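(* Let $u_0\simeq 0.090994\cdots$ be the positive solution of $u+2u\,(e^{4u}-1)\,e^{e^{4u}-1-4u}=\frac{3-\sqrt7}{2}$. Let $(\mathbf f_t,\mathbf z_t)_{t\in[0,T]}$ be a rectifiable path in $\mathscr S_0\setminus\Sigma'$. Let $\mathbf x_0\in\mathscr M$ be an approximation for $\mathbf z_0$ satisfying $$\tfrac12\,\mu(\mathbf f_0,\mathbf z_0)\,\nu(\mathbf z_0)\,\|\mathbf z_0-\mathbf x_0\|_{\mathbf z_0}\le u_0 .$$ Then there is a time mesh $0=t_0<t_1<\cdots<t_N=T$ with $$N\le\left\lceil 38\,\mathscr L\big((\mathbf f_t,\mathbf z_t);0,T\big)\right\rceil$$ so that the approximation $\mathbf x_{i+1}=\mathbf N(\mathbf f_{t_i},\mathbf x_i)$ produces $\mathbf y_0=\mathbf x_N$ with $$\tfrac12\,\mu(\mathbf f_T,\mathbf z_T)\,\nu(\mathbf z_T)\,\|\mathbf z_T-\mathbf y_0\|_{\mathbf z_T}\le u_0$$ for the same constant $u_0$. Moreover, the sequence $\mathbf y_{i+1}=\mathbf N(\mathbf f_T,\mathbf y_i)$ is well-defined and satisfies $$\|\mathbf y_i-\mathbf z_T\|_{\mathbf z_T}\le 2^{-2^i+1}\,\|\mathbf y_0-\mathbf z_T\|_{\mathbf z_T}.$$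
   Context: Spaces. Fix $n\ge1$, finite nonempty sets $A_1,\dots,A_n\subset(\mathbb R^n)^*$ (row vectors; $A_i\subset\mathbb Z^n$ for sparse polynomials), and $\rho_{i,\mathbf a}>0$ for $\mathbf a\in A_i$. $\mathscr F_i=\mathscr F_{A_i}$ is the space of exponential sums $f_i(\mathbf x)=\sum_{\mathbf a\in A_i}f_{i,\mathbf a}\rho_{i,\mathbf a}e^{\mathbf a\mathbf x}$ on $\mathbb C^n$, with $(\rho_{i,\mathbf a}e^{\mathbf a\mathbf x})_{\mathbf a\in A_i}$ orthonormal, so $\|f_i\|^2=\sum_{\mathbf a}|f_{i,\mathbf a}|^2$. $V_i(\mathbf x)\in\mathscr F_i^*$ is evaluation at $\mathbf x$; in dual coordinates $V_i(\mathbf x)=(\rho_{i,\mathbf a}e^{\mathbf a\mathbf x})_{\mathbf a}$ and $\|V_i(\mathbf x)\|^2=K_i(\mathbf x,\mathbf x)=\sum_{\mathbf a}\rho_{i,\mathbf a}^2e^{2\mathbf a\,\mathrm{Re}(\mathbf x)}$. Let $[V]=([V_1],\dots,[V_n]):\mathbb C^n\to\mathbb P(\mathscr F_1^* )\times\cdots\times\mathbb P(\mathscr F_n^* )$, and let $\mathscr M=\mathbb C^n/[V]$ be the quotient identifying points of $\mathbb C^n$ with the same image under $[V]$. Points of $\mathscr M$ are handled through representatives in $\mathbb C^n$; sums and differences are those of $\mathbb C^n$, and in an expression such as $\|\mathbf x-\mathbf z\|_{\mathbf x}$ the representatives are chosen to minimize the norm. Throughout $\mathbf f=(f_1,\dots,f_n)$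 with each $f_i\in\mathscr F_i\setminus\{0\}$; $\mathbf f$ is also regarded as a point of $\mathbb P(\mathscr F_1)\times\cdots\times\mathbb P(\mathscr F_n)$. Momentum and local norms. $\mathbf m_i(\mathbf x)=\frac12D\log K_i(\mathbf x,\mathbf x)=\sum_{\mathbf a}p_{i,\mathbf a}(\mathbf x)\,\mathbf a$ with $p_{i,\mathbf a}(\mathbf x)=\rho_{i,\mathbf a}^2e^{2\mathbf a\mathrm{Re}(\mathbf x)}/K_i(\mathbf x,\mathbf x)$. $\langle\cdot,\cdot\rangle_{i,\mathbf x}$ is the pull-back by $[V_i]$ of the Fubini–Study metric: $\|\mathbf u\|_{i,\mathbf x}^2=\sum_{\mathbf a}p_{i,\mathbf a}(\mathbf x)|(\mathbf a-\mathbf m_i(\mathbf x))\mathbf u|^2$; $\|\mathbf u\|_{\mathbf x}^2=\sum_{i=1}^n\|\mathbf u\|_{i,\mathbf x}^2$. $T_{\mathbf x}\mathscr M$ is $\mathbb C^n$ (modulo the common kernel of these seminorms, which is $0$ when $DS_{\mathbf f,\mathbf x}(0)$ below is invertible for some $\mathbf f$). Newton operator. $S_{\mathbf f,\mathbf x}(\dot{\mathbf x})\in\mathbb C^n$ has $i$-th coordinate $\|W_i(\mathbf x)\|^{-1}W_i(\mathbf x+\dot{\mathbf x})(f_i)$, where $W_i(\mathbf y)=e^{-\mathbf m_i(\mathbf x)\mathbf y}V_i(\mathbf y)$ ($\mathbf x$ fixed), so $W_i(\mathbf y)(f_i)=e^{-\mathbf m_i(\mathbf x)\mathbf y}f_i(\mathbf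 y)$. The Newton operator is $\mathbf N(\mathbf f,\mathbf x)=\mathbf N_{\mathbf f}(\mathbf x)=\mathbf x-DS_{\mathbf f,\mathbf x}(0)^{-1}S_{\mathbf f,\mathbf x}(0)$. Condition numbers. $\mu(\mathbf f,\mathbf x)=\|DS_{\mathbf f,\mathbf x}(0)^{-1}\,\mathrm{diag}(\|f_1\|,\dots,\|f_n\|)\|_{\mathbf x}$, operator norm from $\mathbb C^n$ (canonical norm) to $(T_{\mathbf x}\mathscr M,\|\cdot\|_{\mathbf x})$, and $\mu=\infty$ if $DS_{\mathbf f,\mathbf x}(0)$ is not invertible. $\nu_i(\mathbf x)=\max_{\mathbf a\in A_i}\sup_{\|\mathbf u\|_{i,\mathbf x}\le1}|(\mathbf a-\mathbf m_i(\mathbf x))\mathbf u|$ and $\nu(\mathbf x)=\max_i\nu_i(\mathbf x)$. Solution variety and condition length. $\mathscr S_0=\{(\mathbf f,\mathbf x)\in\mathbb P(\mathscr F_1)\times\cdots\times\mathbb P(\mathscr F_n)\times\mathscr M:\mathbf f(\mathbf x)=0\}$; $\Sigma'$ is the set of pairs with $\mu(\mathbf f,\mathbf x)\nu(\mathbf x)=\infty$. For a path, $$\mathscr L((\mathbf f_t,\mathbf z_t);t_0,t_1)=\int_{t_0}^{t_1}\mu(\mathbf f_t,\mathbf z_t)\,\nu(\mathbf z_t)\sqrt{\|\dot{\mathbf f}_t\|_{\mathbf f_t}^2+\|\dot{\mathbf z}_t\|_{\mathbf z_t}^2}\,dt,$$ where $\|\cdot\|_{\mathbf f}$ is the product Fubini–Study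 norm on the tangent space of $\mathbb P(\mathscr F_1)\times\cdots\times\mathbb P(\mathscr F_n)$ at $[\mathbf f]$.
   Formalization: The bound is N ≤ max(1, ⌈38 L⌉), since a constant path with T>0 has L=0 and no mesh with N=0; and the rectifiable path is taken absolutely continuous in t, as the length integral presupposes (it vanishes for a Cantor-type parametrization). *)

(* Defs.v *)
From HB Require Import structures.
From mathcomp Require Import all_boot all_order all_algebra finmap complex.
From mathcomp Require Import all_classical all_reals all_analysis.
Set Implicit Arguments.
Unset Strict Implicit.
Unset Printing Implicit Defensive.
Import Order.TTheory GRing.Theory Num.Theory.
Import numFieldNormedType.Exports.
Import ComplexField.Normc.
Local Open Scope classical_set_scope.
Local Open Scope ring_scope.
Local Open Scope complex_scope.

Section Complex.
Variable R : realType.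

Definition cexp (z : R[i]) : R[i] :=
  (expR (complex.Re z) * cos (complex.Im z)) +i*
  (expR (complex.Re z) * sin (complex.Im z)).

Definition hnorm (I : finType) (v : I -> R[i]) : R :=
  Num.sqrt (\sum_j normc (v j) ^+ 2).

Definition rowapp (n : nat) (a : 'rV[R]_n) (x : 'cV[R[i]]_n) : R[i] :=
  (map_mx (real_complex R) a *m x) 0 0.

(* At a point where g is not differentiable this is an unspecified value. *)
Definition cderive (g : R -> R[i]) (t : R) : R[i] :=
  ('D_1 (fun s => complex.Re (g s) : R) t) +i*
  ('D_1 (fun s => complex.Im (g s) : R) t).

(* Absolute continuity on [a, b], for families of non-overlapping
   subintervals [l k, r k] listed from left to right. *)
Definition abs_continuous (a b : R) (g : R -> R[i]) : Prop :=
  forall eps : R, 0 < eps -> exists2 delta : R, 0 < delta &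
    forall (m : nat) (l r : 'I_m -> R),
      (forall k, a <= l k /\ l k <= r k /\ r k <= b) ->
      (forall j k : 'I_m, (j < k)%N -> r j <= l k) ->
      \sum_k (r k - l k) < delta ->
      \sum_k normc (g (r k) - g (l k)) < eps.

End Complex.

Section Sparse.
Variables (R : realType) (n : nat) (A : 'I_n -> {fset 'rV[R]_n}).

(* An element of F_i is given by its coordinates (f_{i,a}) in the orthonormal
   basis (rho_{i,a} e^{a x}); elements of the dual F_i^* by dual coordinates.
   Both kinds of tuples have type {ffun A i -> R[i]}. *)
Definition system := forall i : 'I_n, {ffun A i -> R[i]}.

Definition dualapp (i : 'I_n) (w f : {ffun A i -> R[i]}) : R[i] :=
  \sum_a f a * w a.

Variable rho : forall i : 'I_n, A i -> R.

Definition evalV (i : 'I_n) (x : 'cV[R[i]]_n) : {ffun A i -> R[i]} :=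
  [ffun a => (rho a)%:C * cexp (rowapp (val a) x)].

(* The summands of K_i(x,x), with a Re(x) = Re(a x) as a is real. *)
Definition weight (i : 'I_n) (x : 'cV[R[i]]_n) (a : A i) : R :=
  rho a ^+ 2 * expR (2 * complex.Re (rowapp (val a) x)).

Definition kernelK (i : 'I_n) (x : 'cV[R[i]]_n) : R := \sum_a @weight i x a.

Definition prob (i : 'I_n) (x : 'cV[R[i]]_n) (a : A i) : R :=
  weight x a / kernelK i x.

Definition momentum (i : 'I_n) (x : 'cV[R[i]]_n) : 'rV[R]_n :=
  \sum_a @prob i x a *: val a.

Definition normi (i : 'I_n) (x u : 'cV[R[i]]_n) : R :=
  Num.sqrt (\sum_a @prob i x a *
    normc (rowapp (val a - momentum i x) u) ^+ 2).

Definition normx (x u : 'cV[R[i]]_n) : R :=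
  Num.sqrt (\sum_i normi i x u ^+ 2).

(* Points of M are represented by vectors of C^n; M_eq is the relation
   [V](x) = [V](y) defining the quotient M. *)
Definition M_eq (x y : 'cV[R[i]]_n) : Prop :=
  forall i, exists2 c : R[i], c != 0 &
    forall a : A i, evalV i y a = c * evalV i x a.

(* ||x - y||_w for classes x, y in M: minimum over the representatives. *)
Definition M_dist (w x y : 'cV[R[i]]_n) : R :=
  inf [set r | exists x' y', [/\ M_eq x x', M_eq y y' & r = normx w (x' - y')]].

Definition locW (i : 'I_n) (x y : 'cV[R[i]]_n) : {ffun A i -> R[i]} :=
  [ffun a => cexp (- rowapp (momentum i x) y) * evalV i y a].

Definition locS (f : system) (x xdot : 'cV[R[i]]_n) : 'cV[R[i]]_n :=
  \col_i ((hnorm (locW i x x))^-1%:C * dualapp (locW i x (x + xdot)) (f i)).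

(* Complex Jacobian matrix of locS f x at 0.  The type R[i]^o carries the
   normed R[i]-module structure needed by the (complex) derivative. *)
Definition DS (f : system) (x : 'cV[R[i]]_n) : 'M[R[i]]_n :=
  \matrix_(i, j) ('D_(delta_mx j 0)
    (locS f x : 'cV[(R[i])^o]_n -> 'cV[(R[i])^o]_n) 0) i 0.

Definition newton_defined (f : system) (x : 'cV[R[i]]_n) : Prop :=
  DS f x \in unitmx.

(* Meaningful only under newton_defined f x, as invmx is total. *)
Definition newton (f : system) (x : 'cV[R[i]]_n) : 'cV[R[i]]_n :=
  x - invmx (DS f x) *m locS f x 0.

Definition mu (f : system) (x : 'cV[R[i]]_n) : \bar R :=
  if DS f x \in unitmx then
    ereal_sup [set (normx x (invmx (DS f x) *m
                       diag_mx (\row_i (hnorm (f i))%:C) *m v))%:E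
              | v in [set v : 'cV[R[i]]_n | hnorm (fun i => v i 0) <= 1]]
  else +oo%E.

(* The neutral element 0 of the maxima below is harmless: all terms are
   nonnegative. *)
Definition nui (i : 'I_n) (x : 'cV[R[i]]_n) : \bar R :=
  \big[maxe/0%E]_(a : A i)
    ereal_sup [set (normc (rowapp (val a - momentum i x) u))%:E
              | u in [set u : 'cV[R[i]]_n | normi i x u <= 1]].

Definition nu (x : 'cV[R[i]]_n) : \bar R := \big[maxe/0%E]_(i < n) nui i x.

(* (f, x) represents a point of S_0. *)
Definition solution_variety (f : system) (x : 'cV[R[i]]_n) : Prop :=
  (forall i, f i != 0) /\ (forall i, dualapp (evalV i x) (f i) = 0).

Definition Sigma' (f : system) (x : 'cV[R[i]]_n) : Prop :=
  (mu f x * nu x = +oo)%E.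

(* Fubini-Study norm, at [f], of the tangent vector represented by fdot: the
   norm of its component orthogonal to f, divided by the norm of f. *)
Definition fsnormi (i : 'I_n) (f fdot : {ffun A i -> R[i]}) : R :=
  let c := (\sum_a fdot a * conjc (f a)) / (hnorm f ^+ 2)%:C in
  hnorm (fun a => fdot a - c * f a) / hnorm f.

Definition fsnorm (f fdot : system) : R :=
  Num.sqrt (\sum_i fsnormi (f i) (fdot i) ^+ 2).

(* A path in the product of projective spaces times M is given by a path of
   representatives (a lift).  Rectifiable paths are parametrized absolutely
   continuously, so that length is the integral of the speed. *)
Definition rectifiable (f : R -> system) (z : R -> 'cV[R[i]]_n) (a b : R) :
    Prop :=
  (forall (i : 'I_n) (e : A i), abs_continuous a b (fun t => f t i e)) /\
  (forall j : 'I_n, abs_continuous a b (fun t => z t j 0)).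

Definition velocity_f (f : R -> system) (t : R) : system :=
  fun i => [ffun e => cderive (fun s => f s i e) t].

Definition velocity_z (z : R -> 'cV[R[i]]_n) (t : R) : 'cV[R[i]]_n :=
  \col_j cderive (fun s => z s j 0) t.

Definition condition_length (f : R -> system) (z : R -> 'cV[R[i]]_n)
    (t0 t1 : R) : \bar R :=
  (\int[lebesgue_measure]_(t in `[t0, t1])
     (mu (f t) (z t) * nu (z t) *
      (Num.sqrt (fsnorm (f t) (velocity_f f t) ^+ 2 +
                 normx (z t) (velocity_z z t) ^+ 2))%:E))%E.

(* The approximation condition (1/2) mu(f,z) nu(z) ||z - x||_z <= u. *)
Definition approx_cond (u : R) (f : system) (z x : 'cV[R[i]]_n) : Prop :=
  ((2^-1)%:E * mu f z * nu z * (M_dist z z x)%:E <= u%:E)%E.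

End Sparse.

(* Main.v *)
(** The path is cut into pieces of condition length at most 1/38.  Fix the left
    end s of a piece and let D(t) be mu nu, taken at s, times
    sqrt (sum_i sin^2 (f_s, f_t)_i + |z_t - z_s|^2), with norms at z_s.  As long
    as D <= 1/20, condition numbers and local norms at t and at s compare up to
    a factor 8/5, so D(t) is at most 8/5 times the condition length from s to
    t, that is 4/95 < 1/20, and a continuation argument makes this hold along
    the whole piece.  Conversely D <= 4/95 changes mu nu |.| by a factor at most
    3/2.  Combined with the quadratic estimate
    |N(f, x) - z| <= 7/4 mu nu |x - z|^2, valid for mu nu |x - z| <= 5/27, and
    with 1/12 <= u0 < 5/54, the condition mu nu |x - z| <= 2 u0 is passed on from
    each mesh point to the next.

    The paths are only absolutely continuous, so a real function is recovered
    from its derivative through the Radon-Nikodym density of its variation.  The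
    integrand of the condition length is not known to be measurable: the
    integral is a lower integral, of which only comparison with measurable
    functions and additivity on intervals are used. *)

(* Moving [z] to [z + h] multiplies coordinate [a] of [V_i] by [e^{(a - m_i(z)) h}] times a scalar
   common to all [a]. That scalar multiplies row [i] of both [DS] and [S], so it cancels in
   [DS^{-1} S]; what remains is controlled by the single number [tau = nu |h|], which bounds every
   [|(a - m_i(z)) h|]. Hence comparisons between two points are powers of [e^tau], and Newton's step
   and the variation of [mu] are both perturbations of one invertible [DS] at the base point.
   Systems count only up to scalars as well: [g_i] is replaced by its multiple closest to [f_i], at
   distance [|f_i| sin (f_i, g_i)], which is why sines measure the movement of the system. Distances
   in the quotient are infima not known to be attained, so estimates are made for nearly optimal
   representatives with slack [e], and [e] tends to 0. The mesh points come from the intermediate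
   value theorem for the indefinite integral of the condition speed; its continuity, and the
   finiteness of the condition length, follow from a bound on [mu nu] along the path and an
   integrable majorant of the velocities. *)
Require Import Defs.
From HB Require Import structures.
From mathcomp Require Import all_boot all_order all_algebra finmap complex.
From mathcomp Require Import all_classical all_reals all_analysis.
From mathcomp Require Import ring lra measurable_realfun.
Set Implicit Arguments.
Unset Strict Implicit.
Unset Printing Implicit Defensive.
Import Order.TTheory GRing.Theory Num.Theory.
Import numFieldNormedType.Exports.
Import ComplexField.Normc.
Local Open Scope classical_set_scope.
Local Open Scope ring_scope.
Local Open Scope complex_scope.

(** * Complex numbers and the exponential *)

Section ComplexNumbers.
Variable R : realType.
Implicit Types (z w : R[i]) (x y : R).

Lemma normc_sqrE z : normc z ^+ 2 = complex.Re z ^+ 2 + complex.Im z ^+ 2.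
Proof. by case: z => a b /=; rewrite sqr_sqrtr// addr_ge0// sqr_ge0. Qed.

Lemma normc_ge0 z : 0 <= normc z.
Proof. by case: z => a b /=; exact: sqrtr_ge0. Qed.

Lemma normcR x : normc x%:C = `|x|.
Proof. by rewrite /= expr0n addr0 sqrtr_sqr. Qed.

Lemma normc_eq0 z : (normc z == 0) = (z == 0).
Proof. by apply/eqP/eqP => [/eq0_normc//|->]; rewrite normc0. Qed.

Lemma normc_gt0 z : (0 < normc z) = (z != 0).
Proof. by rewrite lt_def normc_ge0 andbT normc_eq0. Qed.

Lemma ReD z w : complex.Re (z + w) = complex.Re z + complex.Re w.
Proof. by case: z; case: w. Qed.

Lemma ImD z w : complex.Im (z + w) = complex.Im z + complex.Im w.
Proof. by case: z; case: w. Qed.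

Lemma ReN z : complex.Re (- z) = - complex.Re z. Proof. by case: z. Qed.

Lemma ImN z : complex.Im (- z) = - complex.Im z. Proof. by case: z. Qed.

Lemma ReM z w : complex.Re (z * w) =
  complex.Re z * complex.Re w - complex.Im z * complex.Im w.
Proof. by case: z; case: w. Qed.

Lemma ImM z w : complex.Im (z * w) =
  complex.Re z * complex.Im w + complex.Im z * complex.Re w.
Proof. by case: z => a b; case: w => c d /=; rewrite (mulrC b). Qed.

Lemma Re_sum (I : Type) (r : seq I) (P : pred I) (F : I -> R[i]) :
  complex.Re (\sum_(i <- r | P i) F i) = \sum_(i <- r | P i) complex.Re (F i).
Proof. by apply: (big_morph _ ReD). Qed.

Lemma Im_sum (I : Type) (r : seq I) (P : pred I) (F : I -> R[i]) :
  complex.Im (\sum_(i <- r | P i) F i) = \sum_(i <- r | P i) complex.Im (F i).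
Proof. by apply: (big_morph _ ImD). Qed.

Lemma ReZ x z : complex.Re (x%:C * z) = x * complex.Re z.
Proof. by rewrite ReM /= mul0r subr0. Qed.

Lemma ImZ x z : complex.Im (x%:C * z) = x * complex.Im z.
Proof. by rewrite ImM /= mul0r addr0. Qed.

Lemma abs_Re_le z : `|complex.Re z| <= normc z.
Proof.
by rewrite -ler_sqr ?nnegrE ?normc_ge0// normc_sqrE real_normK ?num_real//
  lerDl sqr_ge0.
Qed.

Lemma abs_Im_le z : `|complex.Im z| <= normc z.
Proof.
by rewrite -ler_sqr ?nnegrE ?normc_ge0// normc_sqrE real_normK ?num_real//
  lerDr sqr_ge0.
Qed.

Lemma Re_le z : complex.Re z <= normc z.
Proof. exact: le_trans (ler_norm _) (abs_Re_le z). Qed.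

Lemma normc_le_ReIm z : normc z <= `|complex.Re z| + `|complex.Im z|.
Proof.
rewrite -ler_sqr ?nnegrE ?normc_ge0 ?addr_ge0// normc_sqrE.
rewrite sqrrD !real_normK ?num_real// -addrA lerD2l lerDr.
by rewrite mulrn_wge0// mulr_ge0.
Qed.

Lemma normc_conj z : normc (conjc z) = normc z.
Proof. by case: z => a b /=; rewrite sqrrN. Qed.

Lemma normc_sum (I : Type) (r : seq I) (P : pred I) (F : I -> R[i]) :
  normc (\sum_(i <- r | P i) F i) <= \sum_(i <- r | P i) normc (F i).
Proof.
elim/big_ind2: _ => [|a b c d ab cd|//]; first by rewrite normc0.
by apply: le_trans (le_normcD _ _) _; exact: lerD.
Qed.

Lemma cexp0 : cexp (0 : R[i]) = 1.
Proof. by rewrite /cexp /= expR0 cos0 sin0 !mul1r. Qed.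

Lemma cexpD z w : cexp (z + w) = cexp z * cexp w.
Proof.
case: z w => a b [c d]; rewrite /cexp /= expRD cosD sinD.
by congr (_ +i* _); rewrite /=; ring.
Qed.

Lemma cexp_neq0 z : cexp z != 0.
Proof.
apply/eqP => h; have := cexpD z (- z); rewrite h subrr cexp0 mul0r.
by move=> /eqP; rewrite oner_eq0.
Qed.

Lemma normc_cexp z : normc (cexp z) = expR (complex.Re z).
Proof.
rewrite /cexp /=; set e := expR _; set c := cos _; set s := sin _.
have -> : (e * c) ^+ 2 + (e * s) ^+ 2 = e ^+ 2.
  by rewrite !exprMn -mulrDr cos2Dsin2 mulr1.
by rewrite sqrtr_sqr ger0_norm ?expR_ge0.
Qed.

End ComplexNumbers.

(** * Estimates for the real and complex exponential *)

Section ExpEstimates.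
Variable R : realType.
Implicit Types (x y : R).

Lemma expR_sub1_le x : expR x - 1 <= x * expR x.
Proof.
have := expR_ge1Dx (- x); rewrite expRN => h.
rewrite lerBlDr -lerBlDl -[X in X - _]mul1r -mulrBl.
by rewrite -ler_pdivlMr ?expR_gt0// mul1r.
Qed.

Lemma abs_expR_sub1_le x : `|expR x - 1| <= expR `|x| - 1.
Proof.
have [x0|x0] := leP 0 x.
  by rewrite (ger0_norm x0) ger0_norm// subr_ge0 -expR0 ler_expR.
rewrite (ltr0_norm x0) ler0_norm ?subr_le0 ?expR_le1 ?(ltW x0)//.
rewrite opprB expRN.
have e0 := expR_gt0 x.
rewrite -(ler_pM2r e0) mulrBl mulrBl mulVf ?gt_eqF// !mul1r.
(* For negative [x] the claim [1 - e^x <= e^{-x} - 1], multiplied by [e^x], says that this square is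
   nonnegative. *)
have : 0 <= (expR x - 1) ^+ 2 by exact: sqr_ge0.
by rewrite expr2; lra.
Qed.

Lemma abs_expR_sub1_le_mul x : `|expR x - 1| <= `|x| * expR `|x|.
Proof. exact: le_trans (abs_expR_sub1_le x) (expR_sub1_le _). Qed.

Lemma is_derive_ge0_le (F dF : R -> R) (a b : R) : a <= b ->
  (forall x : R, is_derive x (1 : R) F (dF x)) ->
  (forall x, a < x < b -> 0 <= dF x) -> F a <= F b.
Proof.
move=> ab FdF dF0; apply: (@ger0_derive1_ndecr R F a b) => //.
- move=> s; rewrite in_itv /= => sab.
  by rewrite derive1E (@derive_val _ _ _ _ _ _ _ (FdF s)) dF0.
- by apply: derivable_within_continuous => s _; exact: (@ex_derive _ _ _ _ _ _ _ (FdF s)).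
Qed.

Lemma sin_le (x : R) : 0 <= x -> sin x <= x.
Proof.
move=> x0; rewrite -subr_ge0.
have h : 0 - sin 0 <= x - sin x.
  by apply: (@is_derive_ge0_le (fun s => s - sin s) (fun s => 1 - cos s)) => //.
by move: h; rewrite sin0 subr0.
Qed.

Lemma one_sub_cos_le y : 2 * (1 - cos y) <= y ^+ 2.
Proof.
wlog y0 : y / 0 <= y => [h|].
  have [/h//|y0] := leP 0 y.
  by rewrite -cosN -sqrrN h// oppr_ge0 ltW.
pose F (t : R) : R := t ^+ 2 - 2 * (1 - cos t).
suff : F 0 <= F y by rewrite /F cos0 subrr mulr0 subr0 expr0n/= subr_ge0.
apply: (@is_derive_ge0_le _ (fun t => 2 * t - 2 * sin t)) => // t.
  rewrite /F; apply: is_derive_eq.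
  by rewrite /GRing.scale /=; ring.
by move=> /andP[t0 _]; rewrite -mulrBr mulr_ge0// subr_ge0 sin_le// ltW.
Qed.

(** [|e^{x+iy} - 1|^2] equals [(e^x - 1)^2 + 2 e^x (1 - cos y)]; the two summands are at most
    [x^2 e^{2r}] and [y^2 e^{2r}], where [r = |x + iy|]. *)
Lemma normc_cexp_sub1_le (s : R[i]) :
  normc (cexp s - 1) <= normc s * expR (normc s).
Proof.
rewrite -ler_sqr ?nnegrE ?mulr_ge0 ?normc_ge0 ?expR_ge0//.
rewrite exprMn !normc_sqrE; case: s => x y.
set r := normc _; rewrite /cexp /= subr0.
have xr : `|x| <= r by exact: (abs_Re_le (x +i* y)).
have h1 : (expR x - 1) ^+ 2 <= x ^+ 2 * expR r ^+ 2.
  rewrite -[_ ^+ 2]real_normK ?num_real// -[x ^+ 2]real_normK ?num_real// -exprMn.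
  rewrite ler_sqr ?nnegrE ?mulr_ge0 ?expR_ge0//.
  apply: le_trans (abs_expR_sub1_le_mul x) _.
  by rewrite ler_wpM2l// ler_expR.
have h2 : expR x * (2 * (1 - cos y)) <= y ^+ 2 * expR r ^+ 2.
  rewrite mulrC; apply: ler_pM.
  - by rewrite mulr_ge0// subr_ge0 cos_le1.
  - exact: expR_ge0.
  - exact: one_sub_cos_le.
  - rewrite -expRM_natl ler_expR.
    apply: le_trans (ler_norm _) (le_trans xr _).
    by rewrite ler_peMl ?normc_ge0// ler1n.
have -> : (expR x * cos y - 1) ^+ 2 + (expR x * sin y) ^+ 2 =
          (expR x - 1) ^+ 2 + expR x * (2 * (1 - cos y)).
  have h := cos2Dsin2 y.
  rewrite sqrrB exprMn mulr1 exprMn.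
  have -> : sin y ^+ 2 = 1 - cos y ^+ 2 by rewrite -h addrAC subrr add0r.
  by ring.
by rewrite [leRHS]mulrDl; exact: lerD.
Qed.

Lemma scaleRE (x : R) (y : R^o) : x *: y = x * y. Proof. by []. Qed.

Definition cpath_derive (g dg : R -> R[i]) := forall t : R,
  is_derive t (1 : R) (fun t => complex.Re (g t)) (complex.Re (dg t)) /\
  is_derive t (1 : R) (fun t => complex.Im (g t)) (complex.Im (dg t)).

(** Mean value inequality for plane curves: the rotation [u] takes [g 1 - g 0] to the positive real
    axis, so its length is the increment of the real function [Re (u g)], whose derivative is at
    most [dp]. *)
Lemma normc_increment_le (g dg : R -> R[i]) (p dp : R -> R) :
  cpath_derive g dg -> (forall t : R, is_derive t (1 : R) p (dp t)) ->
  (forall t, 0 < t < 1 -> normc (dg t) <= dp t) ->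
  normc (g 1 - g 0) <= p 1 - p 0.
Proof.
move=> gdg pdp gp; set d := g 1 - g 0.
have [d0|d0] := eqVneq d 0.
  rewrite d0 normc0 subr_ge0; apply: (@is_derive_ge0_le _ dp) => // t /gp.
  exact: le_trans (normc_ge0 _).
pose u := conjc d / (normc d)%:C.
have nd : normc d != 0 by rewrite normc_eq0.
have nu : normc u = 1.
  by rewrite normcM normcV normcR ger0_norm ?normc_ge0// normc_conj divff.
pose a := complex.Re u; pose b := complex.Im u.
pose G (t : R) : R :=
  p t - (a * complex.Re (g t) - b * complex.Im (g t)).
have GE t : G t = p t - complex.Re (u * g t) by rewrite ReM.
have : G 0 <= G 1.
  apply: (@is_derive_ge0_le _ (fun t => dp t - complex.Re (u * dg t))); first exact: ler01.
    move=> t; rewrite ReM; have [h1 h2] := gdg t; have h3 := pdp t.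
    exact: is_deriveB.
  move=> t /gp h; rewrite subr_ge0; apply: le_trans (Re_le _) _.
  by rewrite normcM nu mul1r.
rewrite !GE => h.
have -> : normc d = complex.Re (u * g 1) - complex.Re (u * g 0).
  rewrite -ReN -ReD -mulrBr -/d /u mulrAC.
  have -> : conjc d * d = (normc d ^+ 2)%:C.
    by rewrite normc_sqrE; case: (d) => x y; congr (_ +i* _); rewrite /=; ring.
  by rewrite -fmorphV -rmorphM /= expr2 mulfK.
by lra.
Qed.

Lemma is_derive_cexp (s : R[i]) : cpath_derive (fun t => cexp (t%:C * s))
  (fun t => s * cexp (t%:C * s)).
Proof.
move=> t; split.
  rewrite ReM /cexp !ReZ !ImZ /=; under eq_fun do rewrite ReZ ImZ.
  apply: is_derive_eq; rewrite /GRing.scale /=; ring.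
rewrite ImM /cexp !ReZ !ImZ /=; under eq_fun do rewrite ReZ ImZ.
apply: is_derive_eq; rewrite /GRing.scale /=; ring.
Qed.

Let is_derive_half_sqr (c t : R) :
  is_derive t (1 : R) (fun t => t ^+ 2 / 2 * c) (t * c).
Proof. by apply: is_derive_eq; rewrite /GRing.scale /=; field. Qed.

(** Mean value inequality for the curve [e^{ts} - ts], with velocity [s (e^{ts} - 1)], against
    [t^2/2 |s|^2 e^{|s|}]. *)
Lemma normc_cexp_sub1_sub_le (s : R[i]) :
  normc (cexp s - 1 - s) <= normc s ^+ 2 / 2 * expR (normc s).
Proof.
pose c := normc s ^+ 2 * expR (normc s).
have := @normc_increment_le (fun t => cexp (t%:C * s) - t%:C * s)
  (fun t => s * cexp (t%:C * s) - s) (fun t => t ^+ 2 / 2 * c) (fun t => t * c).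
rewrite /= !mul1r mul0r cexp0 subr0 expr0n !mul0r subr0 expr1n addrAC /c.
rewrite -mulrA mul1r (mulrCA _^-1) mulrA; apply => [t|t|t /andP[t0 t1]].
- have [h1 h2] := is_derive_cexp s t; split.
    under eq_fun do rewrite ReD ReN ReZ.
    by rewrite ReD ReN; apply: is_derive_eq; rewrite /GRing.scale /= ?(ReM, ImM); ring.
  under eq_fun do rewrite ImD ImN ImZ.
  by rewrite ImD ImN; apply: is_derive_eq; rewrite /GRing.scale /= ?(ReM, ImM); ring.
- exact: is_derive_half_sqr.
- have -> : s * cexp (t%:C * s) - s = s * (cexp (t%:C * s) - 1) by ring.
  rewrite normcM expr2 -mulrA mulrCA.
  rewrite ler_wpM2l ?normc_ge0//.
  apply: le_trans (normc_cexp_sub1_le _) _.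
  rewrite normcM normcR gtr0_norm// -mulrA ler_wpM2l ?(ltW t0)//.
  by rewrite ler_wpM2l ?normc_ge0// ler_expR ler_piMl ?normc_ge0// ltW.
Qed.

(** The curve [t s e^{ts} - e^{ts}] has velocity [t s^2 e^{ts}], the terms of lower order
    cancelling. The expression is the remainder of Newton's step for a single exponential. *)
Lemma normc_mul_cexp_sub_le (s : R[i]) :
  normc (s * cexp s - cexp s + 1) <= normc s ^+ 2 / 2 * expR (normc s).
Proof.
pose c := normc s ^+ 2 * expR (normc s).
have := @normc_increment_le
  (fun t => t%:C * (s * cexp (t%:C * s)) - cexp (t%:C * s))
  (fun t => t%:C * (s * (s * cexp (t%:C * s))))
  (fun t => t ^+ 2 / 2 * c) (fun t => t * c).
rewrite /= !mul1r !mul0r cexp0 sub0r opprK expr0n !mul0r subr0 expr1n /c.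
rewrite -mulrA mul1r (mulrCA _^-1) mulrA; apply => [t|t|t /andP[t0 t1]].
- have [h1 h2] := is_derive_cexp s t; split.
    under eq_fun do rewrite ReD ReN ReZ ReM.
    rewrite ReZ ReM; apply: is_derive_eq.
    by rewrite !scaleRE !(ReM, ImM); ring.
  under eq_fun do rewrite ImD ImN ImZ ImM.
  rewrite ImZ ImM; apply: is_derive_eq.
  by rewrite !scaleRE !(ReM, ImM); ring.
- exact: is_derive_half_sqr.
- rewrite !normcM normcR gtr0_norm// ler_wpM2l ?(ltW t0)// mulrA -expr2.
  rewrite ler_wpM2l ?sqr_ge0// normc_cexp ler_expR ReZ.
  apply: le_trans (_ : t * normc s <= _); first by rewrite ler_wpM2l ?Re_le// ltW.
  by rewrite ler_piMl ?normc_ge0// ltW.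
Qed.

End ExpEstimates.

Section HermitianNorm.
Variables (R : realType) (I : finType).
Implicit Types (x y : I -> R) (v w : I -> R[i]).

(** Cauchy-Schwarz, obtained termwise from [x y <= (b/a x^2 + a/b y^2) / 2] with [a], [b] the two
    norms; zero vectors are set apart because of the divisions. *)
Lemma sum_mul_le_sqrt x y : \sum_j x j * y j <=
  Num.sqrt (\sum_j x j ^+ 2) * Num.sqrt (\sum_j y j ^+ 2).
Proof.
have null (z : I -> R) : \sum_j z j ^+ 2 = 0 -> forall j, z j = 0.
  move=> /eqP; rewrite psumr_eq0 => [/allP h j|j _]; last exact: sqr_ge0.
  by have := h j (mem_index_enum _); rewrite sqrf_eq0 => /eqP.
set a := Num.sqrt _; set b := Num.sqrt _.
have s0 (z : I -> R) : 0 <= \sum_j z j ^+ 2 by apply: sumr_ge0 => j _; exact: sqr_ge0.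
have [a0|a0] := eqVneq (\sum_j x j ^+ 2) 0.
  rewrite big1 ?mulr_ge0 ?sqrtr_ge0// => j _; by rewrite (null x a0) mul0r.
have [b0|b0] := eqVneq (\sum_j y j ^+ 2) 0.
  rewrite big1 ?mulr_ge0 ?sqrtr_ge0// => j _; by rewrite (null y b0) mulr0.
have ap : 0 < a by rewrite sqrtr_gt0 lt_def a0 s0.
have bp : 0 < b by rewrite sqrtr_gt0 lt_def b0 s0.
have -> : a * b = \sum_j (b / a * x j ^+ 2 + a / b * y j ^+ 2) / 2.
  rewrite -mulr_suml big_split /= -!mulr_sumr.
  rewrite -(sqr_sqrtr (s0 x)) -(sqr_sqrtr (s0 y)) -/a -/b.
  by field; rewrite !gt_eqF.
apply: ler_sum => j _; rewrite ler_pdivlMr ?ltr0n//.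
rewrite -subr_ge0.
have -> : b / a * x j ^+ 2 + a / b * y j ^+ 2 - x j * y j * 2 =
  (a * b)^-1 * (b * x j - a * y j) ^+ 2 by field; rewrite !gt_eqF.
by rewrite mulr_ge0 ?sqr_ge0// invr_ge0 mulr_ge0 ?ltW.
Qed.

Lemma hnorm_ge0 v : 0 <= hnorm v. Proof. exact: sqrtr_ge0. Qed.

Lemma hnorm_sqr v : hnorm v ^+ 2 = \sum_j normc (v j) ^+ 2.
Proof. by rewrite sqr_sqrtr// sumr_ge0// => j _; exact: sqr_ge0. Qed.

Lemma hnorm_eq0 v : hnorm v = 0 -> forall j, v j = 0.
Proof.
move=> h j; have := hnorm_sqr v; rewrite h expr0n => /esym/eqP.
rewrite psumr_eq0 => [/allP/(_ j (mem_index_enum _))|k _]; last exact: sqr_ge0.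
by rewrite sqrf_eq0 normc_eq0 => /eqP.
Qed.

Lemma eq_hnorm v w : v =1 w -> hnorm v = hnorm w.
Proof. by move=> vw; congr Num.sqrt; apply: eq_bigr => j _; rewrite vw. Qed.

Lemma normc_le_hnorm v j : normc (v j) <= hnorm v.
Proof.
rewrite -ler_sqr ?nnegrE ?normc_ge0 ?hnorm_ge0// hnorm_sqr (bigD1 j)//=.
by rewrite lerDl sumr_ge0// => k _; exact: sqr_ge0.
Qed.

Lemma hnorm_le v w (c : R) : 0 <= c ->
  (forall j, normc (v j) <= c * normc (w j)) -> hnorm v <= c * hnorm w.
Proof.
move=> c0 h; rewrite -ler_sqr ?nnegrE ?mulr_ge0 ?hnorm_ge0//.
rewrite exprMn !hnorm_sqr mulr_sumr; apply: ler_sum => j _.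
by rewrite -exprMn ler_sqr ?nnegrE ?mulr_ge0 ?normc_ge0.
Qed.

Lemma hnormZ (c : R[i]) v : hnorm (fun j => c * v j) = normc c * hnorm v.
Proof.
apply/eqP; rewrite -(@eqrXn2 _ 2) ?mulr_ge0 ?hnorm_ge0 ?normc_ge0//.
rewrite exprMn !hnorm_sqr mulr_sumr; apply/eqP; apply: eq_bigr => j _.
by rewrite normcM exprMn.
Qed.

Lemma normc_sum_mul_le v w : normc (\sum_j v j * w j) <= hnorm v * hnorm w.
Proof.
apply: le_trans (normc_sum _ _ _) _.
under eq_bigr do rewrite normcM.
exact: sum_mul_le_sqrt.
Qed.

Lemma hnormD v w : hnorm (fun j => v j + w j) <= hnorm v + hnorm w.
Proof.
rewrite -ler_sqr ?nnegrE ?addr_ge0 ?hnorm_ge0// sqrrD !hnorm_sqr.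
apply: (@le_trans _ _ (\sum_j (normc (v j) + normc (w j)) ^+ 2)).
  apply: ler_sum => j _.
  by rewrite ler_sqr ?nnegrE ?addr_ge0 ?normc_ge0// le_normcD.
under eq_bigr do rewrite sqrrD; rewrite !big_split /= lerD2r lerD2l.
by rewrite mulr2n; apply: lerD; exact: sum_mul_le_sqrt.
Qed.

Lemma hnorm0 v : (forall j, v j = 0) -> hnorm v = 0.
Proof.
move=> h; rewrite /hnorm big1 ?sqrtr0// => j _.
by rewrite h normc0 expr0n.
Qed.

End HermitianNorm.

Section RowApp.
Variables (R : realType) (n : nat).
Implicit Types (a b : 'rV[R]_n) (u v : 'cV[R[i]]_n).

Lemma rowappE a u : rowapp a u = \sum_j (a 0 j)%:C * u j 0.
Proof. by rewrite /rowapp mxE; apply: eq_bigr => j _; rewrite !mxE. Qed.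

Lemma rowappDr a u v : rowapp a (u + v) = rowapp a u + rowapp a v.
Proof. by rewrite /rowapp mulmxDr mxE. Qed.

Lemma rowappZr a c u : rowapp a (c *: u) = c * rowapp a u.
Proof. by rewrite /rowapp -scalemxAr mxE. Qed.

Lemma rowappr0 a : rowapp a 0 = 0 :> R[i].
Proof. by rewrite /rowapp mulmx0 mxE. Qed.

Lemma rowappBl a b u : rowapp (a - b) u = rowapp a u - rowapp b u.
Proof. by rewrite /rowapp map_mxB mulmxBl !mxE. Qed.

Lemma rowapp_suml (I : Type) (r : seq I) (P : pred I) (c : I -> R) (F : I -> 'rV[R]_n) u :
  rowapp (\sum_(i <- r | P i) c i *: F i) u =
  \sum_(i <- r | P i) (c i)%:C * rowapp (F i) u.
Proof.
rewrite rowappE; under [RHS]eq_bigr do rewrite rowappE mulr_sumr.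
rewrite exchange_big /=; apply: eq_bigr => j _.
rewrite summxE rmorph_sum mulr_suml; apply: eq_bigr => k _.
by rewrite mxE rmorphM /= mulrA.
Qed.

End RowApp.

(** * Momentum and local norms *)

Section Momentum.
Variables (R : realType) (n : nat) (A : 'I_n -> {fset 'rV[R]_n}).
Hypothesis A_neq0 : forall i, A i != fset0.
Variable rho : forall i : 'I_n, A i -> R.
Hypothesis rho_gt0 : forall i a, 0 < @rho i a.
Implicit Types (x z h u v : 'cV[R[i]]_n) (i : 'I_n).

(** The logarithmic derivative at [z], along [v], of coordinate [a] of [W_i]. Centring at the
    momentum makes its mean for the weights [prob] vanish ([sum_prob_mform]). *)
Definition mform i z (a : A i) v : R[i] := rowapp (val a - momentum rho i z) v.

Lemma mformD i z (a : A i) u v : mform z a (u + v) = mform z a u + mform z a v.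
Proof. exact: rowappDr. Qed.

Lemma mformZ i z (a : A i) (c : R[i]) u : mform z a (c *: u) = c * mform z a u.
Proof. exact: rowappZr. Qed.

Lemma weight_gt0 i x (a : A i) : 0 < weight rho x a.
Proof. by rewrite /weight mulr_gt0 ?expR_gt0// exprn_gt0. Qed.

Lemma kernelK_gt0 i x : 0 < kernelK rho i x.
Proof.
have [a ai] := fset0Pn _ (A_neq0 i).
rewrite /kernelK (bigD1 [` ai]%fset)//=.
by rewrite ltr_pwDl ?weight_gt0// sumr_ge0// => b _; rewrite ltW ?weight_gt0.
Qed.

Lemma prob_gt0 i x (a : A i) : 0 < prob rho x a.
Proof. by rewrite divr_gt0 ?weight_gt0 ?kernelK_gt0. Qed.

Lemma prob_ge0 i x (a : A i) : 0 <= prob rho x a.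
Proof. exact/ltW/prob_gt0. Qed.

Lemma sum_prob i x : \sum_a @prob _ _ _ rho i x a = 1.
Proof. by rewrite -mulr_suml divff// gt_eqF ?kernelK_gt0. Qed.

Lemma sum_probM i x (c : R) : \sum_(a : A i) prob rho x a * c = c.
Proof. by rewrite -mulr_suml sum_prob mul1r. Qed.

Lemma rowapp_momentum i x v : rowapp (momentum rho i x) v =
  \sum_(a : A i) (prob rho x a)%:C * rowapp (val a) v.
Proof. exact: rowapp_suml. Qed.

Lemma sum_prob_mform i x v : \sum_(a : A i) (prob rho x a)%:C * mform x a v = 0.
Proof.
rewrite /mform; under eq_bigr do rewrite rowappBl mulrBr.
rewrite sumrB -mulr_suml -rowapp_momentum.
by rewrite -rmorph_sum sum_prob mul1r subrr.
Qed.

Lemma sum_prob_mform_Re i x v :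
  \sum_(a : A i) prob rho x a * complex.Re (mform x a v) = 0.
Proof.
have := congr1 (@complex.Re R) (@sum_prob_mform i x v).
by rewrite Re_sum /= => h; rewrite -[RHS]h; apply: eq_bigr => a _; rewrite ReZ.
Qed.

Lemma normi_ge0 i x v : 0 <= normi rho i x v. Proof. exact: sqrtr_ge0. Qed.

Lemma normx_ge0 x v : 0 <= normx rho x v. Proof. exact: sqrtr_ge0. Qed.

Lemma normi_sqr i x v : normi rho i x v ^+ 2 =
  \sum_(a : A i) prob rho x a * normc (mform x a v) ^+ 2.
Proof.
by rewrite sqr_sqrtr// sumr_ge0// => a _; rewrite mulr_ge0 ?prob_ge0 ?sqr_ge0.
Qed.

Lemma normiE i x v : normi rho i x v =
  hnorm (fun a : A i => (Num.sqrt (prob rho x a))%:C * mform x a v).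
Proof.
congr Num.sqrt; apply: eq_bigr => a _.
by rewrite normcM normcR ger0_norm ?sqrtr_ge0// exprMn sqr_sqrtr// prob_ge0.
Qed.

Lemma normxE x v : normx rho x v = hnorm (fun i => (normi rho i x v)%:C).
Proof.
congr Num.sqrt; apply: eq_bigr => i _.
by rewrite normcR ger0_norm ?normi_ge0.
Qed.

Lemma normiD i x u v : normi rho i x (u + v) <= normi rho i x u + normi rho i x v.
Proof.
rewrite !normiE; apply: le_trans (hnormD _ _).
by rewrite le_eqVlt; apply/orP; left; apply/eqP/eq_hnorm => a; rewrite mformD mulrDr.
Qed.

Lemma normiZ i x (c : R[i]) v : normi rho i x (c *: v) = normc c * normi rho i x v.
Proof.
by rewrite !normiE -hnormZ; apply: eq_hnorm => a; rewrite mformZ mulrCA.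
Qed.

Lemma normxZ x (c : R[i]) v : normx rho x (c *: v) = normc c * normx rho x v.
Proof.
rewrite !normxE -[X in X * _](ger0_norm (normc_ge0 c)) -normcR -hnormZ.
by apply: eq_hnorm => i; rewrite normiZ rmorphM.
Qed.

Lemma normi_le_normx i x v : normi rho i x v <= normx rho x v.
Proof.
rewrite normxE; have := normc_le_hnorm (fun i => (normi rho i x v)%:C) i.
by rewrite normcR ger0_norm ?normi_ge0.
Qed.

Lemma normxD x u v : normx rho x (u + v) <= normx rho x u + normx rho x v.
Proof.
rewrite !normxE; apply: le_trans (hnormD _ _).
rewrite -[leRHS]mul1r; apply: hnorm_le => // i.
rewrite mul1r -rmorphD !normcR !ger0_norm ?addr_ge0 ?normi_ge0//.
exact: normiD.
Qed.

Lemma normxN x v : normx rho x (- v) = normx rho x v.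
Proof. by rewrite -scaleN1r normxZ normcN normc1 mul1r. Qed.

Lemma normxB x u v : normx rho x (u - v) <= normx rho x u + normx rho x v.
Proof. by rewrite -(normxN x v); exact: normxD. Qed.

Lemma normx_distC x u v : normx rho x (u - v) = normx rho x (v - u).
Proof. by rewrite -normxN opprB. Qed.

Lemma normx0 x : normx rho x 0 = 0.
Proof. by rewrite -(scale0r 0) normxZ normc0 mul0r. Qed.

Lemma normx_le x z (c : R) u v : 0 <= c ->
  (forall i, normi rho i x u <= c * normi rho i z v) ->
  normx rho x u <= c * normx rho z v.
Proof.
move=> c0 h; rewrite !normxE; apply: hnorm_le => // i.
by rewrite !normcR !ger0_norm ?normi_ge0.
Qed.

(** Cauchy-Schwarz with [prob] split into two square roots, one going to [F], the other to the form;
    as the weights add up to 1, [F] costs no more than its largest value. *)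
Lemma normc_sum_prob_le i x (F : A i -> R[i]) (c : R) v : 0 <= c ->
  (forall a, normc (F a) <= c) ->
  normc (\sum_a (prob rho x a)%:C * (F a * mform x a v)) <= c * normi rho i x v.
Proof.
move=> c0 Fc.
have -> : \sum_a (prob rho x a)%:C * (F a * mform x a v) =
  \sum_a ((Num.sqrt (prob rho x a))%:C * F a) *
         ((Num.sqrt (prob rho x a))%:C * mform x a v).
  apply: eq_bigr => a _; rewrite mulrACA -rmorphM /= -expr2 sqr_sqrtr//.
  exact: prob_ge0.
apply: le_trans (normc_sum_mul_le _ _) _.
rewrite -normiE ler_wpM2r ?normi_ge0//.
rewrite -ler_sqr ?nnegrE ?hnorm_ge0// hnorm_sqr -[leRHS]mul1r -(sum_prob i x).
rewrite mulr_suml; apply: ler_sum => a _.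
rewrite normcM exprMn normcR ger0_norm ?sqrtr_ge0// sqr_sqrtr ?prob_ge0//.
by rewrite ler_wpM2l ?prob_ge0// ler_sqr ?nnegrE ?normc_ge0.
Qed.

(* The mean minimizes the second moment. *)
Lemma normi_sqr_le i x v (c : R[i]) : normi rho i x v ^+ 2 <=
  \sum_(a : A i) prob rho x a * normc (mform x a v - c) ^+ 2.
Proof.
rewrite normi_sqr -subr_ge0 -sumrB.
have -> : \sum_(a : A i) (prob rho x a * normc (mform x a v - c) ^+ 2 -
    prob rho x a * normc (mform x a v) ^+ 2) =
  normc c ^+ 2 - 2 * complex.Re (conjc c * \sum_(a : A i) (prob rho x a)%:C * mform x a v).
  rewrite -[X in X - _](sum_probM i x).
  rewrite mulr_sumr Re_sum mulr_sumr.
  rewrite -sumrB; apply: eq_bigr => a _.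
  rewrite !normc_sqrE; case: c (mform x a v) => [c d] [e f] /=; ring.
by rewrite sum_prob_mform mulr0 /= mulr0 subr0 sqr_ge0.
Qed.

Section Shift.
Variables (i : 'I_n) (z h : 'cV[R[i]]_n) (tau : R).
Hypothesis mform_le : forall a : A i, normc (mform z a h) <= tau.

Let tau_ge0 : 0 <= tau.
Proof.
have [a ai] := fset0Pn _ (A_neq0 i).
exact: le_trans (normc_ge0 _) (mform_le [` ai]%fset).
Qed.

(** The exponential moment of the centred forms. By [kernelK_shift] it is the quotient of the
    kernels at [z + h] and [z], freed from the factor due to the momentum. *)
Definition kshift : R :=
  \sum_(a : A i) prob rho z a * expR (2 * complex.Re (mform z a h)).

Lemma abs_Re_mform_le (a : A i) : `|complex.Re (mform z a h)| <= tau.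
Proof. exact: le_trans (abs_Re_le _) (mform_le a). Qed.

Lemma Re_mform_le (a : A i) : complex.Re (mform z a h) <= tau.
Proof. exact: le_trans (ler_norm _) (abs_Re_mform_le a). Qed.

Lemma Re_mform_ge (a : A i) : - tau <= complex.Re (mform z a h).
Proof. by have := abs_Re_mform_le a; rewrite ler_norml => /andP[]. Qed.

(** Jensen's inequality, in the form [e^x >= 1 + x]: the linear terms have mean zero. *)
Lemma kshift_ge1 : 1 <= kshift.
Proof.
have -> : 1 = \sum_(a : A i) (prob rho z a +
    2 * (prob rho z a * complex.Re (mform z a h))).
  by rewrite big_split /= -mulr_sumr sum_prob_mform_Re sum_prob mulr0 addr0.
apply: ler_sum => a _; rewrite mulrCA -{1}[prob rho z a]mulr1 -mulrDr.
by rewrite ler_wpM2l ?prob_ge0// expR_ge1Dx.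
Qed.

Lemma kshift_gt0 : 0 < kshift.
Proof. exact: lt_le_trans kshift_ge1. Qed.

Lemma kshift_le : kshift <= expR (2 * tau).
Proof.
rewrite -[leRHS](sum_probM i z); apply: ler_sum => a _.
by rewrite ler_wpM2l ?prob_ge0// ler_expR ler_wpM2l// Re_mform_le.
Qed.

Lemma weight_shift (a : A i) : weight rho (z + h) a =
  weight rho z a * expR (2 * complex.Re (mform z a h)) *
  expR (2 * complex.Re (rowapp (momentum rho i z) h)).
Proof.
rewrite /weight rowappDr ReD.
have -> : complex.Re (rowapp (val a) h) =
  complex.Re (mform z a h) + complex.Re (rowapp (momentum rho i z) h).
  by rewrite -ReD /mform rowappBl subrK.
by rewrite !mulrDr !expRD !mulrA.
Qed.

Lemma kernelK_shift : kernelK rho i (z + h) = kernelK rho i z * kshift *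
  expR (2 * complex.Re (rowapp (momentum rho i z) h)).
Proof.
have -> : kernelK rho i z * kshift =
    \sum_(a : A i) weight rho z a * expR (2 * complex.Re (mform z a h)).
  rewrite /kshift mulr_sumr; apply: eq_bigr => a _.
  rewrite /prob mulrA; congr (_ * _).
  by rewrite mulrC divfK// gt_eqF ?kernelK_gt0.
rewrite big_distrl /= {1}/kernelK; apply: eq_bigr => a _.
exact: weight_shift.
Qed.

Lemma prob_shift (a : A i) : prob rho (z + h) a =
  prob rho z a * expR (2 * complex.Re (mform z a h)) / kshift.
Proof.
rewrite /prob kernelK_shift weight_shift.
move: (kernelK rho i z) (kernelK_gt0 i z) kshift kshift_gt0 => K K0 k k0.
move: (expR (2 * complex.Re (mform z a h))) (weight rho z a) => e w.
move: (expR _) (expR_gt0 (2 * complex.Re (rowapp (momentum rho i z) h))) => c c0.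
by field; rewrite !gt_eqF.
Qed.

(** Dividing by [kshift >= 1] costs nothing here. In the reverse bound [prob_le_shift], the upper
    bound [e^{2 tau}] of [kshift] is paid in addition, which doubles the exponent. *)
Lemma prob_shift_le (a : A i) :
  prob rho (z + h) a <= prob rho z a * expR (2 * tau).
Proof.
rewrite prob_shift ler_pdivrMr ?kshift_gt0//.
rewrite -[leRHS]mulrA ler_wpM2l ?prob_ge0//.
apply: le_trans (_ : expR (2 * tau) * 1 <= _).
  by rewrite mulr1 ler_expR ler_wpM2l// Re_mform_le.
by rewrite ler_wpM2l ?expR_ge0 ?kshift_ge1.
Qed.

Lemma prob_le_shift (a : A i) :
  prob rho z a <= prob rho (z + h) a * expR (4 * tau).
Proof.
rewrite prob_shift mulrAC ler_pdivlMr ?kshift_gt0// -[leRHS]mulrA.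
rewrite ler_wpM2l ?prob_ge0//; apply: le_trans kshift_le _.
rewrite -expRD ler_expR.
by have := Re_mform_ge a; lra.
Qed.

(** The difference of the means is the mean of [mform z] under the new weights. As its old mean is
    zero, 1 may be subtracted from the factors [e^{2 Re (mform z a h)}], which leaves factors of
    size at most [e^{2 tau} - 1]. *)
Lemma momentum_shift_le v :
  normc (rowapp (momentum rho i (z + h) - momentum rho i z) v) <=
  (expR (2 * tau) - 1) * normi rho i z v.
Proof.
have -> : rowapp (momentum rho i (z + h) - momentum rho i z) v =
  (kshift^-1)%:C * \sum_(a : A i) (prob rho z a)%:C *
    ((expR (2 * complex.Re (mform z a h)) - 1)%:C * mform z a v).
  have -> : rowapp (momentum rho i (z + h) - momentum rho i z) v =
    (kshift^-1)%:C * \sum_(a : A i) (prob rho z a)%:C *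
      ((expR (2 * complex.Re (mform z a h)))%:C * mform z a v).
    rewrite rowappBl rowapp_momentum mulr_sumr.
    have -> : rowapp (momentum rho i z) v =
      \sum_(a : A i) (prob rho (z + h) a)%:C * rowapp (momentum rho i z) v.
      by rewrite -mulr_suml -rmorph_sum sum_prob mul1r.
    rewrite -sumrB; apply: eq_bigr => a _.
    rewrite -mulrBr -rowappBl -/(mform z a v) prob_shift !rmorphM /=.
    by ring.
  congr (_ * _); rewrite -[LHS]subr0 -[X in _ - X](sum_prob_mform i z v).
  rewrite -sumrB; apply: eq_bigr => a _.
  by rewrite rmorphB /= rmorph1; ring.
rewrite normcM normcR ger0_norm ?invr_ge0 ?(ltW kshift_gt0)//.
rewrite ler_pdivrMl ?kshift_gt0//.
have e0 : 0 <= expR (2 * tau) - 1.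
  by rewrite subr_ge0 -expR0 ler_expR mulr_ge0.
apply: (@le_trans _ _ ((expR (2 * tau) - 1) * normi rho i z v)).
  apply: normc_sum_prob_le => // a; rewrite normcR.
  apply: le_trans (abs_expR_sub1_le _) _.
  rewrite lerD2r ler_expR normrM ger0_norm// ler_wpM2l//.
  exact: abs_Re_mform_le.
by rewrite ler_peMl ?kshift_ge1// mulr_ge0 ?normi_ge0.
Qed.

Lemma mform_shift (a : A i) v : mform (z + h) a v =
  mform z a v - rowapp (momentum rho i (z + h) - momentum rho i z) v.
Proof. by rewrite /mform -rowappBl; congr rowapp; rewrite opprB addrA subrK. Qed.

(** The second moment about the old momentum dominates the one about the new momentum
    ([normi_sqr_le]), so only the change of weights counts: [e^{2 tau}] for the squares. The reverse
    comparison is alike. *)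
Lemma normi_shift_le v : normi rho i (z + h) v <= expR tau * normi rho i z v.
Proof.
rewrite -ler_sqr ?nnegrE ?mulr_ge0 ?expR_ge0 ?normi_ge0// exprMn.
pose c := - rowapp (momentum rho i (z + h) - momentum rho i z) v.
apply: le_trans (normi_sqr_le i (z + h) v c) _.
rewrite normi_sqr mulr_sumr -expRM_natl; apply: ler_sum => a _.
rewrite mform_shift /c addrK [leRHS]mulrA (mulrC (expR _)).
by rewrite ler_wpM2r ?sqr_ge0// prob_shift_le.
Qed.

Lemma normi_le_shift v : normi rho i z v <= expR (2 * tau) * normi rho i (z + h) v.
Proof.
rewrite -ler_sqr ?nnegrE ?mulr_ge0 ?expR_ge0 ?normi_ge0// exprMn.
pose c := rowapp (momentum rho i (z + h) - momentum rho i z) v.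
apply: le_trans (normi_sqr_le i z v c) _.
rewrite normi_sqr mulr_sumr -expRM_natl; apply: ler_sum => a _.
rewrite -mform_shift [leRHS]mulrA (mulrA 2) -natrM (mulrC (expR _)).
by rewrite ler_wpM2r ?sqr_ge0// prob_le_shift.
Qed.

End Shift.

End Momentum.

(** * The Jacobian and the condition numbers *)

Section Jacobian.
Variables (R : realType) (n : nat) (A : 'I_n -> {fset 'rV[R]_n}).
Variable rho : forall i : 'I_n, A i -> R.
Implicit Types (f : system A) (x z h u v : 'cV[R[i]]_n) (i : 'I_n).

(** The scalar that turns [V_i(x)] into the unit vector [W_i(x) / |W_i(x)|]; its modulus is
    [K_i(x,x)^{-1/2}]. *)
Definition normfac i x : R[i] :=
  (hnorm (locW rho i x x))^-1%:C * cexp (- rowapp (momentum rho i x) x).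

Definition coefV f x i (a : A i) : R[i] := f i a * evalV rho i x a.

Lemma locSE f x u i : locS rho f x u i 0 =
  normfac i x * \sum_(a : A i) coefV f x a * cexp (mform rho x a u).
Proof.
rewrite mxE /normfac -mulrA; congr (_ * _).
rewrite /dualapp mulr_sumr; apply: eq_bigr => a _.
rewrite !ffunE /coefV ffunE.
have -> : - rowapp (momentum rho i x) (x + u) = - rowapp (momentum rho i x) x +
    - rowapp (momentum rho i x) u by rewrite rowappDr opprD.
rewrite rowappDr !cexpD /mform rowappBl cexpD.
by ring.
Qed.

Lemma cexp_quotient_le (s t : R[i]) : t != 0 -> normc t <= 1 ->
  normc (s - t^-1 * (cexp (t * s) - 1)) <=
  normc t * (normc s ^+ 2 * expR (normc s)).
Proof.
move=> t0 t1.
have -> : s - t^-1 * (cexp (t * s) - 1) = - (t^-1 * (cexp (t * s) - 1 - t * s)).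
  by field.
rewrite normcN normcM normcV ler_pdivrMl ?normc_gt0//.
apply: le_trans (normc_cexp_sub1_sub_le _) _.
have : normc (t * s) <= normc s.
  by rewrite normcM ler_piMl ?normc_ge0.
rewrite -ler_expR => h.
move: h (expR_gt0 (normc (t * s))); rewrite {3}normcM.
move: (expR (normc (t * s))) (expR (normc s)) => E1 E2 h E0.
move: (normc t) (normc s) => p q.
have -> : (p * q) ^+ 2 / 2 * E1 = (p * q) ^+ 2 * (E1 / 2) by ring.
have -> : p * (p * (q ^+ 2 * E2)) = (p * q) ^+ 2 * E2 by ring.
by rewrite ler_wpM2l ?sqr_ge0//; lra.
Qed.

Lemma cexp_sum_quotient_le (I : finType) (c l1 l0 t : R[i]) (k s : I -> R[i]) :
  t != 0 -> normc t <= 1 ->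
  l1 = c * (\sum_a k a * cexp (t * s a)) -> l0 = c * (\sum_a k a) ->
  normc (c * (\sum_a k a * s a) - t^-1 * (l1 - l0)) <=
  normc t * \sum_a normc (c * k a) * (normc (s a) ^+ 2 * expR (normc (s a))).
Proof.
move=> t0 t1 -> ->.
have -> (S S1 S0 : R[i]) :
  c * S - t^-1 * (c * S1 - c * S0) = c * (S - t^-1 * (S1 - S0)) by ring.
rewrite -sumrB !mulr_sumr -sumrB mulr_sumr.
apply: le_trans (normc_sum _ _ _) _.
apply: ler_sum => a _.
have -> : c * (k a * s a - t^-1 * (k a * cexp (t * s a) - k a)) =
  (c * k a) * (s a - t^-1 * (cexp (t * s a) - 1)) by ring.
rewrite normcM [leRHS]mulrCA ler_wpM2l ?normc_ge0//.
exact: cexp_quotient_le.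
Qed.

(** The derivative is found from its definition as a limit: by [cexp_sum_quotient_le] the difference
    quotient in component [k] misses the limit by at most [|t| C k], with [C k] independent of
    [t]. *)
Lemma DS_entry f x i j : DS rho f x i j =
  normfac i x * \sum_(a : A i) coefV f x a * mform rho x a (delta_mx j 0).
Proof.
pose L : 'cV[(R[i])^o]_n := \col_i (normfac i x *
  \sum_(a : A i) coefV f x a * mform rho x a (delta_mx j 0)).
rewrite mxE.
suff -> : 'D_(delta_mx j 0)
    (locS rho f x : 'cV[(R[i])^o]_n -> 'cV[(R[i])^o]_n) 0 = L by rewrite mxE.
apply/cvg_lim => //; apply/cvgrPdist_le => /= e e0.
pose C i : R := \sum_(a : A i) normc (normfac i x * coefV f x a) *
  (normc (mform rho x a (delta_mx j 0)) ^+ 2 *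
   expR (normc (mform rho x a (delta_mx j 0)))).
have C0 k : 0 <= C k.
  by apply: sumr_ge0 => a _; rewrite !mulr_ge0 ?normc_ge0 ?expR_ge0.
(* A common bound for all components; the 1 keeps it positive, as it divides the tolerance. *)
pose D : R := 1 + \sum_i C i.
have D0 : 0 < D by rewrite ltr_pwDl ?sumr_ge0.
have CD k : C k <= D.
  rewrite /D (bigD1 k)//= addrCA lerDl addr_ge0// sumr_ge0// => *; exact: C0.
(* Positive elements of [R[i]] are real, so the tolerance is replaced by its real part. *)
have [eR eI] : 0 < complex.Re e /\ e = (complex.Re e)%:C.
  by case: (e) e0 => a b; rewrite ltcE /= => /andP[/eqP -> ->].
near=> t.
have t0 : t != 0.
  by near: t; exact: (@nbhs_dnbhs_neq (R[i])^o 0).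
have tn : normc t <= Num.min 1 (complex.Re e / D).
  rewrite -lecR.
  have : `|t| <= (Num.min 1 (complex.Re e / D))%:C.
    near: t; apply: (@dnbhs0_le _ (R[i])^o); rewrite ltcR lt_min ltr01 /=.
    by rewrite divr_gt0.
  by rewrite normc_def; case: (t).
have [t1 tD] : normc t <= 1 /\ normc t <= complex.Re e / D.
  by move: tn; rewrite le_min => /andP.
set Q := L - _.
have entry k : normc (Q k 0) <= complex.Re e.
  pose l1 := locS rho f x (t *: delta_mx j 0 + 0) k 0.
  pose l0 := locS rho f x 0 k 0.
  have e1 : l1 = normfac k x * \sum_(a : A k) coefV f x a *
      cexp (t * mform rho x a (delta_mx j 0)).
    rewrite /l1 locSE; congr (_ * _); apply: eq_bigr => a _.
    by rewrite mformD mformZ [mform _ _ _ 0]rowappr0 addr0.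
  have e0' : l0 = normfac k x * \sum_(a : A k) coefV f x a.
    rewrite /l0 locSE; congr (_ * _); apply: eq_bigr => a _.
    by rewrite [mform _ _ _ 0]rowappr0 cexp0 mulr1.
  have -> : Q k 0 = normfac k x * (\sum_(a : A k) coefV f x a *
      mform rho x a (delta_mx j 0)) - t^-1 * (l1 - l0).
    rewrite /Q /L /l1 /l0.
    move: (locS rho f x (t *: delta_mx j 0 + 0)) (locS rho f x 0) => M1 M0.
    by rewrite !mxE.
  apply: le_trans (cexp_sum_quotient_le t0 t1 e1 e0') _.
  apply: le_trans (ler_pM (normc_ge0 _) (C0 k) tD (CD k)) _.
  by rewrite divfK ?gt_eqF.
rewrite eI {1}/Num.Def.normr /=.
have [->|] := eqVneq (mx_norm Q) 0; first by rewrite ler0c ltW.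
move=> /mx_norm_neq0[[k l] ->] /=.
by rewrite (ord1 l) normc_def lecR; have := entry k; case: (Q k 0).
Unshelve. all: by end_near. Qed.

Lemma DS_mul f x v i : (DS rho f x *m v) i 0 =
  normfac i x * \sum_(a : A i) coefV f x a * mform rho x a v.
Proof.
rewrite mxE; under eq_bigr do rewrite DS_entry -mulrA mulr_suml.
rewrite -mulr_sumr exchange_big /=; congr (_ * _); apply: eq_bigr => a _.
under eq_bigr do rewrite -mulrA.
rewrite -mulr_sumr; congr (_ * _).
rewrite /mform [RHS]rowappE; apply: eq_bigr => j _.
move: (val a - _) => b.
rewrite rowappE (bigD1 j)//= mxE !eqxx mulr1 big1 ?addr0// => k kj.
by rewrite mxE (negbTE kj) mulr0.
Qed.

End Jacobian.

(** * The condition numbers as real numbers *)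

Section Suprema.
Variable R : realType.

(** The extended suprema behind [mu] and [nu] enter the sequel only through a real [m] with the two
    properties of a least upper bound. *)
Lemma ereal_sup_image_fin (T : Type) (P : set T) (F : T -> R) (v0 : T) (M : R) :
  P v0 -> (forall v, P v -> F v <= M) ->
  exists m : R, [/\ ereal_sup [set (F v)%:E | v in P] = m%:E,
    forall v, P v -> F v <= m &
    forall M', (forall v, P v -> F v <= M') -> m <= M'].
Proof.
move=> Pv0 FM; set S := [set _ | _ in _].
have ub M' : (forall v, P v -> F v <= M') -> (ereal_sup S <= M'%:E)%E.
  by move=> h; apply: ge_ereal_sup => _ [v Pv <-]; rewrite lee_fin h.
have lb v : P v -> ((F v)%:E <= ereal_sup S)%E.
  by move=> Pv; apply: ereal_sup_ubound; exists v.
have fin : ereal_sup S \is a fin_num.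
  rewrite fin_numElt (lt_le_trans (ltNyr (F v0)) (lb _ Pv0)) /=.
  by rewrite (le_lt_trans (ub _ FM)) ?ltry.
exists (fine (ereal_sup S)); split; first by rewrite fineK.
- by move=> v /lb h; rewrite -lee_fin fineK.
- by move=> M' /ub h; rewrite -lee_fin fineK.
Qed.

Lemma bigmaxe_EFin (I : finType) (G : I -> \bar R) (g : I -> R) :
  (forall a, G a = (g a)%:E) ->
  (\big[maxe/0%E]_a G a = (\big[Num.max/0]_a g a)%:E)%E.
Proof.
move=> h; under eq_bigr do rewrite h.
by apply/esym; apply: (big_morph EFin) => // x y; rewrite EFin_max.
Qed.

End Suprema.

(* Locked: unifying two unfolded condition numbers is hopelessly slow. *)
HB.lock Definition muR (R : realType) (n : nat) (A : 'I_n -> {fset 'rV[R]_n})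
  (rho : forall i : 'I_n, A i -> R) (f : system A) (x : 'cV[R[i]]_n) : R :=
  fine (mu rho f x).

HB.lock Definition nuR (R : realType) (n : nat) (A : 'I_n -> {fset 'rV[R]_n})
  (rho : forall i : 'I_n, A i -> R) (x : 'cV[R[i]]_n) : R := fine (nu rho x).

Section Normalization.
Variables (R : realType) (n : nat) (A : 'I_n -> {fset 'rV[R]_n}).
Hypothesis A_neq0 : forall i, A i != fset0.
Variable rho : forall i : 'I_n, A i -> R.
Hypothesis rho_gt0 : forall i a, 0 < @rho i a.
Implicit Types (f : system A) (x z h u v : 'cV[R[i]]_n) (i : 'I_n).

Let prob_ge0 := prob_ge0 A_neq0 rho_gt0.
Let kernelK_gt0 := kernelK_gt0 A_neq0 rho_gt0.

Lemma normc_evalV_sqr i x (a : A i) : normc (evalV rho i x a) ^+ 2 = weight rho x a.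
Proof.
rewrite ffunE normcM normcR normc_cexp exprMn real_normK ?num_real//.
by rewrite -expRM_natl.
Qed.

Lemma hnorm_locW_sqr i x : hnorm (locW rho i x x) ^+ 2 =
  normc (cexp (- rowapp (momentum rho i x) x)) ^+ 2 * kernelK rho i x.
Proof.
rewrite hnorm_sqr /kernelK mulr_sumr; apply: eq_bigr => a _.
by rewrite ffunE normcM exprMn normc_evalV_sqr.
Qed.

Lemma normc_normfac_sqr i x : normc (normfac rho i x) ^+ 2 = (kernelK rho i x)^-1.
Proof.
rewrite /normfac normcM normcR ger0_norm ?invr_ge0 ?hnorm_ge0//.
rewrite exprMn exprVn hnorm_locW_sqr.
have K0 := kernelK_gt0 i x.
move: (kernelK rho i x) K0 => K K0.
have := cexp_neq0 (- rowapp (momentum rho i x) x); rewrite -normc_eq0.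
by move: (normc _) => c c0; field; rewrite c0 gt_eqF.
Qed.

Lemma normfac_neq0 i x : normfac rho i x != 0.
Proof.
rewrite -normc_eq0 -sqrf_eq0 normc_normfac_sqr invr_eq0 gt_eqF//.
Qed.

(** The unit vector [W_i(z) / |W_i(z)|]. The squared moduli of its coordinates are the weights
    [prob], which links the rows of [DS] to the local norms. *)
Definition unitV i z (a : A i) : R[i] := normfac rho i z * evalV rho i z a.

Lemma normc_unitV_sqr i z (a : A i) : normc (unitV z a) ^+ 2 = prob rho z a.
Proof.
by rewrite normcM exprMn normc_normfac_sqr normc_evalV_sqr mulrC.
Qed.

Lemma DS_mulE f z v i : (DS rho f z *m v) i 0 =
  \sum_(a : A i) f i a * (unitV z a * mform rho z a v).
Proof.
rewrite DS_mul mulr_sumr; apply: eq_bigr => a _.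
by rewrite /coefV /unitV; ring.
Qed.

Lemma locS0E f z i : locS rho f z 0 i 0 = \sum_(a : A i) f i a * unitV z a.
Proof.
rewrite locSE mulr_sumr; apply: eq_bigr => a _.
by rewrite [mform _ _ _ 0]rowappr0 cexp0 /coefV /unitV; ring.
Qed.

Lemma dualapp_unitV f z i : dualapp (evalV rho i z) (f i) = 0 ->
  \sum_(a : A i) f i a * unitV z a = 0.
Proof.
move=> h; rewrite -[RHS](mulr0 (normfac rho i z)) -[X in _ = _ * X]h mulr_sumr.
by apply: eq_bigr => a _; rewrite /unitV mulrCA.
Qed.

(** Cauchy-Schwarz, where [|unitV|] is the square root of [prob]. The estimates on rows of [DS] and
    [S] below are instances, for various [F]. *)
Lemma row_le i z v (F : A i -> R[i]) (g : A i -> R[i]) (c : R) : 0 <= c ->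
  (forall a, normc (F a) <= c * normc (mform rho z a v)) ->
  normc (\sum_(a : A i) g a * (unitV z a * F a)) <= hnorm g * (c * normi rho i z v).
Proof.
move=> c0 Fc; apply: le_trans (normc_sum_mul_le _ _) _.
rewrite ler_wpM2l ?hnorm_ge0// normiE//; apply: hnorm_le => // a.
rewrite (normcM (unitV z a)) (normcM (Num.sqrt _)%:C) normcR.
rewrite -normc_unitV_sqr sqrtr_sqr normr_id ger0_norm ?normc_ge0// mulrCA.
by rewrite ler_wpM2l ?normc_ge0.
Qed.

(** The scalar common to all coordinates when the unit vector moves from [z] to [z + h], see
    [unitV_shift]; its squared modulus is [1 / kshift]. *)
Definition shiftfac i z h : R[i] := normfac rho i (z + h) *
  cexp (rowapp (momentum rho i z) h) / normfac rho i z.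

Lemma shiftfac_neq0 i z h : shiftfac i z h != 0.
Proof.
apply: mulf_neq0; last by rewrite invr_eq0 normfac_neq0.
by apply: mulf_neq0; [exact: normfac_neq0|exact: cexp_neq0].
Qed.

Lemma unitV_shift i z h (a : A i) : unitV (z + h) a =
  shiftfac i z h * (unitV z a * cexp (mform rho z a h)).
Proof.
rewrite /unitV /shiftfac.
have -> : evalV rho i (z + h) a = evalV rho i z a *
    (cexp (rowapp (momentum rho i z) h) * cexp (mform rho z a h)).
  rewrite !ffunE rowappDr cexpD -mulrA; congr (_ * (_ * _)).
  by rewrite -cexpD /mform rowappBl addrC subrK.
move: (normfac_neq0 i z) (normfac _ _ (z + h)) (evalV _ _ _ _) => h0 c e.
by field.
Qed.

Lemma normc_shiftfac_sqr i z h : normc (shiftfac i z h) ^+ 2 = (kshift rho i z h)^-1.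
Proof.
rewrite /shiftfac (normcM (_ * _)) (normcM (normfac _ _ _)) normcV !exprMn exprVn.
rewrite !normc_normfac_sqr normc_cexp.
rewrite kernelK_shift//.
have K0 := kernelK_gt0 i z; have k0 := kshift_gt0 A_neq0 rho_gt0 i z h.
rewrite -expRM_natl; have e0 := expR_gt0 (2 * complex.Re (rowapp (momentum rho i z) h)).
move: (expR _) (kernelK _ _ _) (kshift _ _ _ _) e0 K0 k0 => e K k e0 K0 k0.
by field; rewrite !gt_eqF.
Qed.

Lemma normx_sum x (I : Type) (r : seq I) (P : pred I) (F : I -> 'cV[R[i]]_n) :
  normx rho x (\sum_(j <- r | P j) F j) <= \sum_(j <- r | P j) normx rho x (F j).
Proof.
elim/big_ind2: _ => [|a b c d ab cd|//]; first by rewrite normx0.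
by apply: le_trans (normxD _ _ _ _ _) _ => //; exact: lerD.
Qed.

Lemma normx_mulmx_bounded x (B : 'M[R[i]]_n) : exists2 C : R, 0 <= C &
  forall v, normx rho x (B *m v) <= C * hnorm (fun i => v i 0).
Proof.
exists (\sum_j normx rho x (B *m delta_mx j 0)).
  by apply: sumr_ge0 => j _; exact: normx_ge0.
move=> v.
have -> : B *m v = \sum_j v j 0 *: (B *m delta_mx j 0).
  rewrite [v in LHS](matrix_sum_delta v) mulmx_sumr; apply: eq_bigr => j _.
  by rewrite big_ord1 -scalemxAr.
apply: le_trans (normx_sum _ _ _ _) _; rewrite mulr_suml; apply: ler_sum => j _.
rewrite normxZ// mulrC ler_wpM2l ?normx_ge0//.
exact: (normc_le_hnorm (fun i => v i 0)).
Qed.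

(** The supremum is finite by [normx_mulmx_bounded], and homogeneity extends the bound from the unit
    ball to every vector. The last clause serves to bound [mu] at a neighbouring point from
    above. *)
Lemma mu_unit f x : DS rho f x \in unitmx ->
  [/\ mu rho f x = (muR rho f x)%:E, 0 <= muR rho f x,
    forall v, normx rho x (invmx (DS rho f x) *m
       diag_mx (\row_i (hnorm (f i))%:C) *m v) <= muR rho f x * hnorm (fun i => v i 0) &
    forall M, 0 <= M -> (forall v, normx rho x (invmx (DS rho f x) *m
       diag_mx (\row_i (hnorm (f i))%:C) *m v) <= M * hnorm (fun i => v i 0)) ->
      muR rho f x <= M].
Proof.
move=> fx; rewrite muR.unlock /mu fx.
set B := _ *m diag_mx _.
have [C C0 BC] := normx_mulmx_bounded x B.
have hn0 : hnorm (fun i => (0 : 'cV[R[i]]_n) i 0) = 0.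
  by apply: hnorm0 => j; rewrite mxE.
have [||m [-> ub lub]] := @ereal_sup_image_fin R _
  [set v : 'cV[R[i]]_n | hnorm (fun i => v i 0) <= 1]
  (fun v => normx rho x (B *m v)) 0 C.
- by rewrite /= hn0.
- move=> v /= v1; apply: le_trans (BC v) _.
  by rewrite -[leRHS]mulr1 ler_wpM2l.
have m0 : 0 <= m.
  have := ub 0; rewrite /= hn0 mulmx0 normx0// => h; exact: h.
split=> //=.
- move=> v; have [v0|v0] := eqVneq (hnorm (fun i => v i 0)) 0.
    have -> : v = 0 by apply/colP => j; rewrite (hnorm_eq0 v0) mxE.
    by rewrite mulmx0 normx0// mulr_ge0 ?hnorm_ge0.
  have vp : 0 < hnorm (fun i => v i 0) by rewrite lt_def v0 hnorm_ge0.
  have := ub ((hnorm (fun i => v i 0))^-1%:C *: v).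
  rewrite -scalemxAr normxZ// normcR ger0_norm ?invr_ge0 ?(ltW vp)//.
  rewrite ler_pdivrMl// mulrC; apply; rewrite /=.
  have -> : hnorm (fun i => ((hnorm (fun i => v i 0))^-1%:C *: v) i 0) =
    hnorm (fun i => (hnorm (fun i => v i 0))^-1%:C * v i 0).
    by apply: eq_hnorm => j; rewrite mxE.
  by rewrite /= hnormZ normcR ger0_norm ?invr_ge0 ?(ltW vp)// mulVf.
- move=> M M0 h; apply: lub => v /= v1; apply: le_trans (h v) _.
  by rewrite -[leRHS]mulr1 ler_wpM2l.
Qed.

Lemma hnorm_ffun_eq0 i (k : {ffun A i -> R[i]}) : (hnorm k == 0) = (k == 0).
Proof.
apply/eqP/eqP => [h0|->]; first by apply/ffunP => a; rewrite ffunE (hnorm_eq0 h0).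
by apply: hnorm0 => a; rewrite ffunE.
Qed.

(** Dividing row [i] by [|f_i|] absorbs the diagonal factor in [mu]; row bounds relative to [|f_i|]
    are thus what [mu] converts into a bound on [DS^{-1} b]. *)
Lemma muR_le_hnorm f x (b : 'cV[R[i]]_n) (t : 'I_n -> R) : DS rho f x \in unitmx ->
  (forall i, f i != 0) ->
  (forall i, normc (b i 0) <= hnorm (f i) * t i) ->
  normx rho x (invmx (DS rho f x) *m b) <= muR rho f x * hnorm (fun i => (t i)%:C).
Proof.
move=> fx f0 hb; have [_ mu0 hmu _] := mu_unit fx.
have hf i : hnorm (f i) != 0 by rewrite hnorm_ffun_eq0.
have hf0 i : 0 < hnorm (f i) by rewrite lt_def hf hnorm_ge0.
pose w : 'cV[R[i]]_n := \col_i ((hnorm (f i))^-1%:C * b i 0).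
have -> : b = diag_mx (\row_i (hnorm (f i))%:C) *m w.
  apply/colP => j; rewrite mul_diag_mx !mxE mulrA -rmorphM /= divff//.
  by rewrite mul1r.
rewrite mulmxA; apply: le_trans (hmu w) _.
rewrite ler_wpM2l// -[leRHS]mul1r; apply: hnorm_le => // i.
rewrite mxE normcM !normcR ger0_norm ?invr_ge0 ?hnorm_ge0// mul1r.
rewrite ler_pdivrMl//; apply: le_trans (hb i) _.
by rewrite ler_wpM2l ?hnorm_ge0// ler_norm.
Qed.

Lemma muR_le f x (b : 'cV[R[i]]_n) z v (k : R) : DS rho f x \in unitmx ->
  (forall i, f i != 0) -> 0 <= k ->
  (forall i, normc (b i 0) <= hnorm (f i) * (k * normi rho i z v)) ->
  normx rho x (invmx (DS rho f x) *m b) <= muR rho f x * (k * normx rho z v).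
Proof.
move=> fx f0 k0 hb; have [_ mu0 _ _] := mu_unit fx.
apply: le_trans (muR_le_hnorm fx f0 hb) _.
rewrite ler_wpM2l// normxE; apply: hnorm_le => // i.
by rewrite !normcR !ger0_norm ?mulr_ge0 ?normi_ge0.
Qed.

(** Every exponent has positive weight, so [|(a - m) v| <= prob^{-1/2} |v|_i]; this makes all the
    suprema finite. *)
Lemma nu_fin x : [/\ nu rho x = (nuR rho x)%:E, 0 <= nuR rho x,
  forall i (a : A i) v, normc (mform rho x a v) <= nuR rho x * normi rho i x v &
  forall c, 0 <= c -> (forall i (a : A i) v,
    normc (mform rho x a v) <= c * normi rho i x v) -> nuR rho x <= c].
Proof.
have base i (a : A i) v :
    normc (mform rho x a v) <= (Num.sqrt (prob rho x a))^-1 * normi rho i x v.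
  rewrite ler_pdivlMl ?sqrtr_gt0 ?prob_gt0// normiE//.
  have := normc_le_hnorm (fun a : A i => (Num.sqrt (prob rho x a))%:C * mform rho x a v) a.
  by rewrite normcM normcR ger0_norm ?sqrtr_ge0.
have supP i (a : A i) : exists m : R, [/\ ereal_sup
   [set (normc (rowapp (val a - momentum rho i x) u))%:E
     | u in [set u : 'cV[R[i]]_n | normi rho i x u <= 1]] = m%:E, 0 <= m,
   forall v, normc (mform rho x a v) <= m * normi rho i x v &
   forall c, 0 <= c -> (forall v,
    normc (mform rho x a v) <= c * normi rho i x v) -> m <= c].
  have n0 : normi rho i x 0 = 0.
    by rewrite -(scale0r 0) normiZ// normc0 mul0r.
  have [||m [mE ub lub]] := @ereal_sup_image_fin R _
    [set u : 'cV[R[i]]_n | normi rho i x u <= 1]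
    (fun u => normc (mform rho x a u)) 0 (Num.sqrt (prob rho x a))^-1.
  - by rewrite /= n0.
  - move=> v /= v1; apply: le_trans (base i a v) _.
    by rewrite -[leRHS]mulr1 ler_wpM2l ?invr_ge0 ?sqrtr_ge0.
  have m0 : 0 <= m by apply: le_trans (ub 0 _); rewrite ?normc_ge0//= n0.
  exists m; split => //.
  (* Where the seminorm vanishes the form vanishes too, by [base]; elsewhere [v] is normalized. *)
  - move=> v; have [v0|v0] := eqVneq (normi rho i x v) 0.
      by have := base i a v; rewrite v0 !mulr0.
    have vp : 0 < normi rho i x v by rewrite lt_def v0 normi_ge0.
    have := ub ((normi rho i x v)^-1%:C *: v).
    rewrite /= normiZ// mformZ normcM normcR ger0_norm ?invr_ge0 ?(ltW vp)//.
    by rewrite mulVf// lexx ler_pdivrMl// mulrC; apply.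
  - move=> c c0 h; apply: lub => v /= v1; apply: le_trans (h v) _.
    by rewrite -[leRHS]mulr1 ler_wpM2l.
pose g i (a : A i) := sval (cid (supP i a)).
have gP i (a : A i) := svalP (cid (supP i a)).
have nuE : nu rho x = (\big[Num.max/0]_i \big[Num.max/0]_(a : A i) g i a)%:E.
  apply: bigmaxe_EFin => i; apply: bigmaxe_EFin => a.
  by have [] := gP i a.
have nuRE : nuR rho x = \big[Num.max/0]_i \big[Num.max/0]_(a : A i) g i a.
  by rewrite nuR.unlock nuE.
split; first by rewrite nuRE.
- rewrite nuRE; exact: bigmax_ge_id.
- move=> i a v; have [_ _ h _] := gP i a; apply: le_trans (h v) _.
  rewrite ler_wpM2r ?normi_ge0// nuRE.
  apply: le_trans (_ : \big[Num.max/0]_(a : A i) g i a <= _).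
    exact: (le_bigmax _ (g i)).
  exact: (le_bigmax _ (fun i => \big[Num.max/0]_(a : A i) g i a)).
- move=> c c0 h; rewrite nuRE; apply: bigmax_le => // i _.
  apply: bigmax_le => // a _; have [_ _ _] := gP i a; apply => // v; exact: h.
Qed.

End Normalization.

(** * Newton's operator near a zero *)

Lemma expR_mul1B_le1 (R : realType) (x : R) : expR x * (1 - x) <= 1.
Proof.
have h := expR_ge1Dx (- x); have e0 := expR_gt0 x.
by rewrite -[leRHS](expRxMexpNx_1 x) ler_wpM2l// ltW.
Qed.

(** [e^{5/27}] is the fifth power of [e^{1/27} <= 1 / (1 - 1/27) = 27/26]; the intermediate powers
    are rounded up to small fractions. *)
Lemma expR_5_27_le (R : realType) (t : R) : t <= 5 / 27 -> expR t <= 29 / 24.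
Proof.
move=> t1; have [c cE] : exists c : R, c = 1 / 27 by exists (1 / 27).
have : expR t <= expR (c + c + c + c + c) by rewrite ler_expR; lra.
rewrite !expRD; have := expR_mul1B_le1 c; have := expR_ge0 c.
move: (expR c) (expR t) => w e w0 w1 he; apply: le_trans he _.
have w2 : w <= 27 / 26 by move: w1; rewrite cE; lra.
move: {t1 c cE w1} w0 w2 => w0 w1.
have w2 : w * w <= 55 / 51 by apply: le_trans (ler_pM w0 w0 w1 w1) _; lra.
have w20 : 0 <= w * w by rewrite mulr_ge0.
have w4 : w * w * (w * w) <= 57 / 49.
  by apply: le_trans (ler_pM w20 w20 w2 w2) _; lra.
rewrite mulrA in w4.
by apply: le_trans (ler_pM _ w0 w4 w1) _; rewrite ?mulr_ge0//; lra.
Qed.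

(** Here [e] stands for [e^tau], [q] for [mu tau], [d] and [y] for the errors before and after
    Newton's step. The bounds give [1 - q e^3 >= 2/3] and [e (e^2 - 1/2) <= 7/6], whence the
    quotient [7/4]. *)
Lemma newton_constants (R : realType) (e q d y : R) :
  1 <= e -> e <= 29 / 24 -> 0 <= q -> q <= 5 / 27 -> 0 <= d -> 0 <= y ->
  q * e ^+ 3 < 1 /\
  ((1 - q * e ^+ 3) * y <= q * (e * (e ^+ 2 - 2^-1)) * d -> y <= 7 / 4 * q * d).
Proof.
move=> eg1 e1 q0 q1 d0 y0; have e0 : 0 <= e by exact: le_trans eg1.
have e2 : e * e <= 19 / 13.
  by apply: le_trans (ler_pM e0 e0 e1 e1) _; clear; lra.
have e3 : e * (e * e) <= 53 / 30.
  by apply: le_trans (ler_pM e0 (mulr_ge0 e0 e0) e1 e2) _; clear; lra.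
have q3 : q * e ^+ 3 <= 1 / 3.
  rewrite !exprS expr0 mulr1.
  by apply: le_trans (ler_pM q0 (mulr_ge0 e0 (mulr_ge0 e0 e0)) q1 e3) _; clear; lra.
have ee1 : 1 * 1 <= e * e by apply: ler_pM.
have q2 : e * (e ^+ 2 - 2^-1) <= 7 / 6.
  have h1 : 0 <= e * e - 2^-1 by move: ee1; clear; lra.
  have h2 : e * e - 2^-1 <= 25 / 26 by move: e2; clear; lra.
  by rewrite expr2; apply: le_trans (ler_pM e0 h1 e1 h2) _; clear; lra.
split; first by move: q3; clear; lra.
move=> hy.
have h1 : 2 / 3 * y <= (1 - q * e ^+ 3) * y.
  by rewrite ler_wpM2r//; move: q3; clear; lra.
have h2 : q * (e * (e ^+ 2 - 2^-1)) * d <= q * (7 / 6) * d.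
  by rewrite ler_wpM2r// ler_wpM2l.
have : 2 / 3 * y <= q * (7 / 6) * d by apply: le_trans h1 (le_trans hy h2).
have -> : q * (7 / 6) * d = 7 / 6 * (q * d) by ring.
have -> : 7 / 4 * q * d = 7 / 4 * (q * d) by ring.
by move: (q * d) => r; lra.
Qed.

Section NewtonContraction.
Variables (R : realType) (n : nat) (n_gt0 : (0 < n)%N).
Variable A : 'I_n -> {fset 'rV[R]_n}.
Hypothesis A_neq0 : forall i, A i != fset0.
Variable rho : forall i : 'I_n, A i -> R.
Hypothesis rho_gt0 : forall i a, 0 < @rho i a.
Implicit Types (x u v : 'cV[R[i]]_n) (i : 'I_n).
Variables (f : system A) (z : 'cV[R[i]]_n).
Hypothesis f_neq0 : forall i, f i != 0.
Hypothesis fz_unit : DS rho f z \in unitmx.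

Let mu := muR rho f z.
Let nu := nuR rho z.

Lemma DS_mul_le v i :
  normc ((DS rho f z *m v) i 0) <= hnorm (f i) * (1 * normi rho i z v).
Proof. by rewrite DS_mulE; apply: row_le => // a; rewrite mul1r. Qed.

Lemma mulmx_injective_unitmx (B : 'M[R[i]]_n) :
  (forall v : 'cV_n, B *m v = 0 -> v = 0) -> B \in unitmx.
Proof.
move=> h; rewrite -unitmx_tr -row_free_unit -kermx_eq0; apply/eqP/row_matrixP => j.
rewrite row0; apply: trmx_inj; rewrite trmx0; apply: h.
by apply: trmx_inj; rewrite trmx_mul trmxK trmx0 -row_mul mulmx_ker row0.
Qed.

(** The rows of [DS v] are bounded by the local seminorms of [v] ([DS_mul_le]), so an invertible
    [DS] makes them separate points. *)
Lemma normx_eq0 v : normx rho z v = 0 -> v = 0.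
Proof.
move=> v0; suff h : DS rho f z *m v = 0.
  by rewrite -[v](mulKmx fz_unit) h mulmx0.
apply/colP => i; rewrite [RHS]mxE; apply/eqP.
rewrite -normc_eq0 eq_le normc_ge0 andbT.
apply: le_trans (DS_mul_le v i) _.
have := normi_le_normx rho i z v; rewrite v0 => h.
have -> : normi rho i z v = 0 by apply/eqP; rewrite eq_le h normi_ge0.
by rewrite !mulr0.
Qed.

Let e0 : 'cV[R[i]]_n := delta_mx (Ordinal n_gt0) 0.

Let normx_e0_gt0 : 0 < normx rho z e0.
Proof.
rewrite lt_def normx_ge0 andbT; apply/eqP => /normx_eq0 /colP/(_ (Ordinal n_gt0)).
by rewrite /e0 !mxE !eqxx => /eqP; rewrite oner_eq0.
Qed.

(** By [DS_mul_le], row [i] of [DS v] is at most [|f_i| |v|_i], so [v = DS^{-1} (DS v)] has norm at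
    most [mu |v|]; this is applied to the vector [e0] of positive norm. *)
Lemma muR_ge1 : 1 <= mu.
Proof.
have := @muR_le _ _ _ A_neq0 _ rho_gt0 f z (DS rho f z *m e0) z e0 1 fz_unit f_neq0 ler01
  (DS_mul_le e0).
by rewrite mulKmx// mul1r -ler_pdivrMr// divff// gt_eqF.
Qed.

Let nuP i (a : A i) v : normc (mform rho z a v) <= nu * normi rho i z v.
Proof. by have [_ _ h _] := nu_fin A_neq0 rho_gt0 z; exact: h. Qed.

Let nu_ge0 : 0 <= nu.
Proof. by have [_ h _ _] := nu_fin A_neq0 rho_gt0 z. Qed.

(** [|v|_i^2] is a mean of the [|(a - m) v|^2], each of which is at most [nu^2 |v|_i^2]. *)
Lemma nuR_ge1 : 1 <= nu.
Proof.
have [i e0i] : exists i, 0 < normi rho i z e0.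
  apply: contrapT => h.
  have h0 i : normi rho i z e0 = 0.
    apply/eqP; rewrite eq_le normi_ge0 andbT leNgt.
    by apply/negP => h1; apply: h; exists i.
  move: normx_e0_gt0; rewrite normxE hnorm0 ?ltxx// => i.
  by rewrite h0.
rewrite -(@ler_pM2r _ (normi rho i z e0))// mul1r.
rewrite -ler_sqr ?nnegrE ?mulr_ge0 ?normi_ge0//.
rewrite (normi_sqr A_neq0 rho_gt0) -[leRHS](sum_probM A_neq0 rho_gt0 i z).
apply: ler_sum => a _; rewrite ler_wpM2l ?prob_ge0//.
by rewrite ler_sqr ?nnegrE ?normc_ge0 ?mulr_ge0 ?normi_ge0.
Qed.

Let mu_ge0 : 0 <= mu. Proof. exact: le_trans muR_ge1. Qed.

Lemma mform_le_nu i (a : A i) h : normc (mform rho z a h) <= nu * normx rho z h.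
Proof.
by apply: le_trans (nuP a h) _; rewrite ler_wpM2l// normi_le_normx.
Qed.

Section Step.
Hypothesis fz_eq0 : forall i, dualapp (evalV rho i z) (f i) = 0.
Variable h : 'cV[R[i]]_n.
Let tau := nu * normx rho z h.

Let tau_ge0 : 0 <= tau.
Proof. by rewrite mulr_ge0 ?normx_ge0. Qed.

Let s i (a : A i) : R[i] := mform rho z a h.

Let s_le i (a : A i) : normc (s a) <= tau. Proof. exact: mform_le_nu. Qed.

Let normi_le_tau i : normi rho i z h <= tau.
Proof.
apply: le_trans (normi_le_normx _ _ _ _) _.
by rewrite -[leLHS]mul1r ler_wpM2r ?normx_ge0 ?nuR_ge1.
Qed.

Let dmom i v := rowapp (momentum rho i (z + h) - momentum rho i z) v.

Let dmom_le i v : normc (dmom i v) <= (expR (2 * tau) - 1) * normi rho i z v.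
Proof. by apply: momentum_shift_le => // a; exact: s_le. Qed.

(** Pairs [f_i] with the unit vector at [z], its coordinates multiplied by [F]. Since [z] is a zero,
    constants pair to 0 ([g1]), so [e^s] may be replaced by [e^s - 1], which is of order [tau]. *)
Let g i (F : A i -> R[i]) := \sum_(a : A i) f i a * (unitV rho z a * F a).

Let gD i F G : @g i (fun a => F a + G a) = g F + g G.
Proof. by rewrite /g -big_split; apply: eq_bigr => a _; rewrite !mulrDr. Qed.

Let gZ i c F : @g i (fun a => c * F a) = c * g F.
Proof. by rewrite /g mulr_sumr; apply: eq_bigr => a _ /=; ring. Qed.

Let g1 i : @g i (fun=> 1) = 0.
Proof.
rewrite -[RHS](dualapp_unitV (fz_eq0 i)); apply: eq_bigr => a _.
by rewrite mulr1.
Qed.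

Let expR2tau_ge0 : 0 <= expR (2 * tau) - 1.
Proof. by rewrite subr_ge0 -expR0 ler_expR mulr_ge0. Qed.

Let normc_exp_le i (a : A i) :
  normc (cexp (s a) - 1) <= expR tau * normc (s a).
Proof.
apply: le_trans (normc_cexp_sub1_le _) _.
by rewrite mulrC ler_wpM2r ?normc_ge0// ler_expR s_le.
Qed.

Let g_exp_le i :
  normc (g (fun a : A i => cexp (s a) - 1)) <=
  hnorm (f i) * (expR tau * normi rho i z h).
Proof. apply: row_le => //; exact: expR_ge0. Qed.

(** Takes the scalar [shiftfac] out of row [i]. Doing this to [DS] and [S] together does not affect
    Newton's step. *)
Let scaled (B : 'cV[R[i]]_n) : 'cV[R[i]]_n := \col_i ((shiftfac rho i z h)^-1 * B i 0).

Let scaled_DS v i : scaled (DS rho f (z + h) *m v) i 0 =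
  g (fun a : A i => cexp (s a) * mform rho z a v) - dmom i v * g (fun a : A i => cexp (s a) - 1).
Proof.
have -> : g (fun a : A i => cexp (s a) - 1) = g (fun a : A i => cexp (s a)).
  by rewrite (gD (fun a : A i => cexp (s a)) (fun _ : A i => -1)) -[RHS]addr0; congr (_ + _);
    have := gZ (-1) (fun _ : A i => 1); rewrite g1 mulr0 => <-;
    apply: eq_bigr => a _; rewrite mulr1.
rewrite mxE DS_mulE mulr_sumr -gZ -sumrB; apply: eq_bigr => a _.
rewrite (unitV_shift A_neq0 rho_gt0) mform_shift -/(dmom i v) -/(s a).
by have := shiftfac_neq0 A_neq0 rho_gt0 i z h; move: (shiftfac _ _ _ _) (dmom i v) => k d k0; field.
Qed.

Let scaled_S i : scaled (locS rho f (z + h) 0) i 0 =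
  g (fun a : A i => cexp (s a) - 1).
Proof.
rewrite (gD (fun a : A i => cexp (s a)) (fun _ : A i => -1)).
have -> : g (fun _ : A i => -1) = 0.
  have := gZ (-1) (fun _ : A i => 1); rewrite g1 mulr0 => <-.
  by apply: eq_bigr => a _; rewrite mulr1.
rewrite addr0 mxE locS0E// mulr_sumr; apply: eq_bigr => a _.
rewrite (unitV_shift A_neq0 rho_gt0) -/(s a).
by have := shiftfac_neq0 A_neq0 rho_gt0 i z h; move: (shiftfac _ _ _ _) => k k0; field.
Qed.

Let contr := mu * (tau * expR (3 * tau)).

Let DS_defect_le v :
  normx rho z (invmx (DS rho f z) *m (DS rho f z *m v - scaled (DS rho f (z + h) *m v)))
  <= contr * normx rho z v.
Proof.
rewrite /contr -mulrA; apply: muR_le => //; first exact: mulr_ge0 tau_ge0 (expR_ge0 _).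
move=> i; rewrite [X in normc X]mxE [X in _ + X]mxE scaled_DS.
rewrite DS_mulE -/(g (fun a : A i => mform rho z a v)).
have -> : g (fun a : A i => mform rho z a v) - (g (fun a : A i => cexp (s a) * mform rho z a v) -
    dmom i v * g (fun a : A i => cexp (s a) - 1)) =
  dmom i v * g (fun a : A i => cexp (s a) - 1) -
  g (fun a : A i => (cexp (s a) - 1) * mform rho z a v).
  have -> : g (fun a : A i => (cexp (s a) - 1) * mform rho z a v) =
    g (fun a : A i => cexp (s a) * mform rho z a v) - g (fun a : A i => mform rho z a v).
    by rewrite /g -sumrB; apply: eq_bigr => a _; ring.
  by ring.
apply: le_trans (le_normcD _ _) _; rewrite normcN.
(* The first summand bounds the shift of the momentum times [g (e^s - 1)], the second the effect of
   replacing 1 by [e^s] in the row. *)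
have -> : tau * expR (3 * tau) * normi rho i z v =
  (expR (2 * tau) - 1) * normi rho i z v * (expR tau * tau) +
  tau * expR tau * normi rho i z v.
  have -> : 3 * tau = 2 * tau + tau by ring.
  by rewrite expRD; ring.
rewrite mulrDr; apply: lerD; last first.
  apply: row_le => //; first exact: mulr_ge0 tau_ge0 (expR_ge0 _).
  move=> a; rewrite normcM ler_wpM2r ?normc_ge0//.
  apply: le_trans (normc_exp_le a) _.
  by rewrite mulrC ler_wpM2r ?expR_ge0.
rewrite normcM mulrCA.
apply: ler_pM; rewrite ?normc_ge0 ?dmom_le//.
apply: le_trans (g_exp_le i) _.
by rewrite ler_wpM2l ?hnorm_ge0// ler_wpM2l ?expR_ge0.
Qed.

(** [DS h - S] at [z + h] is of second order in [h]: row [i] pairs [f_i] with [s e^s - e^s + 1], and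
    the correction by the momentum is a product of two first-order terms. *)
Let newton_defect_le :
  normx rho z (invmx (DS rho f z) *m
    (scaled (DS rho f (z + h) *m h) - scaled (locS rho f (z + h) 0)))
  <= mu * (tau * expR tau * (expR (2 * tau) - 2^-1) * normx rho z h).
Proof.
have c0 : 0 <= tau * expR tau * (expR (2 * tau) - 2^-1).
  apply: mulr_ge0; first exact: mulr_ge0 tau_ge0 (expR_ge0 _).
  apply: le_trans expR2tau_ge0 _.
  by rewrite lerD2l lerN2 invf_le1// ler1n.
apply: muR_le => // i.
rewrite [X in normc X]mxE [X in _ + X]mxE scaled_DS scaled_S.
have -> : g (fun a : A i => cexp (s a) * mform rho z a h) -
    dmom i h * g (fun a : A i => cexp (s a) - 1) -
    g (fun a : A i => cexp (s a) - 1) =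
  g (fun a : A i => s a * cexp (s a) - cexp (s a) + 1) -
  dmom i h * g (fun a : A i => cexp (s a) - 1).
  have -> : g (fun a : A i => s a * cexp (s a) - cexp (s a) + 1) =
    g (fun a : A i => cexp (s a) * mform rho z a h) - g (fun a : A i => cexp (s a) - 1).
    by rewrite /g -sumrB; apply: eq_bigr => a _; rewrite /s; ring.
  by ring.
apply: le_trans (le_normcD _ _) _; rewrite normcN.
have -> : tau * expR tau * (expR (2 * tau) - 2^-1) * normi rho i z h =
  tau / 2 * expR tau * normi rho i z h +
  (expR (2 * tau) - 1) * normi rho i z h * (expR tau * tau) by field.
rewrite mulrDr; apply: lerD.
  apply: row_le => //.
    by apply: mulr_ge0 (expR_ge0 _); rewrite divr_ge0.
  move=> a; apply: le_trans (normc_mul_cexp_sub_le _) _.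
  have := s_le a; rewrite -ler_expR -/(s a).
  move: (normc _) (normc_ge0 (s a)) (s_le a) => r r0 rt et.
  have -> : tau / 2 * expR tau * r = (tau * r) / 2 * expR tau by ring.
  apply: ler_pM; rewrite ?expR_ge0 ?mulr_ge0 ?sqr_ge0 ?invr_ge0//.
  by rewrite ler_wpM2r ?invr_ge0// expr2 ler_wpM2r.
rewrite normcM [leRHS]mulrCA.
apply: ler_pM; rewrite ?normc_ge0 ?dmom_le//.
apply: le_trans (g_exp_le i) _.
by rewrite ler_wpM2l ?hnorm_ge0// ler_wpM2l ?expR_ge0.
Qed.

Let scaled_mul0 (B : 'cV[R[i]]_n) : B = 0 -> scaled B = 0.
Proof. by move=> ->; apply/colP => i; rewrite !mxE mulr0. Qed.

(** A kernel vector [v] of [DS] at [z + h] satisfies [|v| <= contr |v|] by [DS_defect_le]. *)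
Let contr_lt1 : contr < 1 -> DS rho f (z + h) \in unitmx.
Proof.
move=> c1; apply: mulmx_injective_unitmx => v v0; apply: normx_eq0.
have := DS_defect_le v; rewrite (scaled_mul0 v0) subr0 mulKmx// => hv.
apply/eqP; rewrite eq_le normx_ge0 andbT leNgt; apply/negP => vp.
by move: hv; rewrite leNgt gtr_pMl ?c1.
Qed.

(** The new error [y] solves [DS y = DS h - S] at [z + h]. Exchanging the left-hand [DS] for the one
    at [z] costs [contr |y|], which is absorbed on the left; the right side is bounded by
    [newton_defect_le]. *)
Lemma newton_error_le : mu * (tau * expR (3 * tau)) < 1 ->
  DS rho f (z + h) \in unitmx /\
  (1 - mu * (tau * expR (3 * tau))) * normx rho z (newton rho f (z + h) - z) <=
  mu * (tau * expR tau * (expR (2 * tau) - 2^-1) * normx rho z h).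
Proof.
move=> c1; have unit := contr_lt1 c1; split=> //.
set y := newton _ _ _ - z.
have yE : y = h - invmx (DS rho f (z + h)) *m locS rho f (z + h) 0.
  by rewrite /y /newton addrAC (addrC z h) addrK.
have DSy : DS rho f (z + h) *m y = DS rho f (z + h) *m h - locS rho f (z + h) 0.
  by rewrite yE mulmxBr mulKVmx.
have sDSy : scaled (DS rho f (z + h) *m y) =
    scaled (DS rho f (z + h) *m h) - scaled (locS rho f (z + h) 0).
  rewrite DSy; move: (_ *m h) (locS _ _ _ _) => B1 B2.
  by apply/colP => i; rewrite !mxE mulrDr mulrN.
have dec (L : 'M[R[i]]_n) (w p q : 'cV_n) : L \in unitmx -> q = p ->
    normx rho z w <= normx rho z (invmx L *m p) + normx rho z (invmx L *m (L *m w - q)).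
  move=> Lu ->; apply: le_trans (normxD A_neq0 rho_gt0 _ _ _).
  by rewrite -mulmxDr addrC subrK mulKmx.
rewrite mulrBl mul1r lerBlDr; apply: le_trans (dec _ y _ _ fz_unit sDSy) _.
apply: lerD; first exact: newton_defect_le.
exact: DS_defect_le.
Qed.

Lemma newton_contraction : mu * nu * normx rho z h <= 5 / 27 ->
  DS rho f (z + h) \in unitmx /\
  normx rho z (newton rho f (z + h) - z) <= 7 / 4 * (mu * nu) * normx rho z h ^+ 2.
Proof.
rewrite -mulrA -/tau => mt.
have t1 : tau <= 5 / 27.
  by apply: le_trans mt; rewrite -{1}[tau]mul1r ler_wpM2r// muR_ge1.
have mt0 : 0 <= mu * tau by rewrite mulr_ge0.
have -> : 7 / 4 * (mu * nu) * normx rho z h ^+ 2 = 7 / 4 * (mu * tau) * normx rho z h.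
  by rewrite /tau expr2; ring.
have [] := newton_constants _ (expR_5_27_le t1) mt0 mt (normx_ge0 rho z h)
  (normx_ge0 rho z (newton rho f (z + h) - z)).
  by rewrite -expR0 ler_expR.
have E0 : mu * (tau * expR (3 * tau)) = mu * tau * expR tau ^+ 3.
  by rewrite expRM_natl mulrA.
have E1 : mu * (tau * expR tau * (expR (2 * tau) - 2^-1) * normx rho z h) =
  mu * tau * (expR tau * (expR tau ^+ 2 - 2^-1)) * normx rho z h.
  by rewrite expRM_natl; ring.
have := newton_error_le; rewrite E0 E1 => h1 h2 h3.
by have [unit hy] := h1 h2; split=> //; exact: h3.
Qed.

End Step.
End NewtonContraction.

(** * Moving the system and its zero *)

Section HermitianProduct.
Variables (R : realType) (I : finType).
Implicit Types v w : I -> R[i].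

Definition herm v w : R[i] := \sum_a v a * conjc (w a).

Lemma herm_conj v w : conjc (herm v w) = herm w v.
Proof.
rewrite /herm (big_morph (@conjc R) (id1 := 0) (op1 := +%R)); last 2 first.
- by move=> [x y] [x' y']; congr (_ +i* _); rewrite /= opprD.
- by rewrite conjc0.
apply: eq_bigr => a _; case: (v a) (w a) => x y [x' y'].
by congr (_ +i* _); rewrite /=; ring.
Qed.

Lemma hermZl c v w : herm (fun a => c * v a) w = c * herm v w.
Proof. by rewrite /herm mulr_sumr; apply: eq_bigr => a _; rewrite mulrA. Qed.

Lemma mulc_conj (z : R[i]) : z * conjc z = (normc z ^+ 2)%:C.
Proof. by rewrite normc_sqrE; case: z => x y; congr (_ +i* _); rewrite /=; ring. Qed.

Lemma herm_self v : herm v v = (hnorm v ^+ 2)%:C.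
Proof.
by rewrite hnorm_sqr rmorph_sum; apply: eq_bigr => a _; exact: mulc_conj.
Qed.

Lemma normc_herm_le v w : normc (herm v w) <= hnorm v * hnorm w.
Proof.
apply: le_trans (normc_sum_mul_le _ _) _.
rewrite le_eqVlt; apply/orP; left; apply/eqP; congr (_ * _).
by congr Num.sqrt; apply: eq_bigr => a _; rewrite normc_conj.
Qed.

Lemma hnormB_sqr v w : hnorm (fun a => v a - w a) ^+ 2 =
  hnorm v ^+ 2 - 2 * complex.Re (herm v w) + hnorm w ^+ 2.
Proof.
rewrite !hnorm_sqr /herm Re_sum mulr_sumr -sumrB -big_split.
apply: eq_bigr => a _; rewrite !normc_sqrE.
by case: (v a) (w a) => x y [x' y'] /=; ring.
Qed.

(* The squared sine of the angle between the complex lines of v and w. *)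
Definition sin2 v w : R :=
  1 - normc (herm v w) ^+ 2 / (hnorm v ^+ 2 * hnorm w ^+ 2).

Lemma sin2_ge0 v w : 0 <= sin2 v w.
Proof.
rewrite subr_ge0; have [h|h] := eqVneq (hnorm v ^+ 2 * hnorm w ^+ 2) 0.
  by rewrite h invr0 mulr0.
rewrite ler_pdivrMr ?mul1r; last by rewrite lt_def h mulr_ge0 ?sqr_ge0.
by rewrite -exprMn ler_sqr ?nnegrE ?normc_ge0 ?mulr_ge0 ?hnorm_ge0// normc_herm_le.
Qed.

Lemma sin2_self v : hnorm v != 0 -> sin2 v v = 0.
Proof.
move=> v0; rewrite /sin2 herm_self normcR ger0_norm ?sqr_ge0//.
rewrite -expr2 divff ?subrr// !expf_neq0//.
Qed.

(** [c v] is the orthogonal projection of [w] to the line of [v]: its distance to [w] is [|w| sin],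
    its length [|w| cos]. *)
Lemma sin2_projection v w : hnorm v != 0 -> hnorm w != 0 ->
  exists c : R[i],
    hnorm (fun a => c * v a - w a) ^+ 2 = hnorm w ^+ 2 * sin2 v w /\
    (normc c * hnorm v) ^+ 2 = hnorm w ^+ 2 * (1 - sin2 v w).
Proof.
move=> v0 w0; exists (herm w v / (hnorm v ^+ 2)%:C).
set c := _ / _.
have nc : normc c = normc (herm v w) / hnorm v ^+ 2.
  rewrite /c normcM normcV normcR ger0_norm ?sqr_ge0//.
  by rewrite -herm_conj normc_conj.
have ec : complex.Re (c * herm v w) = normc (herm v w) ^+ 2 / hnorm v ^+ 2.
  rewrite /c mulrAC -(herm_conj v w) [conjc _ * _]mulrC mulc_conj.
  by rewrite -fmorphV -rmorphM.
rewrite (hnormB_sqr (fun a => c * v a)) hermZl ec hnormZ nc /sin2.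
move: (normc _) (hnorm v) (hnorm w) v0 w0 => h p q p0 q0.
by split; field; rewrite ?p0 ?q0.
Qed.

End HermitianProduct.

(** [e] is [e^tau], [D] is [path_dist] and [E] is [path_defect]. From [D <= 4/95] follow
    [e <= 95/91], [E <= 8/91] and [e^7 <= 19/14], and [(19/14) / (83/91) < 3/2]. *)
Lemma path_up_constants (R : realType) (e tau D E X Y : R) : 0 <= X -> 0 <= Y ->
  1 <= e -> tau <= D -> E <= 2 * D * e -> D <= 4 / 95 -> e * (1 - tau) <= 1 ->
  (1 - E) * X <= e ^+ 7 * Y -> X <= 3 / 2 * Y.
Proof.
move=> X0 Y0 eg1 tD ED D1 et h; have e0 : 0 <= e by exact: le_trans eg1.
have e1 : e <= 95 / 91.
  have : e * (91 / 95) <= e * (1 - tau) by rewrite ler_wpM2l//; lra.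
  by move=> h1; have := le_trans h1 et; lra.
have E1 : E <= 8 / 91.
  apply: le_trans ED _; apply: le_trans (_ : 8 / 95 * e <= _); last by lra.
  by rewrite ler_wpM2r//; lra.
have e2 : e ^+ 2 <= 12 / 11.
  by rewrite expr2; apply: le_trans (ler_pM e0 e0 e1 e1) _; clear; lra.
have x2 : 0 <= e ^+ 2 by exact: exprn_ge0.
have e4 : e ^+ 2 * e ^+ 2 <= 25 / 21.
  by apply: le_trans (ler_pM x2 x2 e2 e2) _; clear; lra.
have x4 : 0 <= e ^+ 2 * e ^+ 2 by exact: mulr_ge0.
have e6 : e ^+ 2 * e ^+ 2 * e ^+ 2 <= 13 / 10.
  by apply: le_trans (ler_pM x4 x2 e4 e2) _; clear; lra.
have x6 : 0 <= e ^+ 2 * e ^+ 2 * e ^+ 2 by exact: mulr_ge0.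
have e7 : e ^+ 7 <= 19 / 14.
  have -> : e ^+ 7 = e ^+ 2 * e ^+ 2 * e ^+ 2 * e by ring.
  by apply: le_trans (ler_pM x6 e0 e6 e1) _; clear; lra.
have h1 : 83 / 91 * X <= (1 - E) * X by rewrite ler_wpM2r//; move: E1; clear; lra.
have h2 : e ^+ 7 * Y <= 19 / 14 * Y by rewrite ler_wpM2r.
by have := le_trans h1 (le_trans h h2); move: Y0; clear; lra.
Qed.

(** Same letters, with [S] for the sines. From [D <= 1/20] follow [e <= 20/19] and
    [(1 + E) e^7 <= 27/17]; the square root is at least [199/200], and the quotient stays below
    [8/5]. *)
Lemma path_down_constants (R : realType) (e tau D E S X Y : R) : 0 <= X -> 0 <= Y ->
  1 <= e -> 0 <= S -> 0 <= E ->
  S <= D -> tau <= D -> E <= 2 * D * e -> D <= 1 / 20 -> e * (1 - tau) <= 1 ->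
  Num.sqrt (1 - S ^+ 2) * X <= (1 + E) * e ^+ 7 * Y -> X <= 8 / 5 * Y.
Proof.
move=> X0 Y0 eg1 S0 E0 SD tD ED D1 et h; have e0 : 0 <= e by exact: le_trans eg1.
have e1 : e <= 20 / 19.
  have : e * (19 / 20) <= e * (1 - tau) by rewrite ler_wpM2l//; lra.
  by move=> h1; have := le_trans h1 et; lra.
have E1 : E <= 2 / 19.
  apply: le_trans ED _; apply: le_trans (_ : 1 / 10 * e <= _); last by lra.
  by rewrite ler_wpM2r//; lra.
have S1 : S <= 1 / 20 by lra.
have S2 : S ^+ 2 <= 1 / 400.
  by rewrite expr2; apply: le_trans (ler_pM S0 S0 S1 S1) _; clear; lra.
have S3 : 0 <= S ^+ 2 by exact: exprn_ge0.
have q1 : 199 / 200 <= Num.sqrt (1 - S ^+ 2).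
  have x0 : 0 <= 1 - S ^+ 2 by move: S2; clear; lra.
  have x1 : Num.sqrt (1 - S ^+ 2) <= 1.
    by rewrite -[leRHS]sqrtr1 ler_wsqrtr// lerBlDr lerDl.
  (* A number in [[0, 1]] is at most its square root. *)
  apply: le_trans (_ : 1 - S ^+ 2 <= _); first by move: S2; clear; lra.
  by rewrite -{1}(sqr_sqrtr x0) expr2 ler_piMl ?sqrtr_ge0.
have e2 : e ^+ 2 <= 41 / 37.
  by rewrite expr2; apply: le_trans (ler_pM e0 e0 e1 e1) _; clear; lra.
have x2 : 0 <= e ^+ 2 by exact: exprn_ge0.
have e4 : e ^+ 2 * e ^+ 2 <= 70 / 57.
  by apply: le_trans (ler_pM x2 x2 e2 e2) _; clear; lra.
have x4 : 0 <= e ^+ 2 * e ^+ 2 by exact: mulr_ge0.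
have e6 : e ^+ 2 * e ^+ 2 * e ^+ 2 <= 49 / 36.
  by apply: le_trans (ler_pM x4 x2 e4 e2) _; clear; lra.
have x6 : 0 <= e ^+ 2 * e ^+ 2 * e ^+ 2 by exact: mulr_ge0.
have e7 : e ^+ 7 <= 43 / 30.
  have -> : e ^+ 7 = e ^+ 2 * e ^+ 2 * e ^+ 2 * e by ring.
  by apply: le_trans (ler_pM x6 e0 e6 e1) _; clear; lra.
have x7 : 0 <= e ^+ 7 by exact: exprn_ge0.
have f7 : (1 + E) * e ^+ 7 <= 27 / 17.
  have E2 : 0 <= 1 + E by move: E0; clear; lra.
  have E3 : 1 + E <= 21 / 19 by move: E1; clear; lra.
  by apply: le_trans (ler_pM E2 x7 E3 e7) _; clear; lra.
have h1 : 199 / 200 * X <= Num.sqrt (1 - S ^+ 2) * X by rewrite ler_wpM2r.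
have h2 : (1 + E) * e ^+ 7 * Y <= 27 / 17 * Y by rewrite ler_wpM2r.
by have := le_trans h1 (le_trans h h2); move: Y0; clear; lra.
Qed.

Lemma sqrt_sum_le (R : realType) (p a b k : R) : 0 <= a -> 0 <= b -> 1 <= k ->
  a <= k * b -> Num.sqrt (p ^+ 2 + a ^+ 2) <= k * Num.sqrt (p ^+ 2 + b ^+ 2).
Proof.
move=> a0 b0 k1 ab; have k0 : 0 <= k by exact: le_trans k1.
rewrite -ler_sqr ?nnegrE ?mulr_ge0 ?sqrtr_ge0// exprMn.
rewrite !sqr_sqrtr ?addr_ge0 ?sqr_ge0// mulrDr; apply: lerD.
  by rewrite ler_peMl ?sqr_ge0// exprn_ege1.
by rewrite -exprMn ler_sqr ?nnegrE ?mulr_ge0.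
Qed.

Lemma path_down_combine (R : realType) (q E t m0 m1 n0 n1 N0 N1 : R) :
  0 <= q -> 0 <= E -> 0 <= m1 -> 0 <= n0 -> 0 <= N0 ->
  q * m0 <= (1 + E) * expR (2 * t) * m1 -> n0 <= expR (3 * t) * n1 ->
  N0 <= expR (2 * t) * N1 ->
  q * (m0 * n0 * N0) <= (1 + E) * expR t ^+ 7 * (m1 * n1 * N1).
Proof.
move=> q0 E0 m10 n00 N00 h1 h2 h4.
have -> : (1 + E) * expR t ^+ 7 * (m1 * n1 * N1) =
  (1 + E) * expR (2 * t) * m1 * (expR (3 * t) * n1) * (expR (2 * t) * N1).
  by rewrite !expRM_natl; ring.
have -> : q * (m0 * n0 * N0) = q * m0 * (n0 * N0) by ring.
apply: le_trans (ler_wpM2r (mulr_ge0 n00 N00) h1) _.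
rewrite -[leRHS]mulrA; apply: ler_wpM2l; last exact: ler_pM.
by rewrite !mulr_ge0 ?expR_ge0 ?addr_ge0.
Qed.

Section SplitInverse.
Variables (R : realType) (n : nat) (A : 'I_n -> {fset 'rV[R]_n}).
Hypothesis A_neq0 : forall i, A i != fset0.
Variable rho : forall i : 'I_n, A i -> R.
Hypothesis rho_gt0 : forall i a, 0 < @rho i a.
Variables (L : 'M[R[i]]_n) (x w q : 'cV[R[i]]_n).
Hypothesis L_unit : L \in unitmx.

Lemma normx_le_split : normx rho x w <=
  normx rho x (invmx L *m (L *m w - q)) + normx rho x (invmx L *m q).
Proof.
apply: le_trans (normxD A_neq0 rho_gt0 _ _ _).
by rewrite -mulmxDr subrK (mulKmx L_unit).
Qed.

Lemma normx_invmx_le_split : normx rho x (invmx L *m q) <=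
  normx rho x w + normx rho x (invmx L *m (L *m w - q)).
Proof.
apply: le_trans (normxB A_neq0 rho_gt0 _ _ _).
by rewrite mulmxBr (mulKmx L_unit) subKr.
Qed.

End SplitInverse.

Section PathComparison.
Variables (R : realType) (n : nat) (n_gt0 : (0 < n)%N).
Variable A : 'I_n -> {fset 'rV[R]_n}.
Hypothesis A_neq0 : forall i, A i != fset0.
Variable rho : forall i : 'I_n, A i -> R.
Hypothesis rho_gt0 : forall i a, 0 < @rho i a.
Variables (f g : system A) (z h : 'cV[R[i]]_n).
Hypothesis f_neq0 : forall i, f i != 0.
Hypothesis g_neq0 : forall i, g i != 0.
Hypothesis gzh_eq0 : forall i, dualapp (evalV rho i (z + h)) (g i) = 0.
Hypothesis fz_unit : DS rho f z \in unitmx.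
Hypothesis gzh_unit : DS rho g (z + h) \in unitmx.

Definition sin2_sum (g f : system A) : R := \sum_i sin2 (g i) (f i).

Let mu0 := muR rho f z.
Let nu0 := nuR rho z.
Let mu1 := muR rho g (z + h).
Let nu1 := nuR rho (z + h).
Let tau := nu0 * normx rho z h.
Let S := Num.sqrt (sin2_sum g f).

Let nu0_ge1 : 1 <= nu0. Proof. exact: (nuR_ge1 n_gt0 A_neq0 rho_gt0 fz_unit). Qed.
Let nu1_ge1 : 1 <= nu1. Proof. exact: (nuR_ge1 n_gt0 A_neq0 rho_gt0 gzh_unit). Qed.
Let mu0_ge1 : 1 <= mu0. Proof. exact: muR_ge1. Qed.
Let mu1_ge1 : 1 <= mu1. Proof. exact: muR_ge1. Qed.

Let nu0_ge0 : 0 <= nu0. Proof. exact: le_trans nu0_ge1. Qed.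
Let nu1_ge0 : 0 <= nu1. Proof. exact: le_trans nu1_ge1. Qed.
Let mu0_ge0 : 0 <= mu0. Proof. exact: le_trans mu0_ge1. Qed.
Let mu1_ge0 : 0 <= mu1. Proof. exact: le_trans mu1_ge1. Qed.

Let tau_ge0 : 0 <= tau.
Proof. exact: mulr_ge0 nu0_ge0 (normx_ge0 _ _ _). Qed.

Let s_le i (a : A i) : normc (mform rho z a h) <= tau.
Proof. exact: mform_le_nu. Qed.

Let normi_up i v : normi rho i (z + h) v <= expR tau * normi rho i z v.
Proof. by apply: normi_shift_le => // a; exact: s_le. Qed.

Let normi_down i v : normi rho i z v <= expR (2 * tau) * normi rho i (z + h) v.
Proof. by apply: normi_le_shift => // a; exact: s_le. Qed.

Lemma normx_shift_le v : normx rho (z + h) v <= expR tau * normx rho z v.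
Proof. by apply: normx_le; rewrite ?expR_ge0. Qed.

Lemma normx_le_shift v : normx rho z v <= expR (2 * tau) * normx rho (z + h) v.
Proof. by apply: normx_le; rewrite ?expR_ge0. Qed.

Let dmom_le i v :
  normc (rowapp (momentum rho i (z + h) - momentum rho i z) v) <=
  (expR (2 * tau) - 1) * normi rho i z v.
Proof. by apply: momentum_shift_le => // a; exact: s_le. Qed.

Let e1 : 1 <= expR tau. Proof. by rewrite -expR0 ler_expR. Qed.
Let e2 : 1 <= expR (2 * tau). Proof. by rewrite -expR0 ler_expR mulr_ge0. Qed.

(** Exchanging the local norms costs [e^{2 tau}]. The shift of the momentum adds [e^{2 tau} - 1] to
    [nu0], which is another factor [e^{2 tau}] because [nu0 >= 1]. *)
Lemma nuR_shift_le : nu1 <= expR (4 * tau) * nu0.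
Proof.
have [_ _ _ lub] := nu_fin A_neq0 rho_gt0 (z + h); apply: lub => [|i a v].
  by rewrite mulr_ge0 ?expR_ge0//.
have [_ _ ub _] := nu_fin A_neq0 rho_gt0 z.
rewrite mform_shift; apply: le_trans (le_normcD _ _) _; rewrite normcN.
apply: le_trans (lerD (ub i a v) (dmom_le i v)) _.
rewrite -/nu0 -mulrDl.
apply: (@le_trans _ _ (expR (2 * tau) * nu0 * (expR (2 * tau) * normi rho i (z + h) v))).
  apply: ler_pM; rewrite ?normi_ge0 ?normi_down//.
    by rewrite addr_ge0// subr_ge0.
  rewrite -subr_ge0; have -> : expR (2 * tau) * nu0 - (nu0 + (expR (2 * tau) - 1)) =
    (nu0 - 1) * (expR (2 * tau) - 1) by ring.
  by rewrite mulr_ge0// subr_ge0.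
rewrite le_eqVlt; apply/orP; left; apply/eqP.
have -> : 4 * tau = 2 * tau + 2 * tau by ring.
by rewrite expRD; ring.
Qed.

Lemma nuR_le_shift : nu0 <= expR (3 * tau) * nu1.
Proof.
have [_ _ _ lub] := nu_fin A_neq0 rho_gt0 z; apply: lub => [|i a v].
  by rewrite mulr_ge0 ?expR_ge0//.
have [_ _ ub _] := nu_fin A_neq0 rho_gt0 (z + h).
have -> : mform rho z a v = mform rho (z + h) a v +
    rowapp (momentum rho i (z + h) - momentum rho i z) v.
  by rewrite mform_shift subrK.
apply: le_trans (le_normcD _ _) _.
have h1 := le_trans (ub i a v) (ler_wpM2l nu1_ge0 (normi_up i v)).
apply: le_trans (lerD h1 (dmom_le i v)) _.
rewrite -/nu1 mulrA -mulrDl ler_wpM2r ?normi_ge0//.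
rewrite !expRM_natl; set e := expR tau.
have e0 : 0 <= e + 1 by rewrite addr_ge0// expR_ge0.
have h2 : 0 <= (nu1 - 1) * (e ^+ 2 - 1).
  by rewrite mulr_ge0 ?subr_ge0// exprn_ege1.
have h3 : 0 <= nu1 * ((e - 1) ^+ 2 * (e + 1)).
  by rewrite mulr_ge0// mulr_ge0 ?sqr_ge0.
(* The surplus of [e^3 nu1] over the required bound is a sum of two nonnegative terms, the first by
   [nu1 >= 1]. *)
have -> : e ^+ 3 * nu1 = nu1 * e + (e ^+ 2 - 1) + (nu1 - 1) * (e ^+ 2 - 1) +
  nu1 * ((e - 1) ^+ 2 * (e + 1)) by ring.
by rewrite -addrA lerDl addr_ge0.
Qed.

Let hn_neq0 (k : system A) (k0 : forall i, k i != 0) i : hnorm (k i) != 0.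
Proof. by rewrite hnorm_ffun_eq0. Qed.

Let sin2_le i : sin2 (g i) (f i) <= S ^+ 2.
Proof.
rewrite sqr_sqrtr; last by apply: sumr_ge0 => j _; exact: sin2_ge0.
rewrite /sin2_sum (bigD1 i)//= lerDl sumr_ge0// => j _; exact: sin2_ge0.
Qed.

(** [c_i g_i] is the projection of [f_i] to the line of [g_i]: it lies within [|f_i| S] of [f_i],
    and its norm is between [|f_i| sqrt (1 - S^2)] and [|f_i|]. *)
Let proj i : {c : R[i] |
  hnorm (fun a => c * g i a - f i a) ^+ 2 = hnorm (f i) ^+ 2 * sin2 (g i) (f i) /\
  (normc c * hnorm (g i)) ^+ 2 = hnorm (f i) ^+ 2 * (1 - sin2 (g i) (f i))}.
Proof. by apply: cid; apply: sin2_projection; exact: hn_neq0. Qed.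

Let c i : R[i] := sval (proj i).

Let cf_le i : hnorm (fun a => c i * g i a - f i a) <= hnorm (f i) * S.
Proof.
have [h1 _] := svalP (proj i).
rewrite -ler_sqr ?nnegrE ?mulr_ge0 ?hnorm_ge0 ?sqrtr_ge0//.
by rewrite h1 exprMn ler_wpM2l ?sqr_ge0.
Qed.

Let c_le i : normc (c i) * hnorm (g i) <= hnorm (f i).
Proof.
have [_ h2] := svalP (proj i).
rewrite -ler_sqr ?nnegrE ?mulr_ge0 ?hnorm_ge0 ?normc_ge0//.
rewrite h2 -[leRHS]mulr1 ler_wpM2l ?sqr_ge0// lerBlDr lerDl.
exact: sin2_ge0.
Qed.

Let c_ge i : hnorm (f i) * Num.sqrt (1 - S ^+ 2) <= normc (c i) * hnorm (g i).
Proof.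
have [_ h2] := svalP (proj i).
have [S1|S1] := leP (1 - S ^+ 2) 0.
  by rewrite ler0_sqrtr// mulr0 mulr_ge0 ?hnorm_ge0 ?normc_ge0.
rewrite -ler_sqr ?nnegrE ?mulr_ge0 ?hnorm_ge0 ?normc_ge0 ?sqrtr_ge0//.
rewrite h2 exprMn (sqr_sqrtr (ltW S1)) ler_wpM2l ?sqr_ge0//.
by rewrite lerD2l lerN2.
Qed.

Let kap i := shiftfac rho i z h.

Let kap_neq0 i : kap i != 0. Proof. exact: shiftfac_neq0. Qed.

Let kap_le1 i : normc (kap i) <= 1.
Proof.
rewrite -ler_sqr ?nnegrE ?normc_ge0// expr1n normc_shiftfac_sqr//.
by rewrite invf_le1 ?kshift_ge1 ?kshift_gt0.
Qed.

Let kapV_le i : (normc (kap i))^-1 <= expR tau.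
Proof.
rewrite -ler_sqr ?nnegrE ?invr_ge0 ?normc_ge0 ?expR_ge0// exprVn.
rewrite normc_shiftfac_sqr// invrK -expRM_natl.
by apply: kshift_le => // a; exact: s_le.
Qed.

Let scaled (B : 'cV[R[i]]_n) : 'cV[R[i]]_n := \col_i (c i / kap i * B i 0).

(** Here [g] vanishes at [z + h], so the factors [e^{mform h}] pair to 0 with [g_i] and the momentum
    correction disappears; in Newton's step, where the zero is [z], it remains. *)
Let scaled_DS v i : scaled (DS rho g (z + h) *m v) i 0 =
  \sum_(a : A i) (c i * g i a) *
    (unitV rho z a * (cexp (mform rho z a h) * mform rho z a v)).
Proof.
pose d := rowapp (momentum rho i (z + h) - momentum rho i z) v.
have h0 : \sum_(a : A i) g i a * (unitV rho z a * cexp (mform rho z a h)) = 0.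
  have := dualapp_unitV (gzh_eq0 i).
  under eq_bigr do rewrite (unitV_shift A_neq0 rho_gt0) mulrCA.
  rewrite -mulr_sumr => /eqP; rewrite mulf_eq0 (negbTE (kap_neq0 i)) /=.
  by move/eqP.
have -> : \sum_(a : A i) (c i * g i a) *
    (unitV rho z a * (cexp (mform rho z a h) * mform rho z a v)) =
  \sum_(a : A i) (c i * g i a) *
    (unitV rho z a * (cexp (mform rho z a h) * mform rho z a v)) -
  c i * d * \sum_(a : A i) g i a * (unitV rho z a * cexp (mform rho z a h)).
  by rewrite h0 mulr0 subr0.
rewrite mxE DS_mulE !mulr_sumr -sumrB; apply: eq_bigr => a _.
rewrite (unitV_shift A_neq0 rho_gt0) mform_shift -/d -/(kap i).
have := kap_neq0 i; move: (kap i) (c i) (unitV _ _ _) (cexp _) (mform _ _ _ v) => k ci u e m k0.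
by field.
Qed.

(** Bounds the change of [DS] as seen through its inverse at [(f, z)]: [S] accounts for the system,
    [tau] for the exponentials. *)
Definition path_defect : R := mu0 * ((S + tau) * expR tau).
Let E := path_defect.

Let E_ge0 : 0 <= E.
Proof.
by rewrite !mulr_ge0 ?expR_ge0 ?addr_ge0 ?sqrtr_ge0//.
Qed.

Let DS_defect_le v :
  normx rho z (invmx (DS rho f z) *m (DS rho f z *m v - scaled (DS rho g (z + h) *m v)))
  <= E * normx rho z v.
Proof.
rewrite /E /path_defect -mulrA; apply: muR_le => //.
  by rewrite mulr_ge0 ?expR_ge0 ?addr_ge0 ?sqrtr_ge0.
move=> i; rewrite [X in normc X]mxE [X in _ + X]mxE scaled_DS DS_mulE.
pose X := \sum_(a : A i) (c i * g i a - f i a) *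
    (unitV rho z a * (cexp (mform rho z a h) * mform rho z a v)).
pose Y := \sum_(a : A i) f i a *
    (unitV rho z a * ((cexp (mform rho z a h) - 1) * mform rho z a v)).
have -> : \sum_(a : A i) f i a * (unitV rho z a * mform rho z a v) -
    \sum_(a : A i) c i * g i a *
      (unitV rho z a * (cexp (mform rho z a h) * mform rho z a v)) = - (X + Y).
  rewrite /X /Y -big_split -sumrB -sumrN; apply: eq_bigr => a _ /=.
  move: (unitV _ _ _) (cexp _) (mform _ _ _ v) (c i * g i a) (f i a) => u e m k l.
  by ring.
rewrite normcN; apply: le_trans (le_normcD _ _) _.
have -> : (S + tau) * expR tau * normi rho i z v =
  S * (expR tau * normi rho i z v) + tau * expR tau * normi rho i z v by ring.
rewrite mulrDr; apply: lerD.
  rewrite mulrA; apply: le_trans (_ : hnorm (fun a => c i * g i a - f i a) * (expR tau * normi rho i z v) <= _).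
    apply: row_le => //.
    move=> a; rewrite normcM ler_wpM2r ?normc_ge0// normc_cexp ler_expR.
    exact: le_trans (Re_le _) (s_le a).
  by rewrite ler_wpM2r// mulr_ge0 ?expR_ge0 ?normi_ge0.
apply: row_le => //; first exact: mulr_ge0 tau_ge0 (expR_ge0 _).
move=> a; rewrite normcM ler_wpM2r ?normc_ge0//.
apply: le_trans (normc_cexp_sub1_le _) _.
by apply: ler_pM; rewrite ?normc_ge0 ?expR_ge0 ?s_le// ler_expR s_le.
Qed.

Let normx_split v : normx rho z v <= E * normx rho z v +
  normx rho z (invmx (DS rho f z) *m scaled (DS rho g (z + h) *m v)).
Proof.
apply: le_trans (normx_le_split A_neq0 rho_gt0 _ _ (scaled (DS rho g (z + h) *m v)) fz_unit) _.
by rewrite lerD2r DS_defect_le.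
Qed.

(** A relative change [E] of [DS] enlarges the inverse by at most [1 / (1 - E)]. One factor [e^tau]
    comes from the norm at [z + h], the other from [1 / |kap|]. *)
Lemma muR_shift_le : (1 - E) * mu1 <= expR (2 * tau) * mu0.
Proof.
have [E1|E1] := leP 1 E.
  apply: le_trans (_ : 0 <= _); last by rewrite mulr_ge0 ?expR_ge0//.
  by rewrite mulr_le0_ge0 ?subr_le0//.
have E1' : 0 < 1 - E by rewrite subr_gt0.
rewrite -ler_pdivlMl// mulrC.
have [_ _ _ lub] := mu_unit A_neq0 rho_gt0 gzh_unit; apply: lub.
  by rewrite !mulr_ge0 ?invr_ge0 ?expR_ge0 ?(ltW E1')//.
move=> w; rewrite -mulmxA; set b := diag_mx _ *m w.
set v := invmx _ *m b.
apply: le_trans (normx_shift_le v) _.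
have gv : DS rho g (z + h) *m v = b by rewrite mulKVmx.
have : (1 - E) * normx rho z v <= mu0 * (expR tau * hnorm (fun i => w i 0)).
  rewrite mulrBl mul1r lerBlDl; apply: le_trans (normx_split v) _.
  rewrite lerD2l gv.
  apply: le_trans (_ : mu0 * hnorm (fun i => (expR tau * normc (w i 0))%:C) <= _).
    apply: muR_le_hnorm => // i.
    rewrite mxE /b mul_diag_mx !mxE; have := kapV_le i; move: (kap i) => k k1.
    rewrite !normcM normcV normcR ger0_norm ?hnorm_ge0//.
    have -> : normc (c i) / normc k * (hnorm (g i) * normc (w i 0)) =
      normc (c i) * hnorm (g i) * ((normc k)^-1 * normc (w i 0)) by ring.
    apply: ler_pM; rewrite ?c_le ?mulr_ge0 ?invr_ge0 ?normc_ge0 ?hnorm_ge0//.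
    by rewrite ler_wpM2r ?normc_ge0.
  rewrite ler_wpM2l //; apply: hnorm_le; first exact: expR_ge0.
  by move=> i; rewrite normcR ger0_norm ?mulr_ge0 ?expR_ge0 ?normc_ge0.
have -> : 2 * tau = tau + tau by ring.
rewrite expRD -ler_pdivlMl// => hv.
apply: le_trans (ler_wpM2l (expR_ge0 _) hv) _.
rewrite le_eqVlt; apply/orP; left; apply/eqP.
by ring.
Qed.

(** In this direction the change of [DS] costs only [1 + E]. The square root bounds
    [|c_i g_i| / |f_i|] from below, [e^{2 tau}] comes from [normx_le_shift], and [|kap| <= 1] is
    free. *)
Lemma muR_le_shift : Num.sqrt (1 - S ^+ 2) * mu0 <= (1 + E) * expR (2 * tau) * mu1.
Proof.
set q := Num.sqrt _.
have rhs_ge0 : 0 <= (1 + E) * expR (2 * tau) * mu1.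
  by rewrite !mulr_ge0 ?expR_ge0 ?addr_ge0//.
have [q0|q0] := leP q 0.
  by apply: le_trans rhs_ge0; rewrite mulr_le0_ge0//.
rewrite -ler_pdivlMl//.
have [_ _ _ lub] := mu_unit A_neq0 rho_gt0 fz_unit; apply: lub.
  by rewrite mulr_ge0 ?invr_ge0 ?(ltW q0).
move=> w; rewrite -mulmxA; set b := diag_mx _ *m w.
have c_neq0 i : c i != 0.
  rewrite -normc_eq0; apply/eqP => h0; have := c_ge i.
  rewrite h0 mul0r leNgt mulr_gt0// lt_def hn_neq0 ?hnorm_ge0//.
pose b' : 'cV[R[i]]_n := \col_i (kap i / c i * b i 0).
pose v := invmx (DS rho g (z + h)) *m b'.
have sb : scaled (DS rho g (z + h) *m v) = b.
  rewrite mulKVmx//; apply/colP => i; rewrite mxE [b' _ _]mxE.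
  have := kap_neq0 i; have := c_neq0 i; move: (b i 0) (c i) (kap i) => x y k y0 k0.
  by field; rewrite y0.
have vb : normx rho z (invmx (DS rho f z) *m b) <= (1 + E) * normx rho z v.
  apply: le_trans (normx_invmx_le_split A_neq0 rho_gt0 _ v _ fz_unit) _.
  rewrite -{1}sb.
  by rewrite mulrDl mul1r lerD2l DS_defect_le.
have hv : normx rho (z + h) v <= mu1 * (q^-1 * hnorm (fun i => w i 0)).
  apply: le_trans (_ : mu1 * hnorm (fun i => (q^-1 * normc (w i 0))%:C) <= _).
    apply: muR_le_hnorm => // i.
    rewrite mxE /b mul_diag_mx !mxE; have := kap_le1 i; move: (kap i) => k k1.
    rewrite !normcM normcV normcR ger0_norm ?hnorm_ge0//.
    have hc : 0 < normc (c i) by rewrite normc_gt0.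
    rewrite mulrA (mulrA (hnorm _)) ler_wpM2r ?normc_ge0//.
    apply: le_trans (_ : (normc (c i))^-1 * hnorm (f i) <= _).
      by rewrite ler_wpM2r ?hnorm_ge0// ler_piMl ?invr_ge0 ?(ltW hc).
    by rewrite ler_pdivrMl// mulrA ler_pdivlMr// c_ge.
  rewrite ler_wpM2l //; apply: hnorm_le.
    by rewrite invr_ge0 ltW.
  by move=> i; rewrite normcR ger0_norm ?mulr_ge0 ?normc_ge0 ?invr_ge0 ?(ltW q0).
apply: le_trans vb _.
have E1 : 0 <= 1 + E by rewrite addr_ge0.
apply: le_trans (ler_wpM2l E1 (normx_le_shift v)) _.
apply: le_trans (ler_wpM2l E1 (ler_wpM2l (expR_ge0 _) hv)) _.
rewrite le_eqVlt; apply/orP; left; apply/eqP.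
by ring.
Qed.

(* The distance from (f, z) to (g, z + h), measured at (f, z) with sines in the
   projective factors and scaled by the condition number. *)
Definition path_dist : R := mu0 * nu0 * Num.sqrt (sin2_sum g f + normx rho z h ^+ 2).
Let D := path_dist.

Let S_sqr : S ^+ 2 = sin2_sum g f.
Proof. by rewrite sqr_sqrtr// sumr_ge0// => j _; exact: sin2_ge0. Qed.

Let S_ge0 : 0 <= S. Proof. exact: sqrtr_ge0. Qed.

Let S_le_D : mu0 * S <= D.
Proof.
rewrite /D /path_dist; set Q := Num.sqrt (_ + _).
have SQ : S <= Q.
  by rewrite /S /Q ler_wsqrtr// lerDl sqr_ge0.
rewrite -mulrA ler_wpM2l//; apply: le_trans SQ _.
by rewrite ler_peMl ?sqrtr_ge0.
Qed.

Let tau_le_D : mu0 * tau <= D.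
Proof.
rewrite /tau mulrA ler_wpM2l ?mulr_ge0//.
rewrite -[leLHS](ger0_norm (normx_ge0 _ _ _)) -sqrtr_sqr ler_wsqrtr// lerDr.
by rewrite -S_sqr sqr_ge0.
Qed.

(** As [mu0] and [nu0] are at least 1, the one number [D] controls the sines, [tau], and each of the
    two summands of [E]. *)
Let D_bounds : [/\ S <= D, tau <= D & E <= 2 * D * expR tau].
Proof.
split.
- by apply: le_trans S_le_D; rewrite ler_peMl.
- by apply: le_trans tau_le_D; rewrite ler_peMl.
- rewrite /E /path_defect mulrA ler_wpM2r ?expR_ge0//.
  by rewrite mulrDr (_ : 2 * D = D + D) ?lerD//; ring.
Qed.

(** The exponent 7 of the constants is [2 + 4 + 1], from [mu], [nu] and the local norm. *)
Lemma path_step_up v : path_dist <= 4 / 95 ->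
  mu1 * nu1 * normx rho (z + h) v <= 3 / 2 * (mu0 * nu0 * normx rho z v).
Proof.
rewrite -/D => D1; have [_ tD ED] := D_bounds.
have X0 := mulr_ge0 (mulr_ge0 mu1_ge0 nu1_ge0) (normx_ge0 rho (z + h) v).
have Y0 := mulr_ge0 (mulr_ge0 mu0_ge0 nu0_ge0) (normx_ge0 rho z v).
apply: (path_up_constants X0 Y0 e1 tD ED D1 (expR_mul1B_le1 tau)).
have h1 := muR_shift_le; have h2 := nuR_shift_le; have h3 := normx_shift_le v.
have -> : expR tau ^+ 7 * (mu0 * nu0 * normx rho z v) =
  expR (2 * tau) * mu0 * (expR (4 * tau) * nu0) * (expR tau * normx rho z v).
  by rewrite !expRM_natl; ring.
have -> : (1 - E) * (mu1 * nu1 * normx rho (z + h) v) =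
  (1 - E) * mu1 * (nu1 * normx rho (z + h) v) by ring.
apply: le_trans (ler_wpM2r (mulr_ge0 nu1_ge0 (normx_ge0 _ _ _)) h1) _.
rewrite -[leRHS]mulrA; apply: ler_wpM2l; first exact: mulr_ge0 (expR_ge0 _) mu0_ge0.
exact: ler_pM nu1_ge0 (normx_ge0 _ _ _) h2 h3.
Qed.

Lemma munu_step_up : path_dist <= 4 / 95 -> mu1 * nu1 <= 3 / 2 * (mu0 * nu0).
Proof.
rewrite -/D => D1; have [_ tD ED] := D_bounds.
have X0 := mulr_ge0 mu1_ge0 nu1_ge0; have Y0 := mulr_ge0 mu0_ge0 nu0_ge0.
apply: (path_up_constants X0 Y0 e1 tD ED D1 (expR_mul1B_le1 tau)).
apply: le_trans (_ : expR (2 * tau) * mu0 * (expR (4 * tau) * nu0) <= _).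
  rewrite (mulrA (1 - E)); apply: le_trans (ler_wpM2r nu1_ge0 muR_shift_le) _.
  exact: (ler_wpM2l (mulr_ge0 (expR_ge0 _) mu0_ge0) nuR_shift_le).
have -> : expR (2 * tau) * mu0 * (expR (4 * tau) * nu0) =
  expR tau ^+ 6 * (mu0 * nu0) by rewrite !expRM_natl; ring.
(* Without the local norm only [e^6] arises; raising it to [e^7] lets the same constants serve. *)
by apply: (ler_wpM2r Y0); exact: ler_weXn2l.
Qed.

(** Here 7 is [2 + 3 + 2]. The number [p] is meant for the speed of the system, which does not
    depend on the point where vectors are measured. *)
Lemma path_step_down (p : R) v : 0 <= p -> path_dist <= 1 / 20 ->
  mu0 * nu0 * Num.sqrt (p ^+ 2 + normx rho z v ^+ 2) <=
  8 / 5 * (mu1 * nu1 * Num.sqrt (p ^+ 2 + normx rho (z + h) v ^+ 2)).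
Proof.
move=> p0; rewrite -/D => D1; have [SD tD ED] := D_bounds.
have X0 := mulr_ge0 (mulr_ge0 mu0_ge0 nu0_ge0)
  (sqrtr_ge0 (p ^+ 2 + normx rho z v ^+ 2)).
have Y0 := mulr_ge0 (mulr_ge0 mu1_ge0 nu1_ge0)
  (sqrtr_ge0 (p ^+ 2 + normx rho (z + h) v ^+ 2)).
apply: (path_down_constants X0 Y0 e1 S_ge0 E_ge0 SD tD ED D1 (expR_mul1B_le1 tau)).
have h4 := sqrt_sum_le p (normx_ge0 _ _ _) (normx_ge0 _ _ _) e2 (normx_le_shift v).
apply: (path_down_combine (sqrtr_ge0 _) E_ge0 mu1_ge0 nu0_ge0 (sqrtr_ge0 _)
  muR_le_shift nuR_le_shift h4).
Qed.

End PathComparison.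

(** * The quotient by the fibers of [V] *)

Section Quotient.
Variables (R : realType) (n : nat) (n_gt0 : (0 < n)%N).
Variable A : 'I_n -> {fset 'rV[R]_n}.
Hypothesis A_neq0 : forall i, A i != fset0.
Variable rho : forall i : 'I_n, A i -> R.
Hypothesis rho_gt0 : forall i a, 0 < @rho i a.
Implicit Types (f : system A) (x y z u v w : 'cV[R[i]]_n) (i : 'I_n).

Lemma evalV_neq0 i x (a : A i) : evalV rho i x a != 0.
Proof.
rewrite ffunE mulf_neq0 ?cexp_neq0//.
by rewrite -normc_eq0 normcR normr_eq0 gt_eqF.
Qed.

Lemma evalV_add i x u (a : A i) :
  evalV rho i (x + u) a = evalV rho i x a * cexp (rowapp (val a) u).
Proof. by rewrite !ffunE rowappDr cexpD mulrA. Qed.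

Lemma M_eq_refl x : M_eq rho x x.
Proof. by move=> i; exists 1; rewrite ?oner_neq0// => a; rewrite mul1r. Qed.

Lemma M_eq_add x x' u : M_eq rho x x' -> M_eq rho (x + u) (x' + u).
Proof.
move=> h i; have [c c0 hc] := h i; exists c => // a.
by rewrite (evalV_add x' u) hc (evalV_add x u) mulrA.
Qed.

(** The fibers of [[V]] are cosets of a group: if [y] and [y'] lie in one fiber, translation by
    [y - y'] multiplies all coordinates of [V_i] by one scalar, so it preserves every fiber. *)
Lemma M_eq_sub x x' y y' : M_eq rho x x' -> M_eq rho y y' ->
  M_eq rho x (x' + (y - y')).
Proof.
move=> hx hy i; have [c c0 hc] := hx i; have [d d0 hd] := hy i.
exists (c / d) => [|a]; first by rewrite mulf_neq0 ?invr_eq0.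
have h : evalV rho i y a = evalV rho i y' a * cexp (rowapp (val a) (y - y')).
  by rewrite -(evalV_add y' (y - y')) addrC subrK.
rewrite (evalV_add x' (y - y')) hc; have := evalV_neq0 y a.
move: h; rewrite hd; move: (evalV _ _ y a) (cexp _) (evalV _ _ x a) => Y E X h Y0.
have -> : E = d^-1.
  apply: (mulfI d0); apply: (mulIf Y0).
  by rewrite divff// mul1r {2}h; ring.
by ring.
Qed.

Section Representatives.
Variables (x x' : 'cV[R[i]]_n) (xx' : M_eq rho x x').

Lemma M_eq_weight i : exists2 k : R, 0 < k &
  forall a : A i, weight rho x' a = k * weight rho x a.
Proof.
have [c c0 hc] := xx' i; exists (normc c ^+ 2); first by rewrite exprn_gt0 ?normc_gt0.
by move=> a; rewrite -!normc_evalV_sqr hc normcM exprMn.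
Qed.

Lemma M_eq_prob i (a : A i) : prob rho x' a = prob rho x a.
Proof.
have [k k0 hk] := M_eq_weight i; rewrite /prob.
have -> : kernelK rho i x' = k * kernelK rho i x.
  by rewrite /kernelK mulr_sumr; apply: eq_bigr => b _; exact: hk.
have K0 := kernelK_gt0 A_neq0 rho_gt0 i x.
by rewrite hk; field; rewrite !gt_eqF.
Qed.

Lemma M_eq_mform i (a : A i) v : mform rho x' a v = mform rho x a v.
Proof.
have e : momentum rho i x' = momentum rho i x.
  by apply: eq_bigr => b _; rewrite M_eq_prob.
by rewrite /mform e.
Qed.

Lemma M_eq_unitV i : exists2 k : R[i], k != 0 &
  forall a : A i, unitV rho x' a = k * unitV rho x a.
Proof.
have [c c0 hc] := xx' i.
exists (normfac rho i x' * c / normfac rho i x).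
  apply: mulf_neq0; last by rewrite invr_eq0 normfac_neq0.
  by apply: mulf_neq0; rewrite ?normfac_neq0.
move=> a; rewrite /unitV hc; have := normfac_neq0 A_neq0 rho_gt0 i x.
move: (normfac _ _ x) (normfac _ _ x') (evalV _ _ _ _) => p q e p0.
by field.
Qed.

(** Equivalent points have proportional unit vectors and equal forms [mform], so the rows of [DS]
    and [S] are multiplied by the same scalars, the diagonal of [D]; these cancel in Newton's
    step. *)
Lemma M_eq_DS f : exists2 D : 'M[R[i]]_n, D \in unitmx &
  DS rho f x' = D *m DS rho f x /\ locS rho f x' 0 = D *m locS rho f x 0.
Proof.
pose k i := s2val (cid2 (M_eq_unitV i)).
have k0 i : k i != 0 := s2valP (cid2 (M_eq_unitV i)).
have hk i : forall a : A i, unitV rho x' a = k i * unitV rho x a :=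
  s2valP' (cid2 (M_eq_unitV i)).
move: k k0 hk => k k0 hk.
have kD (B B' : 'cV[R[i]]_n) : (forall i, B' i 0 = k i * B i 0) ->
    B' = diag_mx (\row_i k i) *m B.
  by move=> h; apply/colP => i; rewrite mul_diag_mx mxE h mxE.
exists (diag_mx (\row_i k i)).
  rewrite unitmxE det_diag unitfE; apply/prodf_neq0 => i _.
  by rewrite mxE.
split; last first.
  apply: (kD (locS rho f x 0) (locS rho f x' 0)) => l.
  apply: etrans (locS0E rho f x' l) _.
  apply: etrans (esym (congr1 ( *%R (k l)) (locS0E rho f x l))); rewrite mulr_sumr.
  apply: eq_bigr => a _.
  by rewrite hk mulrCA.
apply: trmx_inj; apply/row_matrixP => j; rewrite -!tr_col; congr trmx.
rewrite (colE j (DS rho f x')) (colE j (_ *m _)) -mulmxA.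
apply: (kD (DS rho f x *m delta_mx j 0) (DS rho f x' *m delta_mx j 0)) => l.
apply: etrans (DS_mulE rho f x' _ l) _.
apply: etrans (esym (congr1 ( *%R (k l)) (DS_mulE rho f x _ l))); rewrite mulr_sumr.
apply: eq_bigr => a _.
rewrite hk M_eq_mform; move: (k l) (unitV _ _ _) (mform _ _ _ _) => p q r.
by ring.
Qed.

Lemma M_eq_newton_defined f : newton_defined rho f x' <-> newton_defined rho f x.
Proof.
have [D D1 [h _]] := M_eq_DS f; rewrite /newton_defined h unitmx_mul D1.
by [].
Qed.

Lemma M_eq_newton f : newton_defined rho f x ->
  newton rho f x' = newton rho f x + (x' - x).
Proof.
move=> fx; have [D D1 [h1 h2]] := M_eq_DS f.
rewrite /newton h1 h2.
have gen (L : 'M[R[i]]_n) (b : 'cV[R[i]]_n) : L \in unitmx ->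
    invmx (D *m L) *m (D *m b) = invmx L *m b.
  move=> L1; have DL : D *m L \in unitmx by rewrite unitmx_mul D1.
  by rewrite -{1}(mulKVmx L1 b) (mulmxA D) (mulKmx DL).
rewrite gen//; move: (invmx _ *m _) => c.
by rewrite addrAC (addrC x) subrK.
Qed.

End Representatives.

Lemma M_dist_le w x y x' y' : M_eq rho x x' -> M_eq rho y y' ->
  M_dist rho w x y <= normx rho w (x' - y').
Proof.
move=> hx hy; apply: ge_inf; last by exists x', y'.
by exists 0 => _ [? [? [_ _ ->]]]; exact: normx_ge0.
Qed.

Lemma M_dist_ge0 w x y : 0 <= M_dist rho w x y.
Proof.
apply: lb_le_inf; first by exists (normx rho w (x - y)), x, y; split => //; exact: M_eq_refl.
by move=> _ [? [? [_ _ ->]]]; exact: normx_ge0.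
Qed.

Lemma M_dist_sym w x y : M_dist rho w x y = M_dist rho w y x.
Proof.
congr inf; apply/seteqP; split=> _ [x' [y' [hx hy ->]]];
  by exists y', x'; split; [exact: hy|exact: hx|exact: normx_distC].
Qed.

(** The slack [e] is there because the infimum may not be attained. A nearly optimal pair is
    translated by means of [M_eq_sub], so that [y] itself is its second member. *)
Lemma M_dist_representative w x y (e : R) : 0 < e ->
  exists x', M_eq rho x x' /\ normx rho w (x' - y) < M_dist rho w y x + e.
Proof.
move=> e0; rewrite M_dist_sym.
have [|_ [x' [y' [hx hy ->]]] h] := @inf_adherent R
  [set r | exists x' y', [/\ M_eq rho x x', M_eq rho y y' & r = normx rho w (x' - y')]] e e0.
  split; last by exists 0 => _ [? [? [_ _ ->]]]; exact: normx_ge0.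
  by exists (normx rho w (x - y)), x, y; split => //; exact: M_eq_refl.
exists (x' + (y - y')); split; first exact: M_eq_sub.
have -> : x' + (y - y') - y = x' - y' by rewrite -addrA (addrAC y) subrr add0r.
exact: h.
Qed.

(** Lets the slack of the representatives tend to 0; for [e <= 1] the number [M] dominates the
    coefficient of [e]. *)
Lemma le_limit_sqr (a k c d e0 : R) : 0 <= k -> 0 <= d -> 0 < e0 ->
  (forall e, 0 < e -> e <= e0 -> a <= k * (d + e) ^+ 2 + c * e) -> a <= k * d ^+ 2.
Proof.
move=> k0 d0 e00 h; apply/ler_addgt0Pr => eps eps0.
pose M := k * (2 * d + 1) + `|c| + 1.
have kd : 0 <= k * (2 * d + 1) by rewrite mulr_ge0// addr_ge0// mulr_ge0.
have M0 : 0 < M by rewrite ltr_wpDl ?ltr01// addr_ge0.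
pose e := Num.min (Num.min e0 1) (eps / M).
have e_gt0 : 0 < e by rewrite !lt_min e00 ltr01 divr_gt0.
have [e1 e2 e3] : [/\ e <= e0, e <= 1 & e <= eps / M] by split; rewrite !ge_min lexx ?orbT.
apply: le_trans (h e e_gt0 e1) _.
have -> : k * (d + e) ^+ 2 + c * e = k * d ^+ 2 + e * (k * (2 * d + e) + c) by ring.
rewrite lerD2l; apply: (@le_trans _ _ (e * M)); last first.
  by rewrite -ler_pdivlMr.
rewrite ler_wpM2l ?(ltW e_gt0)// /M -addrA; apply: lerD.
  by rewrite ler_wpM2l// lerD2l.
by rewrite (le_trans (ler_norm c))// lerDl.
Qed.

Section NewtonOnQuotient.
Variables (f : system A) (z : 'cV[R[i]]_n).
Hypothesis f_neq0 : forall i, f i != 0.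
Hypothesis fz_eq0 : forall i, dualapp (evalV rho i z) (f i) = 0.
Hypothesis fz_unit : DS rho f z \in unitmx.

Let c := muR rho f z * nuR rho z.

Let c_ge1 : 1 <= c.
Proof.
by rewrite /c -[leLHS]mulr1; apply: ler_pM; rewrite ?muR_ge1 ?(nuR_ge1 n_gt0 A_neq0 rho_gt0 fz_unit).
Qed.

Let c_ge0 : 0 <= c. Proof. exact: le_trans c_ge1. Qed.

Lemma newton_quotient x : c * M_dist rho z z x < 5 / 27 ->
  newton_defined rho f x /\
  M_dist rho z z (newton rho f x) <= 7 / 4 * c * M_dist rho z z x ^+ 2.
Proof.
set d := M_dist rho z z x => cd.
have d0 : 0 <= d by exact: M_dist_ge0.
have c0 : 0 < c by exact: lt_le_trans c_ge1.
have k0 : 0 <= 7 / 4 * c by apply: mulr_ge0 c_ge0; rewrite divr_ge0.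
(* The slack for which [c (d + e0)] is exactly [5/27], the limit of [newton_contraction]. *)
pose e0 := (5 / 27 - c * d) / c.
have e00 : 0 < e0 by rewrite divr_gt0// subr_gt0.
have rep e : 0 < e -> e <= e0 -> newton_defined rho f x /\
    M_dist rho z z (newton rho f x) <= 7 / 4 * c * (d + e) ^+ 2 + 0 * e.
  move=> e_gt0 ee0; have [x' [xx' hx]] := M_dist_representative z x z e_gt0.
  have x'E : z + (x' - z) = x' by rewrite addrC subrK.
  have [|u1 u2] := newton_contraction n_gt0 A_neq0 rho_gt0 f_neq0 fz_unit fz_eq0
    (_ : muR rho f z * nuR rho z * normx rho z (x' - z) <= 5 / 27).
    rewrite -/c; apply: le_trans (_ : c * (d + e) <= _).
      by rewrite ler_wpM2l// ltW.
    rewrite mulrDr -lerBrDl mulrC -ler_pdivlMr//.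
  move: u1 u2; rewrite x'E -/c => u1 u2.
  have ux : newton_defined rho f x := (M_eq_newton_defined xx' f).1 u1.
  split=> //; rewrite mul0r addr0.
  apply: le_trans (_ : normx rho z (z - newton rho f x') <= _).
    apply: M_dist_le; first exact: M_eq_refl.
    rewrite (M_eq_newton xx' ux).
    have {1}-> : newton rho f x = x + (newton rho f x - x) by rewrite addrC subrK.
    have -> : newton rho f x + (x' - x) = x' + (newton rho f x - x).
      by rewrite addrCA addrA.
    exact: M_eq_add.
  rewrite (normx_distC A_neq0 rho_gt0); apply: le_trans u2 _.
  apply: (ler_wpM2l k0).
  by rewrite ler_sqr ?nnegrE ?normx_ge0 ?addr_ge0 ?(ltW e_gt0)// ltW.
split; first by have [] := rep e0 e00 (lexx _).
apply: (@le_limit_sqr _ _ 0 _ e0) => //.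
by move=> e h1 h2; have [] := rep e h1 h2.
Qed.

End NewtonOnQuotient.

End Quotient.

(** Since [7/4 c d_0 <= 7/2 u < 1/2], each step gives [d_{k+1} d_0 <= d_k^2 / 2], and the exponents
    match because [2 (2^k - 1) + 1 = 2^{k+1} - 1]. *)
Lemma quadratic_convergence (R : realType) (d : nat -> R) (u c : R) :
  u < 5 / 54 -> 0 < c -> (forall k, 0 <= d k) -> c * d 0%N <= 2 * u ->
  (forall k, c * d k < 5 / 27 -> d k.+1 <= 7 / 4 * c * d k ^+ 2) ->
  forall k, c * d k < 5 / 27 /\ d k <= (2^-1) ^+ (2 ^ k).-1 * d 0%N.
Proof.
move=> u_lt c0 d0 h0 step.
have cd0 : c * d 0%N < 5 / 27 by apply: le_lt_trans h0 _; lra.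
have half k : 0 <= (2^-1 : R) ^+ k <= 1.
  by rewrite exprn_ge0 ?exprn_ile1 ?invr_ge0// invf_le1// ler1n.
have small k : d k <= (2^-1) ^+ (2 ^ k).-1 * d 0%N -> c * d k < 5 / 27.
  move=> h; apply: le_lt_trans cd0; rewrite ler_wpM2l ?(ltW c0)//.
  apply: le_trans h _.
  by rewrite ler_piMl//; have /andP[] := half (2 ^ k).-1.
suff main k : d k <= (2^-1) ^+ (2 ^ k).-1 * d 0%N by move=> k; split=> //; exact: small.
elim: k => [|k IH]; first by rewrite expn0 expr0 mul1r.
apply: le_trans (step k (small k IH)) _.
apply: le_trans (_ : 7 / 4 * c * ((2^-1) ^+ (2 ^ k).-1 * d 0%N) ^+ 2 <= _).
  apply: ler_wpM2l; first by rewrite mulr_ge0 ?(ltW c0) ?divr_ge0.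
  rewrite ler_sqr// nnegrE// mulr_ge0//; by have /andP[] := half (2 ^ k).-1.
have -> : 7 / 4 * c * ((2^-1) ^+ (2 ^ k).-1 * d 0%N) ^+ 2 =
  7 / 4 * (c * d 0%N) * ((2^-1) ^+ (2 ^ k).-1 ^+ 2 * d 0%N) by ring.
have -> : (2 ^ k.+1).-1 = ((2 ^ k).-1 * 2).+1.
  have : (0 < 2 ^ k)%N by rewrite expn_gt0.
  by rewrite expnS; case: (2 ^ k)%N => // p _; rewrite mulnS mulnC.
rewrite [X in _ <= X * _]exprS exprM -[leRHS]mulrA; apply: ler_wpM2r.
  by rewrite mulr_ge0// sqr_ge0.
by lra.
Qed.

(** * One step of the homotopy, and convergence at its end *)

Section HomotopyStep.
Variables (R : realType) (n : nat) (n_gt0 : (0 < n)%N).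
Variable A : 'I_n -> {fset 'rV[R]_n}.
Hypothesis A_neq0 : forall i, A i != fset0.
Variable rho : forall i : 'I_n, A i -> R.
Hypothesis rho_gt0 : forall i a, 0 < @rho i a.
Implicit Types (f g : system A) (x y z : 'cV[R[i]]_n).

Definition regular_zero f z := [/\ forall i, f i != 0,
  forall i, dualapp (evalV rho i z) (f i) = 0 & DS rho f z \in unitmx].

Definition munu f z : R := muR rho f z * nuR rho z.

Lemma munu_ge1 f z : regular_zero f z -> 1 <= munu f z.
Proof.
move=> [f0 _ fz]; rewrite /munu -[leLHS]mulr1.
by apply: ler_pM; rewrite ?muR_ge1 ?(nuR_ge1 n_gt0 A_neq0 rho_gt0 fz).
Qed.

Lemma munu_gt0 f z : regular_zero f z -> 0 < munu f z.
Proof. by move/munu_ge1; exact: lt_le_trans. Qed.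

Lemma mu_nuE f z : regular_zero f z -> (mu rho f z * nu rho z = (munu f z)%:E)%E.
Proof.
move=> [f0 _ fz]; have [-> _ _ _] := mu_unit A_neq0 rho_gt0 fz.
by have [-> _ _ _] := nu_fin A_neq0 rho_gt0 z; rewrite -EFinM.
Qed.

Lemma approx_condE u f z x : regular_zero f z ->
  approx_cond rho u f z x <-> munu f z * M_dist rho z z x <= 2 * u.
Proof.
move=> fz; rewrite /approx_cond -(muleA (2^-1)%:E) (mu_nuE fz) -!EFinM lee_fin.
by rewrite -mulrA ler_pdivrMl.
Qed.

(* Newton's step at (f, z) leaves mu nu |z - x| <= 2 / 33; moving to (g, z1)
   adds at most 4 / 95 and multiplies by 3 / 2, and
   3 / 2 * (2 / 33 + 4 / 95) < 1 / 6 <= 2 * u. *)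
Lemma homotopy_step u f g z z1 x : 1 / 12 <= u -> u < 5 / 54 ->
  regular_zero f z -> regular_zero g z1 ->
  path_dist rho f g z (z1 - z) <= 4 / 95 ->
  munu f z * M_dist rho z z x <= 2 * u ->
  newton_defined rho f x /\ munu g z1 * M_dist rho z1 z1 (newton rho f x) <= 2 * u.
Proof.
move=> u_ge u_lt fz gz D1 hx; have c0 := munu_gt0 fz.
move: D1 gz; have [h ->] : exists h, z1 = z + h.
  by exists (z1 - z); rewrite addrC subrK.
have -> : z + h - z = h by rewrite addrAC subrr add0r.
move=> D1 gz; have [f0 feq fu] := fz; have [g0 geq gu] := gz.
have cd : munu f z * M_dist rho z z x < 5 / 27 by apply: le_lt_trans hx _; lra.
have [nx hd] := newton_quotient n_gt0 A_neq0 rho_gt0 f0 feq fu cd.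
split; first exact: nx.
have {hd} hd1 : M_dist rho z z (newton rho f x) <=
  7 / 4 * munu f z * M_dist rho z z x ^+ 2 by exact: hd.
move: (newton rho f x) hd1 => x1 hd1.
have hh : munu f z * normx rho z h <= 4 / 95.
  apply: le_trans D1; rewrite /path_dist -/(munu f z); apply: ler_wpM2l; first exact: ltW.
  rewrite -[leLHS](ger0_norm (normx_ge0 rho z h)) -sqrtr_sqr ler_wsqrtr// lerDr.
  by apply: sumr_ge0 => i _; exact: sin2_ge0.
have hd2 : munu f z * M_dist rho z z x1 <= 2 / 33.
  apply: le_trans (ler_wpM2l (ltW c0) hd1) _.
  have -> : munu f z * (7 / 4 * munu f z * M_dist rho z z x ^+ 2) =
    7 / 4 * (munu f z * M_dist rho z z x) ^+ 2 by ring.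
  have : 0 <= munu f z * M_dist rho z z x.
    by apply: mulr_ge0 (ltW c0) _; exact: M_dist_ge0.
  move: (ltW cd); move: (munu f z * M_dist rho z z x) => r r1 r0.
  (* [7/4 (5/27)^2 = 175/2916] is just below [2/33]. *)
  have : r ^+ 2 <= 5 / 27 * (5 / 27) by rewrite expr2 ler_pM.
  lra.
(* The slack [e1] is scaled so that it contributes exactly [e] after multiplication by [munu f z]
   and by [3/2]. *)
apply/ler_addgt0Pr => e e0; pose e1 := e * (2 / 3) / munu f z.
have e10 : 0 < e1 by rewrite !mulr_gt0 ?invr_gt0.
have [x' [xx' hx']] := M_dist_representative A_neq0 rho_gt0 z x1 z e10.
apply: le_trans (_ : munu g (z + h) * normx rho (z + h) (x' - (z + h)) <= _).
  apply: ler_wpM2l; first exact/ltW/munu_gt0.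
  rewrite (normx_distC A_neq0 rho_gt0); apply: M_dist_le => //; exact: M_eq_refl.
apply: le_trans (path_step_up n_gt0 A_neq0 rho_gt0 f0 g0 geq fu gu _ D1) _.
rewrite -/(munu f z).
have hs : munu f z * normx rho z (x' - (z + h)) <= 2 / 33 + e * (2 / 3) + 4 / 95.
  have -> : x' - (z + h) = x' - z - h by rewrite opprD addrA.
  apply: le_trans (ler_wpM2l (ltW c0) (normxB A_neq0 rho_gt0 z (x' - z) h)) _.
  rewrite mulrDr; apply: lerD => //.
  apply: le_trans (ler_wpM2l (ltW c0) (ltW hx')) _.
  rewrite mulrDr; apply: lerD => //.
  by rewrite /e1 mulrC divfK// gt_eqF.
move: hs; move: (munu f z * _) => r hs; lra.
Qed.

Lemma newton_converges u f z (y : nat -> 'cV[R[i]]_n) : u < 5 / 54 ->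
  regular_zero f z -> munu f z * M_dist rho z z (y 0%N) <= 2 * u ->
  (forall k, y k.+1 = newton rho f (y k)) ->
  forall k, newton_defined rho f (y k) /\
    M_dist rho z (y k) z <= (2^-1) ^+ (2 ^ k).-1 * M_dist rho z (y 0%N) z.
Proof.
move=> u_lt fz h0 hy; have [f0 feq fu] := fz.
have step k (hk : munu f z * M_dist rho z z (y k) < 5 / 27) :=
  newton_quotient n_gt0 A_neq0 rho_gt0 f0 feq fu hk.
have hstep k : munu f z * M_dist rho z z (y k) < 5 / 27 ->
    M_dist rho z z (y k.+1) <= 7 / 4 * munu f z * M_dist rho z z (y k) ^+ 2.
  by move=> hk; rewrite (hy k); exact: (step k hk).2.
move=> k; have [h1 h2] := @quadratic_convergence R (fun k => M_dist rho z z (y k)) _ _ u_lt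
  (munu_gt0 fz) (fun k => M_dist_ge0 rho _ _ _) h0 hstep k.
split; first by have [] := step k h1.
rewrite (M_dist_sym A_neq0 rho_gt0 z (y k) z) (M_dist_sym A_neq0 rho_gt0 z (y 0%N) z).
exact: h2.
Qed.

End HomotopyStep.

(** * Numerical bounds for [u0] *)

Lemma sqrt7_bounds (R : realType) : 82 / 31 <= Num.sqrt (7 : R) <= 127 / 48.
Proof.
have s0 := sqrtr_ge0 (7 : R).
have s2 : Num.sqrt (7 : R) * Num.sqrt 7 = 7 by rewrite -expr2 sqr_sqrtr.
move: (Num.sqrt 7) s0 s2 => s s0 s2.
apply/andP; split; rewrite leNgt; apply/negP => h.
  have : s * s <= 82 / 31 * (82 / 31) by apply: ler_pM => //; exact: ltW.
  by rewrite s2; clear; lra.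
have : 127 / 48 * (127 / 48) <= s * s by apply: ler_pM; rewrite ?(ltW h)//; clear; lra.
by rewrite s2; clear; lra.
Qed.

(** From [5/54] on, lower bounds for the factors put the left side above [0.178], whereas the right
    side is below [0.1775]. *)
Lemma u0_lt (R : realType) (u : R) : u + 2 * u * (expR (4 * u) - 1) *
  expR (expR (4 * u) - 1 - 4 * u) = (3 - Num.sqrt 7) / 2 -> u < 5 / 54.
Proof.
move=> u_eq; rewrite ltNge; apply/negP => h.
have c1 : 33 / 23 <= expR (10 / 27 : R).
  (* [10/27] is eight times [5/108]: the bound [1 + c = 113/108] is squared three times, with
     rounding down. *)
  have [c cE] : exists c : R, c = 5 / 108 by exists (5 / 108).
  have -> : 10 / 27 = c + c + (c + c) + (c + c + (c + c)) by rewrite cE; field.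
  rewrite !expRD; have := expR_ge1Dx c; rewrite cE; move: (expR _) => w w1.
  have w0 : 113 / 108 <= w by lra.
  have w2 : 81 / 74 <= w * w.
    by apply: le_trans (ler_pM _ _ w0 w0); clear; lra.
  have w4 : 115 / 96 <= w * w * (w * w).
    by apply: le_trans (ler_pM _ _ w2 w2); clear; lra.
  by apply: le_trans (ler_pM _ _ w4 w4); clear; lra.
have c2 : expR (10 / 27 : R) * (1 + (4 * u - 10 / 27)) <= expR (4 * u).
  have {2}-> : 4 * u = 10 / 27 + (4 * u - 10 / 27) by ring.
  by rewrite expRD ler_wpM2l ?expR_ge0 ?expR_ge1Dx.
have c3 : 33 / 23 * (1 + (4 * u - 10 / 27)) <= expR (4 * u).
  by apply: le_trans c2; rewrite ler_wpM2r//; lra.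
have c4 : 15 / 14 - 1 / 138 <= expR (expR (4 * u) - 1 - 4 * u).
  by apply: le_trans (expR_ge1Dx _); lra.
have c5 : 5 / 27 * (10 / 23) <= 2 * u * (expR (4 * u) - 1) by apply: ler_pM; lra.
have c6 : 5 / 27 * (10 / 23) * (15 / 14 - 1 / 138) <=
  2 * u * (expR (4 * u) - 1) * expR (expR (4 * u) - 1 - 4 * u).
  by apply: ler_pM => //; clear; lra.
have /andP[s1 _] := sqrt7_bounds R.
move: u_eq c6 h s1; move: (_ * expR _) (Num.sqrt 7) => X s; clear; lra.
Qed.

(** Below [1/12] the left side is at most [1/12 + 1/6 * 19/45 * 6/5 < 0.168], whereas the right side
    exceeds [0.177]. *)
Lemma u0_ge (R : realType) (u : R) : 0 < u -> u + 2 * u * (expR (4 * u) - 1) *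
  expR (expR (4 * u) - 1 - 4 * u) = (3 - Num.sqrt 7) / 2 -> 1 / 12 <= u.
Proof.
move=> u_gt0 u_eq; rewrite leNgt; apply/negP => h.
have c1 : expR (4 * u) <= 64 / 45.
  have [c cE] : exists c : R, c = 1 / 12 by exists (1 / 12).
  apply: le_trans (_ : expR (c + c + (c + c)) <= _).
    by rewrite ler_expR cE; lra.
  rewrite !expRD; have := expR_mul1B_le1 c; have := expR_ge0 c.
  rewrite cE; move: (expR _) => w w0 w1.
  have w2 : w <= 12 / 11 by lra.
  have w3 : w * w <= 25 / 21 by apply: le_trans (ler_pM w0 w0 w2 w2) _; clear; lra.
  by apply: le_trans (ler_pM (mulr_ge0 w0 w0) (mulr_ge0 w0 w0) w3 w3) _; clear; lra.
have c2 : expR (expR (4 * u) - 1 - 4 * u) <= 6 / 5.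
  have h1 : expR (4 * u) - 1 - 4 * u <= 1 / 6.
    have := expR_sub1_le (4 * u).
    have : 4 * u * expR (4 * u) <= 4 * u * (64 / 45) by rewrite ler_wpM2l// mulr_ge0// ltW.
    by lra.
  apply: le_trans (_ : expR (1 / 6) <= _); first by rewrite ler_expR.
  by have := expR_mul1B_le1 (1 / 6 : R); lra.
have e1 : 0 <= expR (4 * u) - 1 by rewrite subr_ge0 -expR0 ler_expR mulr_ge0// ltW.
have c3 : 2 * u * (expR (4 * u) - 1) <= 1 / 6 * (19 / 45).
  by apply: ler_pM => //; [rewrite mulr_ge0// ltW|lra|lra].
have c4 : 2 * u * (expR (4 * u) - 1) * expR (expR (4 * u) - 1 - 4 * u) <=
    1 / 6 * (19 / 45) * (6 / 5).
  by apply: ler_pM => //; rewrite ?expR_ge0// mulr_ge0// mulr_ge0// ltW.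
have /andP[_ s1] := sqrt7_bounds R.
move: u_eq c4 h s1; move: (_ * expR _) (Num.sqrt 7) => X s; clear; lra.
Qed.

(** * Absolutely continuous functions *)

Section AbsoluteContinuity.
Variable R : realType.
Implicit Types (a b x y : R) (g : R -> R) (s : seq (R * R)).

Definition nonoverlapping a b s :=
  all (fun p => [&& a <= p.1, p.1 <= p.2 & p.2 <= b]) s &&
  pairwise (fun p q => p.2 <= q.1) s.

Definition total_length s : R := \sum_(p <- s) (p.2 - p.1).

Definition total_increment g s : R := \sum_(p <- s) `|g p.2 - g p.1|.

(** Lists of intervals, unlike indexed families, can be concatenated and filled with partitions,
    which the study of the variation requires. *)
Definition abs_cont a b g := forall eps, 0 < eps -> exists2 delta, 0 < delta &
  forall s, nonoverlapping a b s -> total_length s < delta ->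
    total_increment g s < eps.

Definition partition_pairs x (t : seq R) : seq (R * R) := zip (x :: t) t.

Lemma partition_pairsP x y (t : seq R) : itv_partition x y t ->
  [/\ nonoverlapping x y (partition_pairs x t),
      total_length (partition_pairs x t) = y - x &
      forall g, total_increment g (partition_pairs x t) = variation x y g t].
Proof.
move=> xyt; split.
- elim: t x xyt => [|z t IH] x xyt //.
  have xz : x < z by case: xyt => /= /andP[].
  have zyt := itv_partition_cons xyt.
  have zy := itv_partition_le zyt.
  have /andP[/allP h1 h2] := IH z zyt.
  rewrite /nonoverlapping /= lexx (ltW xz) zy /=; apply/and3P; split.
  + apply/allP => p /h1 /and3P[p1 p2 p3].
    by rewrite (le_trans (ltW xz))// p2.
  + by apply/allP => p /h1 /and3P[p1 p2 p3].
  + exact: h2.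
- elim: t x xyt => [|z t IH] x xyt.
    by rewrite /total_length big_nil (itv_partition_nil xyt) subrr.
  rewrite /total_length big_cons /= -/(partition_pairs z t).
  have := IH z (itv_partition_cons xyt); rewrite /total_length => ->.
  by ring.
- move=> g; rewrite (variation_zip _ xyt) /total_increment /partition_pairs.
  move: {xyt}(x :: t) => u.
  elim: t u => [|z t IH] [|w u] //=; rewrite ?big_nil// !big_cons IH//.
Qed.

Lemma nonoverlapping_widen a b x y s : a <= x -> y <= b ->
  nonoverlapping x y s -> nonoverlapping a b s.
Proof.
move=> ax yb /andP[/allP h1 h2]; apply/andP; split=> //.
apply/allP => p /h1 /and3P[p1 p2 p3].
by rewrite (le_trans ax)// p2 (le_trans p3).
Qed.

Section Variation.
Variables (a b : R) (g : R -> R).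
Hypothesis ab : a <= b.
Hypothesis acg : abs_cont a b g.

Let TV := @total_variation R.

Let TV_small : exists2 d : R, 0 < d & forall x y, a <= x -> x <= y -> y <= b ->
  y - x < d -> (TV x y g <= 1%:E)%E.
Proof.
have [d d0 hd] := acg ltr01; exists d => // x y ax xy yb yx.
apply: ge_ereal_sup => _ [_ [t xyt <-] <-]; rewrite lee_fin.
have [h1 h2 h3] := partition_pairsP xyt.
rewrite -h3; apply/ltW/hd; last by rewrite h2.
exact: nonoverlapping_widen h1.
Qed.

(** The variation is at most 1 over any length below [d] ([TV_small]), and finitely many steps of
    length [d / 2] lead from [x] to [y]. *)
Lemma abs_cont_TV_fin x y : a <= x -> x <= y -> y <= b -> TV x y g \is a fin_num.
Proof.
move=> ax xy yb; have [d d0 hd] := TV_small.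
suff fin k : forall x y, a <= x -> x <= y -> y <= b -> y - x < k%:R * (d / 2) ->
    TV x y g \is a fin_num.
  apply: (fin (Num.bound ((y - x) / (d / 2)))) => //.
  rewrite -ltr_pdivrMr ?divr_gt0//; apply: archi_boundP.
  by rewrite divr_ge0 ?subr_ge0 ?divr_ge0// ltW.
elim: k => [|k IH] {ax xy yb}x {}y ax xy yb.
  by rewrite mul0r subr_lt0 ltNge xy.
rewrite -natr1 mulrDl mul1r => yx.
have [h|h] := leP (x + d / 2) y; last first.
  rewrite ge0_fin_numE ?total_variation_ge0//.
  apply: le_lt_trans (hd x y ax xy yb _) (ltry _).
  by lra.
have xd : x <= x + d / 2 by rewrite lerDl divr_ge0// ltW.
rewrite [TV x y g](total_variationD g xd h) fin_numD; apply/andP; split.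
  rewrite ge0_fin_numE ?total_variation_ge0//.
  apply: le_lt_trans (hd _ _ ax xd (le_trans h yb) _) (ltry _).
  by lra.
apply: IH => //; first exact: le_trans xd.
by rewrite opprD addrA ltrBlDr.
Qed.

Definition variation_fun x : R := fine (TV a x g).
Let V := variation_fun.

Lemma variation_funE x y : a <= x -> x <= y -> y <= b ->
  (V y - V x)%:E = TV x y g.
Proof.
move=> ax xy yb.
have f1 := abs_cont_TV_fin (lexx a) ax (le_trans xy yb).
have f2 := abs_cont_TV_fin ax xy yb.
rewrite /V /variation_fun [TV a y g](total_variationD g ax xy) fineD//.
by rewrite addrAC subrr add0r fineK.
Qed.

Lemma variation_fun_incr x y : a <= x -> x <= y -> y <= b ->
  `|g y - g x| <= V y - V x.
Proof.
move=> ax xy yb; rewrite -lee_fin variation_funE//.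
exact: total_variation_ge.
Qed.

(** Each interval of [s] is filled with a partition that nearly attains its total variation. The
    total length is unchanged, so absolute continuity of [g] on the finer list controls [V] on [s].
    The last clause keeps the concatenated lists ordered in the induction. *)
Let refine s eta : nonoverlapping a b s -> 0 < eta -> exists s',
  [/\ nonoverlapping a b s', total_length s' = total_length s,
      \sum_(p <- s) (V p.2 - V p.1) <= total_increment g s' + eta &
      forall q, q \in s' -> exists2 p, p \in s & p.1 <= q.1 /\ q.2 <= p.2].
Proof.
elim: s eta => [|p s IH] eta.
  exists [::]; split=> //; rewrite /total_increment !big_nil add0r; exact: ltW.
rewrite /nonoverlapping /= => /andP[/andP[/and3P[ap pp pb] alls] /andP[/allP ps prs]] eta0.
have [s' [n1 n2 n3 n4]] := IH (eta / 2) (introT andP (conj alls prs)) (divr_gt0 eta0 (ltr0n _ 2)).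
have fin := abs_cont_TV_fin ap pp pb.
have [_ [_ [t pt <-] <-] ht] := ub_ereal_sup_adherent (divr_gt0 eta0 (ltr0n _ 2)) fin.
have [m1 m2 m3] := partition_pairsP pt.
move: n1 m1 => /andP[c1 c2] /andP[/allP d1 d2].
exists (partition_pairs p.1 t ++ s'); split.
- rewrite /nonoverlapping all_cat c1 andbT pairwise_cat c2 d2 /= andbT.
  apply/andP; split.
    apply/allP => q /d1 /and3P[q1 q2 q3].
    by rewrite (le_trans ap)// q2 (le_trans q3).
  apply/allrelP => q r /d1 /and3P[q1 q2 q3] /n4[p' p's [h1 h2]].
  exact: le_trans q3 (le_trans (ps _ p's) h1).
- by rewrite /total_length big_cat big_cons /= -!/(total_length _) n2 m2.
- rewrite big_cons /total_increment big_cat /= -!/(total_increment _ _).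
  have h : V p.2 - V p.1 <= variation p.1 p.2 g t + eta / 2.
    have {}ht : (TV p.1 p.2 g - (eta / 2)%:E < (variation p.1 p.2 g t)%:E)%E := ht.
    move: ht; rewrite -(variation_funE ap pp pb) -EFinN -EFinD lte_fin => ht.
    by rewrite -lerBlDr ltW.
  rewrite m3; apply: le_trans (lerD h n3) _.
  by rewrite le_eqVlt; apply/orP; left; apply/eqP; field.
- move=> q; rewrite mem_cat => /orP[/d1 /and3P[q1 q2 q3]|/n4[p' p's h]].
    by exists p; rewrite ?mem_head.
  by exists p' => //; rewrite inE p's orbT.
Qed.

Lemma abs_cont_variation_fun : abs_cont a b V.
Proof.
move=> eps eps0; have [d d0 hd] := acg (divr_gt0 eps0 (ltr0n _ 2)).
exists d => // s ns ls; have [s' [n1 n2 n3 n4]] := refine ns (divr_gt0 eps0 (ltr0n _ 2)).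
have -> : total_increment V s = \sum_(p <- s) (V p.2 - V p.1).
  rewrite /total_increment big_seq [RHS]big_seq; apply: eq_bigr => p ps.
  have /andP[/allP/(_ p ps)/and3P[h1 h2 h3] _] := ns.
  by rewrite ger0_norm// (le_trans _ (variation_fun_incr h1 h2 h3)).
apply: le_lt_trans n3 _; rewrite [ltRHS]splitr ltrD2r.
by apply: hd => //; rewrite n2.
Qed.

End Variation.

Lemma abs_contD a b g1 g2 : abs_cont a b g1 -> abs_cont a b g2 ->
  abs_cont a b (fun t => g1 t + g2 t).
Proof.
move=> h1 h2 eps eps0.
have [d1 d10 hd1] := h1 _ (divr_gt0 eps0 (ltr0n _ 2)).
have [d2 d20 hd2] := h2 _ (divr_gt0 eps0 (ltr0n _ 2)).
exists (Num.min d1 d2) => [|s ns]; first by rewrite lt_min d10.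
rewrite lt_min => /andP[l1 l2].
apply: (@le_lt_trans _ _ (total_increment g1 s + total_increment g2 s)).
  rewrite /total_increment -big_split; apply: ler_sum => p _ /=.
  have -> : g1 p.2 + g2 p.2 - (g1 p.1 + g2 p.1) = (g1 p.2 - g1 p.1) + (g2 p.2 - g2 p.1) by ring.
  exact: ler_normD.
by rewrite [ltRHS]splitr ltrD ?hd1 ?hd2.
Qed.

(** The source of most closure properties below: products, inverses and square roots have increments
    dominated in this way. *)
Lemma abs_cont_lipschitz (I : finType) a b g (k : R) (G : I -> R -> R) : 0 <= k ->
  (forall i, abs_cont a b (G i)) ->
  (forall x y, a <= x -> x <= y -> y <= b ->
    `|g y - g x| <= k * \sum_i `|G i y - G i x|) -> abs_cont a b g.
Proof.
move=> k0 acG hg eps eps0.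
(* The added 1 keeps the denominator positive when [k = 0] or [I] is empty. *)
pose e : R := eps / (k * #|I|%:R + 1).
have N0 : 0 < k * #|I|%:R + 1 by rewrite ltr_wpDl// mulr_ge0.
have e0 : 0 < e by rewrite divr_gt0.
have hG i := acG i e e0.
pose d i := s2val (cid2 (hG i)).
have d0 i : 0 < d i := s2valP (cid2 (hG i)).
have hd i : forall s, nonoverlapping a b s -> total_length s < d i ->
    total_increment (G i) s < e := s2valP' (cid2 (hG i)).
exists (\big[Num.min/1]_i d i) => [|s ns].
  by apply/bigmin_gtP; split=> // i _; exact: d0.
move=> /bigmin_gtP[_ ls].
apply: (@le_lt_trans _ _ (k * \sum_i total_increment (G i) s)).
  rewrite /total_increment exchange_big /= mulr_sumr big_seq [leRHS]big_seq.
  apply: ler_sum => p ps.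
  have /andP[/allP/(_ p ps)/and3P[h1 h2 h3] _] := ns.
  exact: hg.
apply: (@le_lt_trans _ _ (k * (#|I|%:R * e))).
  rewrite ler_wpM2l//; apply: le_trans (_ : \sum_(i : I) e <= _).
    by apply: ler_sum => i _; apply/ltW/hd => //; exact: ls.
  by rewrite sumr_const mulr_natl.
have -> : eps = (k * #|I|%:R + 1) * e by rewrite /e mulrC divfK// gt_eqF.
by rewrite mulrA ltr_pM2r// ltrDl.
Qed.

Lemma abs_cont_uniform a b g : abs_cont a b g ->
  forall eps, 0 < eps -> exists2 delta, 0 < delta &
  forall x y, a <= x <= b -> a <= y <= b -> `|y - x| < delta -> `|g y - g x| < eps.
Proof.
move=> acg eps eps0; have [d d0 hd] := acg eps eps0; exists d => // x y.
wlog xy : x y / x <= y => [hw hx hy|/andP[ax xb] /andP[ay yb]].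
  have [/hw|yx] := leP x y; first exact.
  by rewrite distrC [X in _ -> X < _]distrC; apply: hw => //; exact: ltW.
rewrite ger0_norm ?subr_ge0// => xyd.
have := hd [:: (x, y)]; rewrite /nonoverlapping /total_length /total_increment.
by rewrite !big_seq1 /= ax xy yb; apply.
Qed.

(** The retraction of the line to [[a, b]]; composing with it extends a function by constants, so
    that continuity and monotonicity become global. *)
Definition clamp a b x : R := Num.max a (Num.min b x).

Lemma clamp_in a b x : a <= b -> a <= clamp a b x <= b.
Proof. by move=> ab; rewrite /clamp le_max lexx /= ge_max ab /= ge_min lexx. Qed.

Lemma clamp_id a b x : a <= x <= b -> clamp a b x = x.
Proof. by move=> /andP[ax xb]; rewrite /clamp min_r// max_r. Qed.

Lemma clamp_le a b x y : x <= y -> clamp a b x <= clamp a b y.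
Proof.
move=> xy; rewrite /clamp ge_max le_max lexx /= le_max; apply/orP; right.
by rewrite le_min ge_min lexx /= ge_min xy orbT.
Qed.

Lemma clamp_lipschitz a b x y : x <= y -> clamp a b y - clamp a b x <= y - x.
Proof.
move=> xy; rewrite /clamp !maxEle !minEle.
by repeat case: ifPn; rewrite -?ltNge; lra.
Qed.

Lemma abs_cont_clamp_continuous a b g : a <= b -> abs_cont a b g ->
  continuous (g \o clamp a b).
Proof.
move=> ab acg x; apply/cvgrPdist_lt => eps eps0.
have [d d0 hd] := abs_cont_uniform acg eps0.
near=> y; rewrite distrC; apply: hd; rewrite ?clamp_in//.
apply: (@le_lt_trans _ _ `|y - x|); last first.
  by rewrite distrC; near: y; apply: cvgr_dist_lt; [exact: cvg_id|].
have [xy|/ltW yx] := leP x y.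
  by rewrite !ger0_norm ?subr_ge0 ?clamp_le// clamp_lipschitz.
rewrite distrC (distrC y).
by rewrite !ger0_norm ?subr_ge0 ?clamp_le// clamp_lipschitz.
Unshelve. all: by end_near. Qed.

End AbsoluteContinuity.

(** * Densities of absolutely continuous functions *)

Section StieltjesDensity.
Variables (R : realType) (a b : R) (V : R -> R).
Hypothesis ab : a < b.
Hypothesis V_mono : forall x y, a <= x -> x <= y -> y <= b -> V x <= V y.
Hypothesis acV : abs_cont a b V.

Let le_ab : a <= b. Proof. exact: ltW. Qed.
Let G := V \o clamp a b.
Let lam : {measure set (measurableTypeR R) -> \bar R} := @lebesgue_measure R.

Let G_mono x y : x <= y -> G x <= G y.
Proof.
move=> xy; have /andP[h1 h2] := clamp_in x le_ab; have /andP[h3 h4] := clamp_in y le_ab.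
by apply: V_mono => //; exact: clamp_le.
Qed.

Let G_cont : continuous G.
Proof. exact: abs_cont_clamp_continuous. Qed.

Let G_right : right_continuous G.
Proof. exact/right_continuousW/G_cont. Qed.

HB.instance Definition _ := @isCumulative.Build R _ R G G_mono G_right.

Let lsm_oc x y : x <= y ->
  lebesgue_stieltjes_measure (G : cumulative R R) `]x, y]%classic = (G y - G x)%:E.
Proof.
move=> xy; rewrite /lebesgue_stieltjes_measure /measure_extension.
by rewrite measurable_mu_extE/=; [rewrite wlength_itv_bnd|exact: is_ocitv].
Qed.

Let mG : {measure set (measurableTypeR R) -> \bar R} := lebesgue_stieltjes_measure (G : cumulative R R).

Let mG_oc x y : x <= y -> mG `]x, y]%classic = (G y - G x)%:E.
Proof. exact: lsm_oc. Qed.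

Let ac_G eps : 0 < eps -> exists2 delta : R, 0 < delta & forall s : seq (R * R),
  all (fun p => p.1 <= p.2) s -> pairwise (fun p q => p.2 <= q.1) s ->
  total_length s < delta -> \sum_(p <- s) (G p.2 - G p.1) < eps.
Proof.
move=> eps0; have [d d0 hd] := acV eps0; exists d => // s /allP h1 h2 h3.
pose s' := [seq (clamp a b p.1, clamp a b p.2) | p <- s].
have ns' : nonoverlapping a b s'.
  apply/andP; split.
    apply/allP => _ /mapP[p ps ->] /=.
    have /andP[-> _] := clamp_in p.1 le_ab; have /andP[_ ->] := clamp_in p.2 le_ab.
    by rewrite clamp_le//= h1.
  rewrite /s' pairwise_map; apply: sub_pairwise h2 => p q /=.
  exact: clamp_le.
have := hd s' ns'; rewrite /total_increment /total_length /s' !big_map /= => hs.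
apply: le_lt_trans (hs _); first by apply: ler_sum => p _; exact: ler_norm.
apply: le_lt_trans h3; rewrite /total_length big_seq [leRHS]big_seq.
by apply: ler_sum => p /h1; exact: clamp_lipschitz.
Qed.

Let open_interval_bounded (I : set R) : open I -> is_interval I ->
  (lam I < +oo)%E -> I = set0 \/ exists l r, l < r /\ I = `]l, r[%classic.
Proof.
move=> oI iI fI; have IE : I = [set` Rhull I] by rewrite RhullK ?inE.
move: (Rhull I) IE => i IE; rewrite IE in oI fI *.
have li := etrans (erefl (lam [set` i])) (lebesgue_measure_itv i).
case: i oI fI li {IE} => -[c l|[|]] [d r|[|]] oI fI li.
all: try by left; rewrite set_itv_ge.
- have [lr|lr] := ltP l r; last first.
    left; move: oI; rewrite openE => oI.
    apply/seteqP; split=> // x xI; have := oI _ xI.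
    by rewrite interior_itv_bnd set_itv_ge// bnd_simp -leNgt.
  by right; exists l, r; split=> //; rewrite -((interior_id _).1 oI) interior_itv_bnd.
all: by move: fI; rewrite li /= ?ltry ?ltNyr ?ltNyy /=.
Qed.

Let mG_open_itv l r : l <= r -> (mG `]l, r[%classic <= (G r - G l)%:E)%E.
Proof.
move=> lr; rewrite -mG_oc//; apply: le_measure; rewrite ?inE//.
by apply: subset_itvl; rewrite bnd_simp.
Qed.

(** Bounded open intervals have [mG] at most an increment of [G], and absolute continuity bounds the
    sum of these increments once the intervals are listed from left to right. *)
Let mG_disjoint_sum eps : 0 < eps -> exists2 delta : R, 0 < delta &
  forall (n : nat) (I : nat -> set R), (forall k, open (I k) /\ is_interval (I k)) ->
  trivIset setT I -> (lam (\big[setU/set0]_(k < n) I k) < delta%:E)%E ->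
  (\sum_(k < n) mG (I k) <= eps%:E)%E.
Proof.
move=> eps0; have [d d0 hd] := ac_G eps0; exists d => // n I oI tI lI.
have mI k : measurable (I k) by apply: open_measurable; have [] := oI k.
have sumI : lam (\big[setU/set0]_(k < n) I k) = (\sum_(k < n) lam (I k))%E.
  have hU : measurable (\big[setU/set0]_(k < n) I k).
    by rewrite -bigcup_mkord; exact: bigcup_measurable.
  exact: (@measure_semi_additive _ _ _ lam I n mI tI hU).
have finI (k : 'I_n) : (lam (I k) < +oo)%E.
  apply: le_lt_trans (lt_trans lI (ltry _)).
  by rewrite sumI (bigD1 k)//= leeDl// sume_ge0.
have ex (k : 'I_n) : exists lr : R * R, lr.1 <= lr.2 /\ I k = `]lr.1, lr.2[%classic.
  have [ok ik] := oI k; have [->|[l [r [lr ->]]]] := open_interval_bounded ok ik (finI k).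
    by exists (0, 0); split=> //; rewrite set_itv_ge// bnd_simp ltxx.
  by exists (l, r); split=> //; exact: ltW.
pose p (k : 'I_n) := sval (cid (ex k)).
have pP (k : 'I_n) := svalP (cid (ex k)).
(* Empty intervals carry arbitrary endpoints that could break the order, so they are dropped; by
   [sumK] they contribute nothing. *)
pose K := sort (fun j k => (p j).1 <= (p k).1) [seq k <- enum 'I_n | (p k).1 < (p k).2].
have memK k : (k \in K) = ((p k).1 < (p k).2).
  by rewrite mem_sort mem_filter mem_enum andbT.
have uK : uniq K by rewrite sort_uniq filter_uniq ?enum_uniq.
have sK : pairwise (fun j k => (p j).1 <= (p k).1) K.
  rewrite -sorted_pairwise; last by move=> x y z; exact: le_trans.
  by apply: sort_sorted => x y; exact: le_total.
have dK : pairwise (fun j k => (p j).2 <= (p k).1) K.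
  have h : pairwise (fun j k => ((p j).1 <= (p k).1) && (j != k)) K.
    by rewrite pairwise_relI sK -uniq_pairwise.
  have allK : all (fun k => (p k).1 < (p k).2) K by apply/allP => k; rewrite memK.
  apply: sub_in_pairwise allK h => j k jj kk /andP[jk1 jk2].
  rewrite leNgt; apply/negP => kj.
  (* If two intervals overlapped, this midpoint [m] would lie in both. *)
  pose x := Num.min (p j).2 (p k).2; pose m := ((p k).1 + x) / 2.
  have kx : (p k).1 < x by rewrite lt_min kj.
  have [m1 m2] : (p k).1 < m /\ m < x by rewrite /m; split; lra.
  have xj : x <= (p j).2 by rewrite ge_min lexx.
  have xk : x <= (p k).2 by rewrite ge_min lexx orbT.
  have mj : I j m.
    rewrite (pP j).2 /= in_itv /=; apply/andP; split.
      exact: le_lt_trans jk1 m1.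
    exact: lt_le_trans m2 xj.
  have mk : I k m by rewrite (pP k).2 /= in_itv /= m1 (lt_le_trans m2).
  have := tI j k Logic.I Logic.I; move/(_ (ex_intro _ m (conj mj mk))) => /val_inj jk.
  by rewrite jk eqxx in jk2.
pose s := [seq p k | k <- K].
have lenI (k : 'I_n) : lam (I k) = ((p k).2 - (p k).1)%:E.
  rewrite (pP k).2 [LHS]lebesgue_measure_itv /= lte_fin; case: ltP => // h.
  by have := (pP k).1; rewrite -/(p k) => h'; rewrite (_ : (p k).1 = (p k).2) ?subrr//; apply/eqP; rewrite eq_le h'.
have sumK (f : R * R -> R) : (forall q : R * R, q.1 = q.2 -> f q = 0) ->
    \sum_(k < n) f (p k) = \sum_(q <- s) f q.
  move=> f0; rewrite /s big_map.
  have Kp : perm_eq K [seq k <- enum 'I_n | (p k).1 < (p k).2] by rewrite perm_sort.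
  rewrite [RHS](perm_big _ Kp) /=.
  rewrite big_filter big_enum_cond /= [RHS]big_mkcond /=; apply: eq_bigr => k _.
  case: ifPn => //; rewrite -leNgt => h; apply: f0; apply/eqP.
  by rewrite eq_le h andbT (pP k).1.
have h1 : \sum_(q <- s) (G q.2 - G q.1) < eps.
  apply: hd; first by apply/allP => _ /mapP[k _ ->]; exact: (pP k).1.
    by rewrite pairwise_map.
  rewrite /total_length -sumK; last by move=> q ->; rewrite subrr.
  by move: lI; rewrite sumI; under eq_bigr do rewrite lenI; rewrite sumEFin lte_fin.
apply: le_trans (_ : (\sum_(k < n) (G (p k).2 - G (p k).1)%:E <= _)%E).
  apply: lee_sum => k _; rewrite (pP k).2.
  exact: mG_open_itv (pP k).1.
rewrite sumEFin lee_fin (sumK (fun q => G q.2 - G q.1)); first exact: ltW.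
by move=> q ->; rewrite subrr.
Qed.

(** Outer regularity encloses the null set in an open set of small Lebesgue measure, a countable
    union of disjoint open intervals; [mG_disjoint_sum] bounds all partial sums over them. *)
Let mG_dominated (A : set R) : measurable A -> lam A = 0%E -> mG A = 0%E.
Proof.
move=> mA A0; apply/eqP; rewrite eq_le measure_ge0 andbT.
apply/lee_addgt0Pr => eps eps0; rewrite add0e.
have [d d0 hd] := mG_disjoint_sum eps0.
have [|U [oU AU lU]] := lebesgue_regularity_outer mA _ d0; first by rewrite -/lam A0.
have mU : measurable U by exact: open_measurable.
have lamU : (lam U < d%:E)%E.
  have -> : U = A `|` (U `\` A) by rewrite setDUK.
  apply: le_lt_trans (measureU2 _ _ _) _ => //; first exact: measurableD.
  have A0' : (lam A <= 0)%E by rewrite A0.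
  by apply: le_lt_trans (leeD A0' (lexx _)) _; rewrite add0e.
apply: (@le_trans _ _ (mG U)); first by apply: le_measure; rewrite ?inE.
pose I := open_disjoint_itv oU.
have mI k : measurable (I k) by apply: open_measurable; exact: open_disjoint_itv_open.
have UE : U = \bigcup_k I k by exact: open_disjoint_itv_bigcup.
have tI : trivIset setT I by exact: open_disjoint_itv_trivIset.
have mUI : measurable (\bigcup_k I k) by exact: bigcup_measurable.
rewrite UE; apply: le_trans (_ : (\sum_(i <oo) mG (I i) <= _)%E).
  by rewrite (@measure_semi_bigcup _ _ _ mG I mI tI mUI).
apply: lime_le; first by apply: is_cvg_nneseries => *; exact: measure_ge0.
near=> n; rewrite big_mkord; apply: hd => //.
  by move=> k; split; [exact: open_disjoint_itv_open|exact: open_disjoint_itv_is_interval].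
have mUn : measurable (\big[setU/set0]_(k < n) I k).
  by rewrite -bigcup_mkord; exact: bigcup_measurable.
apply: le_lt_trans lamU; apply: le_measure; rewrite ?inE//.
by rewrite UE -bigcup_mkord => x [k _ Ikx]; exists k.
Unshelve. all: by end_near. Qed.

Let oc_fin : (mG `]a, b]%classic < +oo)%E.
Proof. by rewrite mG_oc ?ltry. Qed.

(* Absolute continuity makes the Lebesgue-Stieltjes measure of V null on
   Lebesgue-null sets; its Radon-Nikodym derivative is the density. *)
Lemma monotone_density : exists h : R -> R,
  [/\ forall x, 0 <= h x, lam.-integrable setT (EFin \o h) &
   forall x y, a <= x -> x <= y -> y <= b ->
     (V y - V x)%:E = (\int[lam]_(t in `]x, y]) (h t)%:E)%E].
Proof.
have mab : @measurable _ (measurableTypeR R) `]a, b] by exact: measurable_itv.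
(* Restricted to []a, b]], where [clamp] is the identity, the measure is finite. *)
pose nu : {finite_measure set (measurableTypeR R) -> \bar R} := @mfrestr _ _ R _ mG mab oc_fin.
have nulam : nu `<< (@lebesgue_measure R).
  apply/null_content_dominatesP => A mA A0; apply: mG_dominated.
    exact: measurableI.
  apply/eqP; rewrite eq_le measure_ge0 andbT -A0; apply: le_measure; rewrite ?inE//.
  exact: measurableI.
have [h [h0 hfin hint hE]] := @radon_nikodym_sigma_finite _ _ _ lebesgue_measure nu nulam.
have hK x : (fine (h x))%:E = h x by rewrite fineK.
exists (fine \o h); split=> [x /=||x y ax xy yb].
- by rewrite fine_ge0.
- by apply: eq_integrable hint => // x _ /=; rewrite hK.
- under eq_integral do rewrite /= hK.
  have mxy : @measurable _ (measurableTypeR R) `]x, y] by exact: measurable_itv.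
  apply: etrans (hE _ mxy); rewrite /nu /= /mfrestr /mrestr setIidl.
    rewrite [RHS]mG_oc//= /G /= !clamp_id ?ax ?yb ?(le_trans ax)//.
    by rewrite (le_trans xy).
  by move=> t /=; rewrite !in_itv /= => /andP[t1 t2]; rewrite (le_lt_trans ax)// (le_trans t2).
Qed.

End StieltjesDensity.

Section Density.
Variables (R : realType) (a b : R).
Hypothesis ab : a < b.
Let lam := @lebesgue_measure R.

(* g is the difference of the monotone functions V + g and V, for V its
   variation; W = (V + g) + V has a density k dominating that of g. *)
Lemma abs_cont_density g : abs_cont a b g -> exists h k W : R -> R,
  [/\ (lam.-integrable setT (EFin \o h) /\
    forall x y, a <= x -> x <= y -> y <= b ->
     (g y - g x)%:E = (\int[lam]_(t in `]x, y]) (h t)%:E)%E),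
    (lam.-integrable setT (EFin \o k) /\
    forall x y, a <= x -> x <= y -> y <= b ->
     (W y - W x)%:E = (\int[lam]_(t in `]x, y]) (k t)%:E)%E),
    abs_cont a b W & forall t, `|h t| <= k t].
Proof.
move=> acg; pose V := variation_fun a g.
have acV : abs_cont a b V := abs_cont_variation_fun acg.
have V_incr x y : a <= x -> x <= y -> y <= b -> `|g y - g x| <= V y - V x.
  exact: variation_fun_incr.
have V_mono x y : a <= x -> x <= y -> y <= b -> V x <= V y.
  by move=> ax xy yb; rewrite -subr_ge0 (le_trans _ (V_incr _ _ ax xy yb)).
have W_mono x y : a <= x -> x <= y -> y <= b -> V x + g x <= V y + g y.
  move=> ax xy yb; have := le_trans (ler_norm _) (V_incr _ _ ax xy yb).
  have : g x - g y <= V y - V x.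
    by rewrite -opprB; apply: le_trans (ler_norm _) _; rewrite normrN V_incr.
  by lra.
have acVg := abs_contD acV acg.
have [h1 [p1 i1 e1]] := monotone_density ab V_mono acV.
have [h2 [p2 i2 e2]] := monotone_density ab W_mono acVg.
exists (fun t => h2 t - h1 t), (fun t => h2 t + h1 t), (fun t => V t + g t + V t).
split; [split=> [|x y ax xy yb]|split=> [|x y ax xy yb]|exact: abs_contD|].
- rewrite (_ : EFin \o _ = (EFin \o h2) \- (EFin \o h1))%E; last exact/funext.
  exact: integrableB.
- under eq_integral do rewrite EFinB.
  have mxy : @measurable _ (measurableTypeR R) `]x, y] by exact: measurable_itv.
  have j1 := integrableS measurableT mxy (@subsetT _ _) i1.
  have j2 := integrableS measurableT mxy (@subsetT _ _) i2.
  rewrite integralB// -?e1 -?e2//= -EFinB; congr EFin.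
  by ring.
- rewrite (_ : EFin \o _ = (EFin \o h2) \+ (EFin \o h1))%E; last exact/funext.
  exact: integrableD.
- under eq_integral do rewrite EFinD.
  have mxy : @measurable _ (measurableTypeR R) `]x, y] by exact: measurable_itv.
  have j1 := integrableS measurableT mxy (@subsetT _ _) i1.
  have j2 := integrableS measurableT mxy (@subsetT _ _) i2.
  rewrite integralD// -?e1 -?e2//= -EFinD; congr EFin.
  by ring.
- by move=> t; rewrite (le_trans (ler_normB _ _))// !ger0_norm.
Qed.

(** Lebesgue's differentiation theorem applies to [F], the integral of [h] from minus infinity; on
    [[a, b]], [g] differs from [F] by a constant. *)
Lemma ae_is_derive_density g h : lam.-integrable setT (EFin \o h) ->
  (forall x y, a <= x -> x <= y -> y <= b ->
     (g y - g x)%:E = (\int[lam]_(t in `]x, y]) (h t)%:E)%E) ->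
  {ae lam, forall t, a < t < b -> is_derive t 1 g (h t)}.
Proof.
move=> ih gE.
have ihs (D : set (measurableTypeR R)) : measurable D -> lam.-integrable D (EFin \o h).
  by move=> mD; exact: integrableS ih.
have hloc : locally_integrable setT h by apply: open_integrable_locally; [exact: openT|exact: ih].
have := FTC1Ny (fun y => ihs _ (measurable_itv `]-oo, y])) hloc.
apply: filterS; first exact: (ae_filter_ringOfSetsType lam).
move=> t /= [dF F't] /andP[at_ tb].
set F := (fun x : R => _) in dF F't.
have FE y : a <= y <= b -> g a + (F y - F a) = g y.
  move=> /andP[ay yb].
  have fin x : (\int[lam]_(t in `]-oo, x]) (h t)%:E)%E \is a fin_num.
    exact/integrable_fin_num/ihs.
  have : (F y)%:E = ((F a)%:E + (g y - g a)%:E)%E.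
    rewrite gE// /F !/Rintegral !fineK//.
    have -> : `]-oo, y]%classic = `]-oo, a]%classic `|` `]a, y]%classic :> set R.
      by rewrite -itv_bndbnd_setU// bnd_simp.
    rewrite integral_setU//.
    - by rewrite -itv_bndbnd_setU//; have /measurable_int := ihs _ (measurable_itv `]-oo, y]).
    - by apply/disj_setPS => x [] /=; rewrite !in_itv /= => xa /andP[/lt_geF]; rewrite xa.
  by rewrite -EFinD => -[->]; ring.
clearbody F.
have dF' : is_derive t 1 (fun y => g a + (F y - F a)) (h t).
  have dF1 : is_derive t 1 F (h t).
    by move: F't; rewrite derive1E => F't; exact: (DeriveDef dF F't).
  have := is_deriveD (is_derive_cst (g a) t 1) (is_deriveB dF1 (is_derive_cst (F a) t 1)).
  by rewrite add0r subr0.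
apply: near_eq_is_derive dF'; near=> y; apply: FE; apply/andP; split.
  by apply: ltW; near: y; exact: lt_nbhsr.
by apply: ltW; near: y; exact: lt_nbhsl.
Unshelve. all: by end_near. Qed.

End Density.

(** * Closure properties of absolute continuity *)

Section AbsContAlgebra.
Variables (R : realType) (a b : R).
Hypothesis le_ab : a <= b.
Implicit Types g : R -> R.

Lemma abs_cont_lipschitz1 g g1 (k : R) : 0 <= k -> abs_cont a b g1 ->
  (forall x y, a <= x -> x <= y -> y <= b -> `|g y - g x| <= k * `|g1 y - g1 x|) ->
  abs_cont a b g.
Proof.
move=> k0 ac1 h; apply: (@abs_cont_lipschitz R 'I_1 a b g k (fun _ => g1)) => // x y ax xy yb.
by rewrite big_ord1 h.
Qed.

Lemma abs_cont_cst (c : R) : abs_cont a b (fun _ => c).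
Proof.
move=> eps eps0; exists 1 => // s _ _.
by rewrite /total_increment big1// => p _; rewrite subrr normr0.
Qed.

Lemma abs_contZ (c : R) g : abs_cont a b g -> abs_cont a b (fun t => c * g t).
Proof.
move=> acg; apply: (@abs_cont_lipschitz1 _ g `|c|) => // x y _ _ _.
by rewrite -mulrBr normrM.
Qed.

Lemma abs_contN g : abs_cont a b g -> abs_cont a b (fun t => - g t).
Proof.
move=> acg; apply: (@abs_cont_lipschitz1 _ g 1) => // x y _ _ _.
by rewrite mul1r -opprD normrN.
Qed.

Lemma abs_cont_sum (I : Type) (r : seq I) (G : I -> R -> R) :
  (forall i, abs_cont a b (G i)) -> abs_cont a b (fun t => \sum_(i <- r) G i t).
Proof.
move=> acG; elim: r => [|i r IH].
  by under eq_fun do rewrite big_nil; exact: abs_cont_cst.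
by under eq_fun do rewrite big_cons; exact: abs_contD.
Qed.

Lemma abs_cont_bounded g : abs_cont a b g ->
  exists2 M, 0 <= M & forall t, a <= t <= b -> `|g t| <= M.
Proof.
move=> acg; pose V := variation_fun a g.
exists (`|g a| + `|V b - V a|) => [|t /andP[ta tb]]; first by rewrite addr_ge0.
have h1 := variation_fun_incr acg (lexx a) ta tb.
have h2 : 0 <= V b - V t by apply: le_trans (variation_fun_incr acg ta tb (lexx b)).
have -> : g t = g a + (g t - g a) by ring.
apply: le_trans (ler_normD _ _) _; rewrite lerD2l; apply: le_trans h1 _.
by apply: le_trans (ler_norm _); rewrite -/V; lra.
Qed.

Lemma abs_contM g1 g2 : abs_cont a b g1 -> abs_cont a b g2 ->
  abs_cont a b (fun t => g1 t * g2 t).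
Proof.
move=> ac1 ac2; have [M1 M10 h1] := abs_cont_bounded ac1.
have [M2 M20 h2] := abs_cont_bounded ac2.
pose G (i : bool) := if i then g1 else g2.
apply: (@abs_cont_lipschitz R bool a b _ (M1 + M2) G); first exact: addr_ge0.
  by case.
move=> x y ax xy yb; rewrite big_bool /G /=.
have -> : g1 y * g2 y - g1 x * g2 x = (g1 y - g1 x) * g2 y + g1 x * (g2 y - g2 x) by ring.
apply: le_trans (ler_normD _ _) _; rewrite !normrM mulrDl !mulrDr.
have hy : `|g2 y| <= M2 by rewrite h2// yb (le_trans ax).
have hx : `|g1 x| <= M1 by rewrite h1// ax (le_trans xy).
have k1 := ler_wpM2r (normr_ge0 (g1 y - g1 x)) hy.
have k2 := ler_wpM2r (normr_ge0 (g2 y - g2 x)) hx.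
have k3 := mulr_ge0 M10 (normr_ge0 (g1 y - g1 x)).
have k4 := mulr_ge0 M20 (normr_ge0 (g2 y - g2 x)).
rewrite (mulrC `|g1 y - g1 x| `|g2 y|).
move: k1 k2 k3 k4; set u1 := M2 * _; set u2 := _ * `|g1 y - g1 x|.
by lra.
Qed.

Lemma abs_cont_gt0_bounded g : abs_cont a b g -> (forall t, a <= t <= b -> 0 < g t) ->
  exists2 m, 0 < m & forall t, a <= t <= b -> m <= g t.
Proof.
move=> acg g0.
have cg : {within `[a, b], continuous (g \o clamp a b)}.
  exact/continuous_subspaceT/(abs_cont_clamp_continuous le_ab).
have [c cab hc] := EVT_min le_ab cg.
exists (g c) => [|t tab]; first by apply: g0; move: cab; rewrite in_itv.
have := hc t; rewrite in_itv /= => /(_ tab); rewrite !clamp_id//.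
Qed.

Lemma abs_contV g : abs_cont a b g -> (forall t, a <= t <= b -> 0 < g t) ->
  abs_cont a b (fun t => (g t)^-1).
Proof.
move=> acg g0; have [m m0 hm] := abs_cont_gt0_bounded acg g0.
apply: (@abs_cont_lipschitz1 _ g (m ^- 2)) => // [|x y ax xy yb].
  by rewrite invr_ge0 sqr_ge0.
have hx : m <= g x by rewrite hm// ax (le_trans xy).
have hy : m <= g y by rewrite hm// yb (le_trans ax).
have gx : 0 < g x by exact: lt_le_trans hx.
have gy : 0 < g y by exact: lt_le_trans hy.
have -> : (g y)^-1 - (g x)^-1 = (g x - g y) / (g x * g y).
  by field; rewrite !gt_eqF.
rewrite normrM normfV distrC mulrC ler_wpM2r//.
rewrite lef_pV2 ?posrE ?normr_gt0 ?exprn_gt0 ?mulf_neq0 ?gt_eqF//.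
by rewrite normrM !gtr0_norm// expr2 ler_pM// ltW.
Qed.

(** The square root is not Lipschitz at 0; beyond [eps] it is. In [path_dist_le_length] the cost of
    [eps] is made arbitrarily small. *)
Lemma abs_cont_sqrt (eps : R) g : 0 < eps -> abs_cont a b g ->
  (forall t, a <= t <= b -> 0 <= g t) -> abs_cont a b (fun t => Num.sqrt (g t + eps)).
Proof.
move=> eps0 acg g0; pose k := (Num.sqrt eps)^-1.
have s0 : 0 < Num.sqrt eps by rewrite sqrtr_gt0.
apply: (@abs_cont_lipschitz1 _ g k) => // [|x y ax xy yb].
  by rewrite /k invr_ge0 ltW.
have gx : 0 <= g x by rewrite g0// ax (le_trans xy).
have gy : 0 <= g y by rewrite g0// yb (le_trans ax).
have ge t : 0 <= t -> Num.sqrt eps <= Num.sqrt (t + eps).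
  by move=> t0; rewrite ler_wsqrtr// lerDr.
have e : g y - g x = (Num.sqrt (g y + eps) - Num.sqrt (g x + eps)) *
    (Num.sqrt (g y + eps) + Num.sqrt (g x + eps)).
  rewrite -subr_sqr !sqr_sqrtr ?addr_ge0// ?ltW//.
  by ring.
rewrite e normrM mulrC -mulrA ler_peMr// ler_pdivlMr// mul1r.
by rewrite (le_trans (ge _ gy))// (le_trans _ (ler_norm _))// lerDl sqrtr_ge0.
Qed.

End AbsContAlgebra.

(** * Lower integrals *)

Section LowerIntegral.
Import HBNNSimple.
Local Open Scope ereal_scope.
Context d (T : measurableType d) (R : realType).
Variable mu : {measure set T -> \bar R}.
Implicit Types (D : set T) (I g : T -> \bar R).

(* The integral of a nonnegative function that need not be measurable is its
   lower integral: the supremum of the integrals of the measurable minorants. *)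
Lemma ge0_integral_le_minorant D I (M : \bar R) : measurable D ->
  (forall x, D x -> 0 <= I x) ->
  (forall g, measurable_fun [set: T] g -> (forall x, 0 <= g x) ->
    (forall x, D x -> g x <= I x) -> \int[mu]_(x in D) g x <= M) ->
  \int[mu]_(x in D) I x <= M.
Proof.
move=> mD I0 h; rewrite ge0_integralE//; apply: ge_ereal_sup => _ [/= g gI <-].
have mg : measurable_fun [set: T] (EFin \o g).
  by apply/measurable_EFinP; exact: measurable_funP.
have g0 x : 0 <= (EFin \o g) x by rewrite /= lee_fin.
rewrite -integralT_nnsfun; apply: le_trans (h _ mg g0 _).
  rewrite [leRHS]integral_mkcond; apply: ge0_le_integral => //.
  - by move=> x _; exact: g0.
  - by apply/(measurable_restrictT _ mD); exact: measurable_funTS.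
  move=> x _; rewrite /patch; case: ifPn => // xD.
  by have := gI x; rewrite /patch (negbTE xD).
by move=> x Dx; have := gI x; rewrite /patch mem_set.
Qed.

Lemma ge0_le_integral_minorant D g I : measurable D ->
  (forall x, D x -> 0 <= g x) -> (forall x, D x -> g x <= I x) ->
  \int[mu]_(x in D) g x <= \int[mu]_(x in D) I x.
Proof.
move=> mD g0 gI; have I0 x : D x -> 0 <= I x by move=> Dx; apply: le_trans (gI x Dx); exact: g0.
rewrite !ge0_integralE//; apply: ereal_sup_le => _ [/= h hg <-]; exists h => // x.
apply: le_trans (hg x) _; rewrite /patch; case: ifPn => // xD.
by apply: gI; rewrite inE in xD.
Qed.

Lemma ge0_integral_subset (D1 D2 : set T) I : D1 `<=` D2 ->
  (forall x, D2 x -> 0 <= I x) -> \int[mu]_(x in D1) I x <= \int[mu]_(x in D2) I x.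
Proof.
move=> D12 I0; rewrite integral_mkcond [leRHS]integral_mkcond.
apply: ge0_le_integral_minorant => // x _; rewrite /patch.
  by case: ifPn => //; rewrite inE => /D12 /I0.
have [|h1] := boolP (x \in D1).
  by rewrite inE => /D12 h; rewrite mem_set.
by case: ifPn => //; rewrite inE => /I0.
Qed.

(** The exceptional null set is removed from [D]: this leaves the integral of the measurable [g]
    unchanged and can only lower that of [I]. *)
Lemma ae_ge0_le_integral_minorant D g I : measurable D ->
  measurable_fun D g -> (forall x, D x -> 0 <= g x) ->
  (forall x, D x -> 0 <= I x) -> {ae mu, forall x, D x -> g x <= I x} ->
  \int[mu]_(x in D) g x <= \int[mu]_(x in D) I x.
Proof.
move=> mD mg g0 I0 [N [mN N0 hN]].
rewrite (ge0_negligible_integral mN mD mg g0 N0).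
have mDN : measurable (D `\` N) by exact: measurableD.
apply: le_trans (_ : \int[mu]_(x in D `\` N) I x <= _).
  apply: ge0_le_integral_minorant => // x [Dx Nx]; first exact: g0.
  by apply: contrapT => h; apply/Nx/hN => /= /(_ Dx).
by apply: ge0_integral_subset.
Qed.

Lemma ae_ge0_integral_le_majorant D I g : measurable D ->
  measurable_fun D g -> (forall x, D x -> 0 <= I x) -> (forall x, D x -> 0 <= g x) ->
  {ae mu, forall x, D x -> I x <= g x} ->
  \int[mu]_(x in D) I x <= \int[mu]_(x in D) g x.
Proof.
move=> mD mg I0 g0 Ig; apply: ge0_integral_le_minorant => // k mk k0 kI.
apply: ae_ge0_le_integral => //; first exact: measurable_funTS.
apply: filterS Ig => x h Dx; exact: le_trans (kI x Dx) (h Dx).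
Qed.

Lemma ge0_integral_setU_le (D1 D2 : set T) I : measurable D1 -> measurable D2 ->
  [disjoint D1 & D2] -> (forall x, (D1 `|` D2) x -> 0 <= I x) ->
  \int[mu]_(x in D1 `|` D2) I x <= \int[mu]_(x in D1) I x + \int[mu]_(x in D2) I x.
Proof.
move=> m1 m2 D12 I0; apply: ge0_integral_le_minorant => //; first exact: measurableU.
move=> g mg g0 gI; rewrite ge0_integral_setU//; last exact: measurable_funTS.
apply: leeD; apply: ge0_le_integral_minorant => // x Dx; apply: gI.
  by left.
by right.
Qed.

(** Minorants on the two parts, extended by 0 and added, form a minorant on the union. Finiteness
    allows subtraction, so that the two suprema are taken one after the other. *)
Lemma ge0_integral_setU_ge (D1 D2 : set T) I : measurable D1 -> measurable D2 ->
  [disjoint D1 & D2] -> (forall x, (D1 `|` D2) x -> 0 <= I x) ->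
  \int[mu]_(x in D1 `|` D2) I x < +oo ->
  \int[mu]_(x in D1) I x + \int[mu]_(x in D2) I x <= \int[mu]_(x in D1 `|` D2) I x.
Proof.
move=> m1 m2 D12 I0; set J := (X in _ -> _ <= X) => Joo.
have J0 : 0 <= J by exact: integral_ge0.
have Jfin : J \is a fin_num by rewrite ge0_fin_numE.
have i1 : 0 <= \int[mu]_(x in D1) I x by apply: integral_ge0 => x Dx; apply: I0; left.
have i2 : 0 <= \int[mu]_(x in D2) I x by apply: integral_ge0 => x Dx; apply: I0; right.
have sum_le g1 g2 : measurable_fun [set: T] g1 -> measurable_fun [set: T] g2 ->
    (forall x, 0 <= g1 x) -> (forall x, 0 <= g2 x) ->
    (forall x, D1 x -> g1 x <= I x) -> (forall x, D2 x -> g2 x <= I x) ->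
    \int[mu]_(x in D1) g1 x + \int[mu]_(x in D2) g2 x <= J.
  move=> mg1 mg2 g10 g20 gI1 gI2.
  pose g := (g1 \_ D1) \+ (g2 \_ D2).
  have mr1 : measurable_fun [set: T] (g1 \_ D1).
    by apply/(measurable_restrictT _ m1); exact: measurable_funTS.
  have mr2 : measurable_fun [set: T] (g2 \_ D2).
    by apply/(measurable_restrictT _ m2); exact: measurable_funTS.
  have p0 (h : T -> \bar R) D x : (forall x, 0 <= h x) -> 0 <= (h \_ D) x.
    by move=> h0; rewrite /patch; case: ifP.
  have g0 x : 0 <= g x by rewrite /g adde_ge0// p0.
  have mg : measurable_fun [set: T] g by exact: emeasurable_funD.
  have e1 x : x \in D1 -> x \in D2 = false.
    rewrite inE => h1; apply/negbTE/negP; rewrite inE => h2.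
    by move/disj_setPS : D12 => /(_ x (conj h1 h2)).
  have gE1 x : D1 x -> g x = g1 x.
    by move=> h; rewrite /g /patch e1 ?mem_set// adde0.
  have gE2 x : D2 x -> g x = g2 x.
    move=> h; rewrite /g /patch [in X in _ + X]mem_set//.
    by case: ifPn => [/e1|]; rewrite ?add0e// mem_set.
  apply: (@le_trans _ _ (\int[mu]_(x in D1 `|` D2) g x)).
    rewrite ge0_integral_setU//; last exact: measurable_funTS.
    rewrite le_eqVlt; apply/orP; left; apply/eqP; congr (_ + _); apply: eq_integral => x.
      by rewrite inE => /gE1.
    by rewrite inE => /gE2.
  apply: ge0_le_integral_minorant => //; first exact: measurableU.
  by move=> x [] h; [rewrite gE1// gI1|rewrite gE2// gI2].
have zero g : (forall x, 0 <= g x) -> forall D, 0 <= \int[mu]_(x in D) g x.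
  by move=> g0 D; exact: integral_ge0.
have le1 : \int[mu]_(x in D1) I x <= J.
  by apply: ge0_integral_subset => // x; left.
have f1 : \int[mu]_(x in D1) I x \is a fin_num.
  by rewrite ge0_fin_numE//; exact: le_lt_trans Joo.
rewrite -leeBrDl//.
apply: ge0_integral_le_minorant => //; first by move=> x Dx; apply: I0; right.
move=> g2 mg2 g20 gI2.
have J2 : \int[mu]_(x in D2) g2 x <= J.
  have := sum_le (cst 0) g2 (measurable_cst _) mg2 (fun=> lexx _) g20.
  rewrite integral0 add0e; apply => // x Dx; apply: I0; by left.
have f2 : \int[mu]_(x in D2) g2 x \is a fin_num.
  by rewrite ge0_fin_numE ?zero//; exact: le_lt_trans Joo.
rewrite leeBrDl// addeC -leeBrDl//.
apply: ge0_integral_le_minorant => //; first by move=> x Dx; apply: I0; left.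
move=> g1 mg1 g10 gI1; rewrite leeBrDl// addeC; exact: sum_le.
Qed.

End LowerIntegral.

(** * Speed of a path *)

Section ComplexCurves.
Variable R : realType.
Implicit Types (g : R -> R[i]) (t : R).

Definition is_cderive t g (c : R[i]) : Prop :=
  is_derive t (1 : R) (fun s => complex.Re (g s) : R) (complex.Re c) /\
  is_derive t (1 : R) (fun s => complex.Im (g s) : R) (complex.Im c).

Definition cabs_cont (a b : R) g : Prop :=
  abs_cont a b (fun s => complex.Re (g s)) /\ abs_cont a b (fun s => complex.Im (g s)).

Lemma abs_continuous_cabs_cont (a b : R) g : abs_continuous a b g -> cabs_cont a b g.
Proof.
move=> acg; suff h (p : R[i] -> R) : (forall x y, p (x - y) = p x - p y) ->
    (forall x, `|p x| <= normc x) -> abs_cont a b (p \o g).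
  split; apply: h; [exact: raddfB|exact: abs_Re_le|exact: raddfB|exact: abs_Im_le].
move=> pB p_le eps eps0; have [d d0 hd] := acg eps eps0; exists d => // s ns ls.
have [/allP s1 s2] := andP ns.
pose l (k : 'I_(size s)) := (nth (0, 0) s k).1.
pose r (k : 'I_(size s)) := (nth (0, 0) s k).2.
apply: le_lt_trans (hd _ l r _ _ _).
- rewrite /total_increment (big_nth (0, 0)) big_mkord; apply: ler_sum => k _ /=.
  by rewrite -pB; exact: p_le.
- by move=> k; have /and3P[] := s1 _ (mem_nth (0, 0) (ltn_ord k)).
- move=> j k jk; have /(pairwiseP (0, 0)) := s2; apply=> //; exact: ltn_ord.
- by move: ls; rewrite /total_length (big_nth (0, 0)) big_mkord.
Qed.

Lemma is_cderive_val t g c : is_cderive t g c -> cderive g t = c.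
Proof. by move=> [h1 h2]; rewrite /cderive !derive_val; case: c {h1 h2}. Qed.

Lemma is_cderiveMr t g c w : is_cderive t g c -> is_cderive t (fun s => g s * w) (c * w).
Proof.
case=> h1 h2; split.
- under eq_fun do rewrite ReM; rewrite ReM.
  apply: is_derive_eq; rewrite /GRing.scale /=; ring.
- under eq_fun do rewrite ImM; rewrite ImM.
  apply: is_derive_eq; rewrite /GRing.scale /=; ring.
Qed.

Lemma is_cderiveMl t g c w : is_cderive t g c -> is_cderive t (fun s => w * g s) (w * c).
Proof.
by move=> h; under eq_fun do rewrite mulrC; rewrite mulrC; exact: is_cderiveMr.
Qed.

Lemma is_cderiveB_cst t g c w : is_cderive t g c -> is_cderive t (fun s => g s - w) c.
Proof.
case=> h1 h2; split.
- under eq_fun do rewrite raddfB; apply: is_derive_eq; exact: subr0.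
- under eq_fun do rewrite raddfB; apply: is_derive_eq; exact: subr0.
Qed.

Lemma is_derive_big (I : Type) (r : seq I) t (G : I -> R -> R) (dG : I -> R) :
  (forall i, is_derive t (1 : R) (G i) (dG i)) ->
  is_derive t (1 : R) (fun s => \sum_(i <- r) G i s) (\sum_(i <- r) dG i).
Proof.
move=> h; elim: r => [|i r IH].
  by under eq_fun do rewrite big_nil; rewrite big_nil; exact: is_derive_cst.
under eq_fun do rewrite big_cons; rewrite big_cons.
exact: (is_deriveD (h i) IH).
Qed.

Lemma is_cderive_sum (I : Type) (r : seq I) t (G : I -> R -> R[i]) (dG : I -> R[i]) :
  (forall i, is_cderive t (G i) (dG i)) ->
  is_cderive t (fun s => \sum_(i <- r) G i s) (\sum_(i <- r) dG i).
Proof.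
move=> h; split.
- under eq_fun do rewrite Re_sum; rewrite Re_sum; apply: is_derive_big => i.
  by have [] := h i.
- under eq_fun do rewrite Im_sum; rewrite Im_sum; apply: is_derive_big => i.
  by have [] := h i.
Qed.

Lemma is_derive_normc_sqr t g c : is_cderive t g c ->
  is_derive t (1 : R) (fun s => normc (g s) ^+ 2) (2 * complex.Re (c * conjc (g t))).
Proof.
case=> h1 h2; under eq_fun do rewrite normc_sqrE.
apply: is_derive_eq; case: (g t) c {h1 h2} => x y [x' y'] /=.
rewrite /GRing.scale /=; ring.
Qed.

Section Closure.
Variables (a b : R).
Hypothesis ab : a <= b.

Lemma cabs_contMr g w : cabs_cont a b g -> cabs_cont a b (fun s => g s * w).
Proof.
case=> h1 h2; split.
- under eq_fun do rewrite ReM -[X in X - _]mulrC -[X in _ - X]mulrC.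
  by apply: abs_contD; [|apply: abs_contN]; exact: abs_contZ.
- under eq_fun do rewrite ImM -[X in X + _]mulrC -[X in _ + X]mulrC.
  by apply: abs_contD; exact: abs_contZ.
Qed.

Lemma cabs_contMl g w : cabs_cont a b g -> cabs_cont a b (fun s => w * g s).
Proof. by move=> h; under eq_fun do rewrite mulrC; exact: cabs_contMr. Qed.

Lemma cabs_contB_cst g w : cabs_cont a b g -> cabs_cont a b (fun s => g s - w).
Proof.
case=> h1 h2; split; under eq_fun do rewrite raddfB.
  by apply: abs_contD => //; exact: abs_cont_cst.
by apply: abs_contD => //; exact: abs_cont_cst.
Qed.

Lemma cabs_cont_sum (I : Type) (r : seq I) (G : I -> R -> R[i]) :
  (forall i, cabs_cont a b (G i)) -> cabs_cont a b (fun s => \sum_(i <- r) G i s).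
Proof.
move=> h; split.
- by under eq_fun do rewrite Re_sum; apply: abs_cont_sum => i; have [] := h i.
- by under eq_fun do rewrite Im_sum; apply: abs_cont_sum => i; have [] := h i.
Qed.

Lemma abs_cont_normc_sqr g : cabs_cont a b g -> abs_cont a b (fun s => normc (g s) ^+ 2).
Proof.
case=> h1 h2; under eq_fun do rewrite normc_sqrE !expr2.
by apply: abs_contD; exact: abs_contM.
Qed.

End Closure.
End ComplexCurves.

Section SineDerivative.
Variables (R : realType) (I : finType) (v : R -> I -> R[i]) (w dv : I -> R[i]) (t : R).

(** The tangent vector [e] at [u] without its component along [u]; its norm divided by [|u|] is the
    Fubini-Study norm [fsnormi]. *)
Definition orthogonal_part (u e : I -> R[i]) : I -> R[i] :=
  fun a => e a - herm e u / (hnorm u ^+ 2)%:C * u a.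

Lemma hermBl (u1 u2 u : I -> R[i]) : herm (fun a => u1 a - u2 a) u = herm u1 u - herm u2 u.
Proof. by rewrite /herm -sumrB; apply: eq_bigr => a _; rewrite mulrBl. Qed.

Lemma herm_orthogonal_part (u e : I -> R[i]) : hnorm u != 0 ->
  herm (orthogonal_part u e) u = 0.
Proof.
move=> u0; rewrite /orthogonal_part hermBl hermZl herm_self divfK ?subrr//.
by rewrite -(inj_eq (@complexI R)) in u0 *; rewrite rmorphXn expf_neq0.
Qed.

(** As [e] is orthogonal to [u], its product with [x] is its product with [x - c u]; for the
    projection [c u] of [x] that vector has length [|x| sin]. *)
Lemma normc_herm_orthogonal_le (u e x : I -> R[i]) : hnorm u != 0 -> hnorm x != 0 ->
  herm e u = 0 -> normc (herm e x) <= hnorm e * (hnorm x * Num.sqrt (sin2 u x)).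
Proof.
move=> u0 x0 eu; have [c [h _]] := sin2_projection u0 x0.
have -> : hnorm x * Num.sqrt (sin2 u x) = hnorm (fun a => c * u a - x a).
  apply/eqP; rewrite -(@eqrXn2 _ 2) ?mulr_ge0 ?hnorm_ge0 ?sqrtr_ge0//.
  by apply/eqP; apply: etrans (esym h); rewrite exprMn (sqr_sqrtr (sin2_ge0 u x)).
apply: le_trans (normc_herm_le _ _).
rewrite -[leLHS]normc_conj -[leRHS]normc_conj !herm_conj hermBl hermZl.
by rewrite -(herm_conj e u) eu conjc0 mulr0 sub0r normcN.
Qed.

(** Infinitesimally, the sine of the angle to a fixed line grows no faster than the Fubini-Study
    length; the square is used because the sine itself need not be differentiable at 0. *)
Lemma is_derive_sin2 : hnorm (v t) != 0 -> hnorm w != 0 ->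
  (forall a, is_cderive t (v^~ a) (dv a)) ->
  exists2 D : R, is_derive t (1 : R) (fun s => sin2 (v s) w) D &
    D <= 2 * (Num.sqrt (sin2 (v t) w) * (hnorm (orthogonal_part (v t) dv) / hnorm (v t))).
Proof.
move=> v0 w0 hv; pose H := herm (v t) w.
have dH : is_cderive t (fun s => herm (v s) w) (herm dv w).
  by apply: is_cderive_sum => a; exact: is_cderiveMr.
have dQ : is_derive t (1 : R) (fun s => hnorm (v s) ^+ 2)
    (2 * complex.Re (herm dv (v t))).
  under eq_fun do rewrite hnorm_sqr.
  rewrite /herm Re_sum mulr_sumr.
  by apply: is_derive_big => a; exact: is_derive_normc_sqr.
have dN := is_derive_normc_sqr dH.
pose Q := hnorm (v t) ^+ 2; pose W := hnorm w ^+ 2.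
have Q0 : Q != 0 by rewrite expf_neq0.
have W0 : W != 0 by rewrite expf_neq0.
pose e := orthogonal_part (v t) dv; pose c := herm dv (v t) / Q%:C.
have QC0 : Q%:C != 0 by rewrite (inj_eq (@complexI R)).
have h1 : herm dv (v t) = c * Q%:C by rewrite /c divfK.
(* [c] is the part of [dv] along [v t]; it cancels, since [sin2] does not see a rescaling of
   [v t]. *)
have h2 : herm dv w = c * H + herm e w by rewrite /e /orthogonal_part hermBl hermZl -/H -/Q -/c addrC subrK.
exists (- (2 * complex.Re (herm e w * conjc H)) / (Q * W)).
  have dQV := is_deriveV (f := fun s : R => hnorm (v s) ^+ 2) Q0 dQ.
  have dS := is_deriveB (is_derive_cst (1 : R) t (1 : R))
    (is_deriveM dN (is_deriveM dQV (is_derive_cst (W^-1) t (1 : R)))).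
  have -> : (fun s => sin2 (v s) w) = (fun s => 1 -
      normc (herm (v s) w) ^+ 2 * ((hnorm (v s) ^+ 2)^-1 * W^-1)).
    by apply/funext => s; rewrite /sin2 -/W invfM.
  apply: (is_derive_eq dS); rewrite /GRing.scale /= -/Q -/H h2 (mulrDl (c * H)) ReD.
  have -> : complex.Re (herm dv (v t)) = complex.Re c * Q by rewrite h1 mulrC ReZ mulrC.
  have -> : complex.Re (c * H * conjc H) = complex.Re c * normc H ^+ 2.
    by rewrite -mulrA mulc_conj mulrC ReZ mulrC.
  rewrite -[((fun y => _) * _) t]/(Q^-1 * W^-1).
  move: (complex.Re c) (complex.Re (herm e w * _)) (normc H ^+ 2) => x y z.
  by field; rewrite Q0 W0.
have e0 : herm e (v t) = 0 by exact: herm_orthogonal_part.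
have eH := normc_herm_orthogonal_le v0 w0 e0.
have HQ := normc_herm_le (v t) w; rewrite -/H in HQ.
have h : - complex.Re (herm e w * conjc H) <=
    hnorm e * (hnorm w * Num.sqrt (sin2 (v t) w)) * (hnorm (v t) * hnorm w).
  apply: le_trans (_ : normc (herm e w * conjc H) <= _).
    by apply: le_trans (abs_Re_le _); rewrite -normrN ler_norm.
  by rewrite normcM normc_conj ler_pM ?normc_ge0.
have p0 : 0 < hnorm (v t) by rewrite lt_def v0 hnorm_ge0.
have q0 : 0 < hnorm w by rewrite lt_def w0 hnorm_ge0.
rewrite -mulrN ler_pdivrMr ?mulr_gt0 ?exprn_gt0//.
move: h; rewrite /Q /W -/e; set s := Num.sqrt _; move=> h.
apply: le_trans (_ : 2 * (hnorm e * (hnorm w * s) * (hnorm (v t) * hnorm w)) <= _).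
  by rewrite ler_pM2l.
rewrite le_eqVlt; apply/orP; left; apply/eqP.
move: v0; move: (hnorm e) (hnorm w) (hnorm (v t)) s {h q0 p0} => x y z s z0.
by field.
Qed.

End SineDerivative.

Section PathSpeed.
Variables (R : realType) (n : nat) (A : 'I_n -> {fset 'rV[R]_n}).
Hypothesis A_neq0 : forall i, A i != fset0.
Variable rho : forall i : 'I_n, A i -> R.
Hypothesis rho_gt0 : forall i a, 0 < @rho i a.
Variables (f : R -> system A) (z : R -> 'cV[R[i]]_n).
Variables (f0 : system A) (z0 : 'cV[R[i]]_n).

(** Kept squared, hence differentiable wherever the path is; [path_dist] is its square root times
    the condition number at the base point. *)
Definition path_sqdist (s : R) : R :=
  sin2_sum (f s) f0 + normx rho z0 (z s - z0) ^+ 2.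

Lemma path_sqdist_ge0 s : 0 <= path_sqdist s.
Proof. by rewrite addr_ge0 ?sqr_ge0// sumr_ge0// => i _; exact: sin2_ge0. Qed.

Let normx_sqrE v : normx rho z0 v ^+ 2 =
  \sum_i \sum_(a : A i) prob rho z0 a * normc (mform rho z0 a v) ^+ 2.
Proof.
rewrite /normx sqr_sqrtr; last by apply: sumr_ge0 => i _; exact: sqr_ge0.
by apply: eq_bigr => i _; exact: normi_sqr.
Qed.

Lemma mform_shiftE i (a : A i) v : mform rho z0 a (v - z0) =
  \sum_j ((val a - momentum rho i z0) 0 j)%:C * (v j 0 - z0 j 0).
Proof. by rewrite /mform rowappE; apply: eq_bigr => j _; rewrite !mxE. Qed.

Lemma abs_cont_path_sqdist a b : a <= b ->
  (forall i (e : A i), cabs_cont a b (fun s => f s i e)) ->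
  (forall j, cabs_cont a b (fun s => z s j 0)) ->
  (forall s, a <= s <= b -> forall i, f s i != 0) -> abs_cont a b path_sqdist.
Proof.
move=> ab acf acz f_neq0; apply: abs_contD.
  apply: abs_cont_sum => i.
  have acH : cabs_cont a b (fun s => herm (f s i) (f0 i)).
    by apply: cabs_cont_sum => e; apply: cabs_contMr; exact: acf.
  have acQ : abs_cont a b (fun s => hnorm (f s i) ^+ 2).
    under eq_fun do rewrite hnorm_sqr.
    by apply: abs_cont_sum => e; apply: abs_cont_normc_sqr => //; exact: acf.
  have acQV : abs_cont a b (fun s => (hnorm (f s i) ^+ 2)^-1).
    apply: abs_contV => // s sab; rewrite exprn_gt0// lt_def hnorm_ge0 andbT.
    by rewrite hnorm_ffun_eq0; exact: f_neq0.
  have -> : (fun s => sin2 (f s i) (f0 i)) = (fun s => 1 + (- (hnorm (f0 i) ^+ 2)^-1) *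
      (normc (herm (f s i) (f0 i)) ^+ 2 * (hnorm (f s i) ^+ 2)^-1)).
    by apply/funext => s; rewrite /sin2 invfM; ring.
  apply: abs_contD; first exact: abs_cont_cst.
  apply: abs_contZ; apply: abs_contM => //; exact: abs_cont_normc_sqr.
under eq_fun do rewrite normx_sqrE.
apply: abs_cont_sum => i; apply: abs_cont_sum => e; apply: abs_contZ.
apply: abs_cont_normc_sqr => //; under eq_fun do rewrite mform_shiftE.
by apply: cabs_cont_sum => j; apply: cabs_contMl; apply: cabs_contB_cst; exact: acz.
Qed.

Variables (t : R) (df : system A) (dz : 'cV[R[i]]_n).
Hypothesis f_neq0 : forall i, f t i != 0.
Hypothesis f0_neq0 : forall i, f0 i != 0.
Hypothesis f_derive : forall i (e : A i), is_cderive t (fun s => f s i e) (df i e).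
Hypothesis z_derive : forall j, is_cderive t (fun s => z s j 0) (dz j 0).

Let is_derive_normx_sqr : exists2 D : R,
  is_derive t (1 : R) (fun s => normx rho z0 (z s - z0) ^+ 2) D &
  D <= 2 * (normx rho z0 (z t - z0) * normx rho z0 dz).
Proof.
pose w := z t - z0.
have dm i (a : A i) : is_cderive t (fun s => mform rho z0 a (z s - z0)) (mform rho z0 a dz).
  under eq_fun do rewrite mform_shiftE.
  rewrite /mform rowappE; apply: is_cderive_sum => j; apply: is_cderiveMl.
  exact: is_cderiveB_cst.
exists (\sum_i \sum_(a : A i) prob rho z0 a *
    (2 * complex.Re (mform rho z0 a dz * conjc (mform rho z0 a w)))).
  under eq_fun do rewrite normx_sqrE.
  apply: is_derive_big => i; apply: is_derive_big => a.
  have := is_deriveZ (prob rho z0 a) (is_derive_normc_sqr (dm i a)).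
  exact.
apply: le_trans (_ : 2 * \sum_i normi rho i z0 w * normi rho i z0 dz <= _).
  rewrite mulr_sumr; apply: ler_sum => i _.
  rewrite !(normiE A_neq0 rho_gt0).
  pose X v (a : A i) : R := normc ((Num.sqrt (prob rho z0 a))%:C * mform rho z0 a v).
  apply: (@le_trans _ _ (2 * \sum_(a : A i) X w a * X dz a)); rewrite /X {X}.
    rewrite mulr_sumr; apply: ler_sum => a _.
    set x := mform rho z0 a dz; set y := mform rho z0 a w.
    have p0 := prob_ge0 A_neq0 rho_gt0 z0 a.
    rewrite (normcM _ y) (normcM _ x) normcR ger0_norm ?sqrtr_ge0//.
    have h : complex.Re (x * conjc y) <= normc x * normc y.
      by apply: le_trans (Re_le _) _; rewrite (normcM x) normc_conj.
    have ss : Num.sqrt (prob rho z0 a) * Num.sqrt (prob rho z0 a) = prob rho z0 a.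
      by rewrite -expr2 sqr_sqrtr.
    move: h p0 ss; move: (Num.sqrt (prob rho z0 a)) => q.
    move: (normc x) (normc y) (complex.Re _) (prob rho z0 a) => X Y r p h p0 ss.
    have -> : 2 * (q * Y * (q * X)) = p * (2 * (X * Y)) by rewrite -ss; ring.
    by rewrite ler_wpM2l// ler_pM2l.
  by rewrite ler_pM2l//; exact: sum_mul_le_sqrt.
by rewrite ler_pM2l//; exact: sum_mul_le_sqrt.
Qed.

Let fs i := fsnormi (f t i) (df i).

Lemma is_derive_path_sqdist : exists2 D : R, is_derive t (1 : R) path_sqdist D &
  D <= 2 * (Num.sqrt (path_sqdist t) *
            Num.sqrt (fsnorm (f t) df ^+ 2 + normx rho z0 dz ^+ 2)).
Proof.
have hn0 (g : system A) (g0 : forall i, g i != 0) i : hnorm (g i) != 0.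
  by rewrite hnorm_ffun_eq0.
have hs i := @is_derive_sin2 R (A i) (fun s => f s i) (f0 i) (df i) t
  (hn0 _ f_neq0 i) (hn0 _ f0_neq0 i) (@f_derive i).
pose Ds i := s2val (cid2 (hs i)).
have Ds1 i : is_derive t (1 : R) (fun s => sin2 (f s i) (f0 i)) (Ds i) := s2valP (cid2 (hs i)).
have Ds2 i : Ds i <= 2 * (Num.sqrt (sin2 (f t i) (f0 i)) * fs i) := s2valP' (cid2 (hs i)).
have [Dz Dz1 Dz2] := is_derive_normx_sqr.
exists (\sum_i Ds i + Dz); first exact: (is_deriveD (is_derive_big _ Ds1) Dz1).
pose S := sin2_sum (f t) f0.
have S0 : 0 <= S by apply: sumr_ge0 => i _; exact: sin2_ge0.
have h1 : \sum_i Ds i <= 2 * (Num.sqrt S * fsnorm (f t) df).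
  apply: le_trans (_ : 2 * \sum_i Num.sqrt (sin2 (f t i) (f0 i)) * fs i <= _).
    by rewrite mulr_sumr; apply: ler_sum => i _; exact: Ds2.
  rewrite ler_pM2l//; apply: le_trans (sum_mul_le_sqrt _ _) _.
  rewrite le_eqVlt; apply/orP; left; apply/eqP; congr (Num.sqrt _ * _).
  by apply: eq_bigr => i _; rewrite sqr_sqrtr ?sin2_ge0.
have S2 : Num.sqrt S ^+ 2 = S by rewrite sqr_sqrtr.
(* Cauchy-Schwarz in the plane joins the contributions of the system and of the zero. *)
have h2 := @sum_mul_le_sqrt R bool
  (fun k => if k then Num.sqrt S else normx rho z0 (z t - z0))
  (fun k => if k then fsnorm (f t) df else normx rho z0 dz).
rewrite !big_bool /= S2 in h2.
rewrite /path_sqdist -/S; apply: le_trans (lerD h1 Dz2) _.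
by rewrite -mulrDr ler_pM2l.
Qed.

End PathSpeed.

(** * Condition length and the mesh *)

Section RealAnalysis.
Variable R : realType.
Implicit Types (a b s t r : R) (g Y k W : R -> R).

Lemma abs_cont_subinterval a b s t g : a <= s -> t <= b -> abs_cont a b g -> abs_cont s t g.
Proof.
move=> as_ tb acg eps eps0; have [d d0 hd] := acg eps eps0; exists d => // u nu.
exact/hd/(nonoverlapping_widen as_ tb nu).
Qed.

Lemma sqrtD_sqr_le (x y : R) : 0 <= x -> 0 <= y -> Num.sqrt (x + y ^+ 2) <= Num.sqrt x + y.
Proof.
move=> x0 y0; have s0 := sqrtr_ge0 x.
rewrite -ler_sqr ?nnegrE ?sqrtr_ge0 ?addr_ge0//.
rewrite (sqr_sqrtr (addr_ge0 x0 (sqr_ge0 y))) sqrrD sqr_sqrtr// lerD2r lerDl.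
by rewrite mulrn_wge0// mulr_ge0.
Qed.

(* Since p < q, uniform continuity propagates the bound p by steps of fixed
   length. *)
Lemma sqrt_continuation Y (c p q s t : R) : 0 < c -> p < q -> 0 <= p -> s <= t ->
  abs_cont s t Y -> (forall r, 0 <= Y r) -> Y s = 0 ->
  (forall r, s <= r <= t ->
    (forall r', s <= r' <= r -> c * Num.sqrt (Y r') <= q) -> c * Num.sqrt (Y r) <= p) ->
  forall r, s <= r <= t -> c * Num.sqrt (Y r) <= p.
Proof.
move=> c0 pq p0 st acY Y0 Ys h.
(* By [sqrtD_sqr_le], an increase of [Y] by at most [eta^2] raises [c sqrt Y] by at most
   [c eta = q - p]. *)
pose eta := (q - p) / c; have eta0 : 0 < eta by rewrite divr_gt0// subr_gt0.
have [d d0 hd] := abs_cont_uniform acY (exprn_gt0 2 eta0).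
have near_le x y : s <= x <= t -> s <= y <= t -> `|y - x| < d ->
    c * Num.sqrt (Y y) <= c * Num.sqrt (Y x) + (q - p).
  move=> hx hy /(hd _ _ hx hy) /ltW/ler_normlW; rewrite lerBlDl => yx.
  have -> : q - p = c * eta by rewrite /eta mulrC divfK// gt_eqF.
  rewrite -mulrDr ler_pM2l//; apply: le_trans (sqrtD_sqr_le (Y0 x) (ltW eta0)).
  exact: ler_wsqrtr.
have d2 : 0 < d / 2 by rewrite divr_gt0.
suff step m : forall r, s <= r <= t -> r - s <= m%:R * (d / 2) -> c * Num.sqrt (Y r) <= p.
  move=> r rst; apply: (step (Num.bound ((r - s) / (d / 2)))) => //.
  rewrite -ler_pdivrMr//; apply/ltW/archi_boundP.
  by rewrite divr_ge0 ?(ltW d2)// subr_ge0; case/andP: rst.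
elim: m => [|m IH] r /andP[sr rt].
  rewrite mul0r subr_le0 => rs; have -> : r = s by apply/eqP; rewrite eq_le rs.
  by rewrite Ys sqrtr0 mulr0.
rewrite -natr1 mulrDl mul1r => rm; apply: h => [|r' /andP[sr' r'r]]; first by rewrite sr.
have [hm|hm] := leP (r' - s) (m%:R * (d / 2)).
  by apply: le_trans (ltW pq); apply: IH => //; rewrite sr' (le_trans r'r).
pose x := s + m%:R * (d / 2).
have sx : s <= x by rewrite lerDl mulr_ge0// ltW.
have xr' : x < r' by rewrite /x -ltrBrDl.
have xt : s <= x <= t by rewrite sx (le_trans (ltW xr'))// (le_trans r'r).
have r't : s <= r' <= t by rewrite sr' (le_trans r'r).
have px : c * Num.sqrt (Y x) <= p by apply: IH; rewrite // /x; lra.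
have := near_le x r' xt r't; rewrite gtr0_norm ?subr_gt0// => /(_ _).
have xd : r' - x < d by move: rm r'r d0; rewrite /x; set y := _ * _; lra.
by move=> /(_ xd); lra.
Qed.

(** Near each point the bound holds for all large [M]; compactness makes one [M] suffice. *)
Lemma locally_bounded_segment (phi : R -> R) a b :
  (forall s, a <= s <= b -> exists2 d, 0 < d & exists M, forall r, a <= r <= b ->
     `|r - s| < d -> phi r <= M) ->
  exists M, forall r, a <= r <= b -> phi r <= M.
Proof.
move=> h; have cab := @segment_compact R a b.
have := (compact_near_coveringP `[a, b]%classic).1 cab R (pinfty_nbhs R)
  (fun M r => a <= r <= b -> phi r <= M) _.
case=> [s|M].
  rewrite /= in_itv /= => sab; have [d d0 [M hM]] := h s sab.
  exists (ball s d, [set x | M <= x]).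
    split => /=; first exact: nbhsx_ballx.
    exists M; split; [exact: num_real|move=> x /ltW//].
  move=> [r x] /= [sr Mx] rab; apply: le_trans (hM r rab _) Mx.
  by rewrite distrC.
case=> Mreal hM; exists (M + 1) => r rab.
by apply: (hM (M + 1)) => //=; rewrite ?ltrDl// in_itv.
Qed.

(** By the intermediate value theorem [F] attains [N] equally spaced levels. The maximum with 1
    serves a constant [F] on [[0, T]] with [T > 0], where one step is still needed. *)
Lemma equal_increment_mesh (F : R -> R) (T k : R) : 0 <= T -> 0 < k -> abs_cont 0 T F ->
  (forall x y, 0 <= x -> x <= y -> y <= T -> F x <= F y) ->
  exists (N : nat) (t : nat -> R),
    [/\ N%:Z <= Num.max 1 (Num.ceil (k * (F T - F 0))), t 0%N = 0, t N = T,
        forall i, (i < N)%N -> t i < t i.+1 &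
        (forall i, (i <= N)%N -> 0 <= t i <= T) /\
        (forall i, (i < N)%N -> k * (F (t i.+1) - F (t i)) <= 1)].
Proof.
move=> T0 k0 acF F_mono; have [T00|Tn0] := eqVneq T 0.
  exists 0%N, (fun=> 0); split=> //; first by rewrite le_max.
  by split=> // i _; rewrite T00 lexx.
have Tp : 0 < T by rewrite lt_def Tn0.
have F0T := F_mono 0 T (lexx 0) T0 (lexx T).
pose L := F T - F 0; have L0 : 0 <= L by rewrite subr_ge0.
have [Le0|Ln0] := eqVneq L 0.
  exists 1%N, (fun i => if i is 0%N then 0 else T); split=> //.
  - by rewrite le_max lexx.
  - by case.
  - split=> [[|i] _|[|i]]//; rewrite ?lexx ?T0//=.
    by rewrite -/L Le0 mulr0.
have Lp : 0 < L by rewrite lt_def Ln0.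
pose c := Num.ceil (k * L).
have c_gt0 : 0 < c by rewrite ceil_gt0 mulr_gt0.
pose N := `|c|%N.
have NE : N%:Z = c by rewrite /N gez0_abs// ltW.
have NR : k * L <= N%:R.
  by rewrite -[N%:R]/(N%:Z%:~R) NE; exact: ceil_ge.
have N0 : (0 < N)%N by rewrite -ltz_nat NE.
have Nr0 : 0 < N%:R :> R by rewrite ltr0n.
have ivt (i : nat) : exists x, (i <= N)%N -> [/\ 0 <= x <= T & F x = F 0 + i%:R / N%:R * L].
  have [iN|iN] := leqP i N; last by exists 0.
  have cF : {within `[0, T], continuous (F \o clamp 0 T)}.
    exact/continuous_subspaceT/(abs_cont_clamp_continuous T0).
  have c0 : clamp 0 T 0 = 0 by rewrite clamp_id// lexx.
  have cT : clamp 0 T T = T by rewrite clamp_id// lexx T0.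
  have q0 : 0 <= i%:R / N%:R :> R by rewrite divr_ge0.
  have q1 : i%:R / N%:R <= 1 :> R by rewrite ler_pdivrMr// mul1r ler_nat.
  have FT : F T = F 0 + L by rewrite /L; ring.
  have [|x xT Fx] := @IVT R (F \o clamp 0 T) 0 T (F 0 + i%:R / N%:R * L) T0 cF.
    rewrite /= c0 cT min_l// max_r// lerDl mulr_ge0//= FT lerD2l.
    by rewrite -[leRHS]mul1r ler_wpM2r.
  exists x => _; split; first by move: xT; rewrite in_itv.
  by rewrite -Fx /= clamp_id//; move: xT; rewrite in_itv.
pose x i := sval (cid (ivt i)).
have xP i : (i <= N)%N -> 0 <= x i <= T /\ F (x i) = F 0 + i%:R / N%:R * L.
  by move=> iN; have [] := svalP (cid (ivt i)) iN.
(* The two ends are imposed, as [F] may be constant near 0 or near [T]. *)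
pose t i := if i == 0%N then 0 else if i == N then T else x i.
have tP i : (i <= N)%N -> 0 <= t i <= T /\ F (t i) = F 0 + i%:R / N%:R * L.
  rewrite /t => iN; have [->|i0] := eqVneq i 0%N.
    by rewrite lexx T0 mul0r mul0r addr0.
  have [->|iN'] := eqVneq i N; last exact: xP.
  by rewrite lexx T0 divff ?gt_eqF// mul1r /L; split=> //; ring.
have tE i : (i < N)%N -> F (t i.+1) - F (t i) = L / N%:R.
  move=> iN; rewrite (tP _ iN).2 (tP _ (ltnW iN)).2 -natr1.
  by field; rewrite gt_eqF.
exists N, t; split.
- by rewrite le_max NE lexx orbT.
- by [].
- by rewrite /t (gtn_eqF N0) eqxx.
- move=> i iN; rewrite ltNge; apply/negP => le_t.
  have [/andP[t0 _] _] := tP _ iN; have [/andP[_ tT] _] := tP _ (ltnW iN).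
  have := F_mono _ _ t0 le_t tT; rewrite -subr_ge0 -opprB tE// oppr_ge0 leNgt.
  by rewrite divr_gt0.
- split=> i iN; first by have [] := tP _ iN.
  by rewrite tE// mulrA ler_pdivrMr// mul1r.
Qed.

End RealAnalysis.

Section DominatedDerivatives.
Variable R : realType.
Variables a b : R.
Hypothesis ab : a < b.
Let lam := @lebesgue_measure R.
Implicit Types (W k : R -> R) (g : R -> R[i]).

Definition ac_density W k : Prop := lam.-integrable setT (EFin \o k) /\
  forall x y, a <= x -> x <= y -> y <= b ->
    (W y - W x)%:E = (\int[lam]_(t in `]x, y]) (k t)%:E)%E.

Lemma ac_densityD W1 k1 W2 k2 : ac_density W1 k1 -> ac_density W2 k2 ->
  ac_density (fun t => W1 t + W2 t) (fun t => k1 t + k2 t).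
Proof.
move=> [i1 e1] [i2 e2]; split=> [|x y ax xy yb].
  rewrite (_ : EFin \o _ = (EFin \o k1) \+ (EFin \o k2))%E; last exact/funext.
  exact: integrableD.
under eq_integral do rewrite EFinD.
have mxy : @measurable _ (measurableTypeR R) `]x, y] by exact: measurable_itv.
have j1 := integrableS measurableT mxy (@subsetT _ _) i1.
have j2 := integrableS measurableT mxy (@subsetT _ _) i2.
by rewrite integralD// -?e1 -?e2//= -EFinD; congr EFin; ring.
Qed.

Lemma ac_density0 : ac_density (fun=> 0) (fun=> 0).
Proof.
split=> [|x y _ _ _]; first exact: integrable0.
by rewrite integral0 subrr.
Qed.

Lemma ac_density_sum (I : Type) (r : seq I) (W k : I -> R -> R) :
  (forall i, ac_density (W i) (k i)) ->
  ac_density (fun t => \sum_(i <- r) W i t) (fun t => \sum_(i <- r) k i t).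
Proof.
move=> h; elim: r => [|i r IH].
  rewrite (_ : (fun t => _) = (fun=> 0)); last by apply/funext => t; rewrite big_nil.
  rewrite (_ : (fun t => \sum_(i <- _) k i t) = (fun=> 0)); first exact: ac_density0.
  by apply/funext => t; rewrite big_nil.
rewrite (_ : (fun t => _) = (fun t => W i t + \sum_(j <- r) W j t)); last first.
  by apply/funext => t; rewrite big_cons.
rewrite (_ : (fun t => \sum_(j <- _) k j t) = (fun t => k i t + \sum_(j <- r) k j t)).
  exact: ac_densityD.
by apply/funext => t; rewrite big_cons.
Qed.

Lemma ae_finite_forall (I : finType) (P : I -> R -> Prop) :
  (forall i, {ae lam, forall t, P i t}) -> {ae lam, forall t, forall i, P i t}.
Proof.
move=> h; have FF := ae_filter_ringOfSetsType lam.
suff : {ae lam, forall t, forall i, i \in enum I -> P i t}.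
  by apply: filterS => t ht i; apply: ht; rewrite mem_enum.
elim: (enum I) => [|i s IH]; first by apply: filterE => t j.
apply: filterS2 (h i) IH => t hi hs j; rewrite inE => /orP[/eqP->//|]; exact: hs.
Qed.

(** [cderive] is unspecified where no derivative exists, so the velocity is only compared, almost
    everywhere, with an integrable [k] whose primitive is [W]. *)
Lemma cabs_cont_dominated g : cabs_cont a b g -> exists W k,
  [/\ abs_cont a b W, ac_density W k, forall t, 0 <= k t &
   {ae lam, forall t, a < t < b ->
     is_cderive t g (cderive g t) /\ normc (cderive g t) <= k t}].
Proof.
move=> [ac1 ac2].
have [h1 [k1 [W1 [[i1 e1] d1 acW1 hk1]]]] := abs_cont_density ab ac1.
have [h2 [k2 [W2 [[i2 e2] d2 acW2 hk2]]]] := abs_cont_density ab ac2.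
exists (fun t => W1 t + W2 t), (fun t => k1 t + k2 t).
split; [exact: abs_contD|exact: ac_densityD| |].
  move=> t; apply: addr_ge0.
    exact: (le_trans (normr_ge0 _) (hk1 t)).
  exact: (le_trans (normr_ge0 _) (hk2 t)).
have := ae_is_derive_density i2 e2; have := ae_is_derive_density i1 e1.
apply: filterS2; first exact: (ae_filter_ringOfSetsType lam).
move=> t D1 D2 tab; have dg : is_cderive t g (h1 t +i* h2 t) by split; [exact: D1|exact: D2].
rewrite (is_cderive_val dg); split; first exact: dg.
by apply: le_trans (normc_le_ReIm (h1 t +i* h2 t)) _; exact: (lerD (hk1 t) (hk2 t)).
Qed.

Lemma cabs_cont_family_dominated (J : finType) (G : J -> R -> R[i]) :
  (forall j, cabs_cont a b (G j)) -> exists W k,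
  [/\ abs_cont a b W, ac_density W k, forall t, 0 <= k t &
   {ae lam, forall t, a < t < b ->
     (forall j, is_cderive t (G j) (cderive (G j) t)) /\
     \sum_j normc (cderive (G j) t) <= k t}].
Proof.
move=> acG; have h j := cabs_cont_dominated (acG j).
pose W j := sval (cid (h j)); have hW j := svalP (cid (h j)).
pose k j := sval (cid (hW j)); have hk j := svalP (cid (hW j)).
exists (fun t => \sum_j W j t), (fun t => \sum_j k j t); split.
- by apply: abs_cont_sum => j; have [] := hk j.
- by apply: ac_density_sum => j; have [] := hk j.
- by move=> t; apply: sumr_ge0 => j _; have [_ _ kj0 _] := hk j; exact: kj0.
- have hae j : {ae lam, forall t, a < t < b -> is_cderive t (G j) (cderive (G j) t) /\
      normc (cderive (G j) t) <= k j t} by have [] := hk j.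
  have := ae_finite_forall hae.
  apply: filterS; first exact: (ae_filter_ringOfSetsType lam).
  move=> t ht tab; split=> [j|]; first by have [] := ht j tab.
  by apply: ler_sum => j _; have [] := ht j tab.
Qed.

End DominatedDerivatives.

Section NormBounds.
Variable R : realType.

Lemma sqrt_sum_sqr_le (I : finType) (y : I -> R) : (forall i, 0 <= y i) ->
  Num.sqrt (\sum_i y i ^+ 2) <= \sum_i y i.
Proof.
move=> y0; have S0 : 0 <= \sum_i y i by exact: sumr_ge0.
rewrite -ler_sqr ?nnegrE ?sqrtr_ge0// sqr_sqrtr; last first.
  by apply: sumr_ge0 => i _; exact: sqr_ge0.
rewrite expr2 mulr_suml; apply: ler_sum => i _; rewrite expr2 ler_wpM2l//.
by rewrite (bigD1 i)//= lerDl sumr_ge0.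
Qed.

Lemma hnorm_le_card (I : finType) (v : I -> R[i]) (k : R) :
  (forall j, normc (v j) <= k) -> hnorm v <= #|I|%:R * k.
Proof.
move=> h; apply: le_trans (sqrt_sum_sqr_le _) _ => [j|]; first exact: normc_ge0.
apply: le_trans (_ : \sum_(j : I) k <= _); first exact: ler_sum.
by rewrite sumr_const mulr_natl.
Qed.

Lemma hnorm_orthogonal_part_le (I : finType) (u e : I -> R[i]) : hnorm u != 0 ->
  hnorm (orthogonal_part u e) <= 2 * hnorm e.
Proof.
move=> u0; have up : 0 < hnorm u by rewrite lt_def u0 hnorm_ge0.
pose c := - (herm e u / (hnorm u ^+ 2)%:C).
rewrite (@eq_hnorm _ _ _ (fun a => e a + c * u a)); last first.
  by move=> a; rewrite /orthogonal_part /c mulNr.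
apply: le_trans (hnormD _ _) _; rewrite mulr2n mulrDl mul1r lerD2l hnormZ.
rewrite /c normcN (normcM (herm e u)) normcV normcR ger0_norm ?sqr_ge0//.
have h := normc_herm_le e u; rewrite expr2 invfM mulrA -mulrA.
by rewrite mulVf// mulr1 ler_pdivrMr.
Qed.

End NormBounds.

Section SpeedBounds.
Variables (R : realType) (n : nat) (n_gt0 : (0 < n)%N).
Variable A : 'I_n -> {fset 'rV[R]_n}.
Hypothesis A_neq0 : forall i, A i != fset0.
Variable rho : forall i : 'I_n, A i -> R.
Hypothesis rho_gt0 : forall i a, 0 < @rho i a.

(** Momenta are convex combinations of the exponents, so the forms [a - m_i(z)] are bounded
    independently of [z]. *)
Lemma normx_le_coordinates : exists2 C : R, 0 <= C &
  forall (z v : 'cV[R[i]]_n) k, 0 <= k -> (forall j, normc (v j 0) <= k) -> normx rho z v <= C * k.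
Proof.
pose c (a : 'rV[R]_n) : R := \sum_j `|a 0 j|.
have c0 a : 0 <= c a by exact: sumr_ge0.
have rowapp_le (a : 'rV[R]_n) (v : 'cV[R[i]]_n) k : (forall j, normc (v j 0) <= k) -> normc (rowapp a v) <= c a * k.
  move=> hv; rewrite rowappE /c mulr_suml; apply: le_trans (normc_sum _ _ _) _.
  by apply: ler_sum => j _; rewrite (normcM _ (v j 0)) normcR ler_wpM2l.
pose C := \sum_i \sum_(a : A i) (c (val a) + \sum_(b : A i) c (val b)).
have prob_le1 z i (a : A i) : prob rho z a <= 1.
  rewrite -(sum_prob A_neq0 rho_gt0 i z) (bigD1 a)//= lerDl.
  by apply: sumr_ge0 => b _; exact: prob_ge0.
exists C; first by apply: sumr_ge0 => i _; apply: sumr_ge0 => a _; rewrite addr_ge0 ?sumr_ge0.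
move=> z v k k0 hv; apply: le_trans (sqrt_sum_sqr_le _) _ => [i|]; first exact: normi_ge0.
rewrite mulr_suml; apply: ler_sum => i _; rewrite (normiE A_neq0 rho_gt0).
apply: le_trans (sqrt_sum_sqr_le _) _ => [a|]; first exact: normc_ge0.
rewrite mulr_suml; apply: ler_sum => a _.
rewrite (normcM _ (mform rho z a v)) normcR ger0_norm ?sqrtr_ge0//.
have p1 : Num.sqrt (prob rho z a) <= 1 by rewrite -sqrtr1; exact: ler_wsqrtr.
apply: le_trans (ler_wpM2r (normc_ge0 _) p1) _; rewrite mul1r.
rewrite /mform rowappBl rowapp_momentum; apply: le_trans (le_normcD _ _) _.
rewrite normcN mulrDl; apply: lerD; first exact: rowapp_le.
apply: le_trans (normc_sum _ _ _) _; rewrite mulr_suml; apply: ler_sum => b _.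
rewrite (normcM _ (rowapp (val b) v)) normcR ger0_norm; last exact: prob_ge0.
rewrite -[leRHS]mul1r; apply: ler_pM; rewrite ?normc_ge0//; last exact: rowapp_le.
exact: prob_ge0.
Qed.

Lemma fsnorm_le_coordinates (m : R) (g dg : system A) (k : R) : 0 < m ->
  (forall i, m <= hnorm (g i)) -> (forall i (e : A i), normc (dg i e) <= k) ->
  fsnorm g dg <= (\sum_i 2 * #|{: A i}|%:R / m) * k.
Proof.
move=> m0 hm hk; have g0 i : 0 < hnorm (g i) by exact: lt_le_trans (hm i).
have fs0 i : 0 <= fsnormi (g i) (dg i).
  by rewrite /fsnormi divr_ge0 ?hnorm_ge0.
apply: le_trans (sqrt_sum_sqr_le fs0) _; rewrite mulr_suml; apply: ler_sum => i _.
have h1 := hnorm_orthogonal_part_le (dg i) (lt0r_neq0 (g0 i)).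
have h2 := hnorm_le_card (hk i).
have k0 : 0 <= #|{: A i}|%:R * k by exact: le_trans (hnorm_ge0 _) h2.
rewrite /fsnormi -/(orthogonal_part (g i) (dg i)) ler_pdivrMr//.
have -> : 2 * #|{: A i}|%:R / m * k * hnorm (g i) = 2 * (#|{: A i}|%:R * k * (hnorm (g i) / m)).
  by ring.
apply: le_trans h1 _; rewrite ler_pM2l//; apply: le_trans h2 _.
by rewrite ler_peMr// ler_pdivlMr// mul1r.
Qed.

Lemma munu_step_up_between f g z z1 : regular_zero rho f z -> regular_zero rho g z1 ->
  path_dist rho f g z (z1 - z) <= 4 / 95 -> munu rho g z1 <= 3 / 2 * munu rho f z.
Proof.
move=> fz gz D1; move: D1 gz; have [h ->] : exists h, z1 = z + h.
  by exists (z1 - z); rewrite addrC subrK.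
have -> : z + h - z = h by rewrite addrAC subrr add0r.
move=> D1 [g0 geq gu]; have [f0 feq fu] := fz.
exact: (munu_step_up n_gt0 A_neq0 rho_gt0 f0 g0 geq fu gu D1).
Qed.

Lemma path_step_down_between f g z z1 (p : R) v : 0 <= p ->
  regular_zero rho f z -> regular_zero rho g z1 ->
  path_dist rho f g z (z1 - z) <= 1 / 20 ->
  munu rho f z * Num.sqrt (p ^+ 2 + normx rho z v ^+ 2) <=
  8 / 5 * (munu rho g z1 * Num.sqrt (p ^+ 2 + normx rho z1 v ^+ 2)).
Proof.
move=> p0 fz gz D1; move: D1 gz; have [h ->] : exists h, z1 = z + h.
  by exists (z1 - z); rewrite addrC subrK.
have -> : z + h - z = h by rewrite addrAC subrr add0r.
move=> D1 [g0 geq gu]; have [f0 feq fu] := fz.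
exact: (path_step_down n_gt0 A_neq0 rho_gt0 f0 g0 geq fu gu v p0 D1).
Qed.

(* If nu = 0 then mu * nu = +oo fails even for singular DS; but then every A i
   is a singleton, and a nonzero f i has no zero. *)
Lemma regular_zeroP f z : solution_variety rho f z -> ~ Sigma' rho f z -> regular_zero rho f z.
Proof.
move=> [f0 fz] hS; split=> //.
have [//|fu] := boolP (DS rho f z \in unitmx); exfalso; apply: hS.
have [nuE nu0 hnu _] := nu_fin A_neq0 rho_gt0 z.
rewrite /Sigma' /mu (negbTE fu) nuE gt0_mulye// lte_fin lt_def nu0 andbT.
apply/eqP => nu00; pose i := Ordinal n_gt0.
have mform0 (a : A i) v : mform rho z a v = 0.
  by apply/eqP; rewrite -normc_eq0 eq_le normc_ge0 andbT -(mul0r (normi rho i z v)) -nu00.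
have mom (a : A i) : val a = momentum rho i z.
  apply/rowP => j; have := mform0 a (delta_mx j 0).
  rewrite /mform rowappE (bigD1 j)//= big1 => [|k kj].
    rewrite [delta_mx _ _ _ _]mxE !eqxx mulr1 addr0 => /(@complexI R).
    by rewrite mxE [(- _ : 'rV[R]_n) _ _]mxE => /eqP; rewrite subr_eq0 => /eqP.
  by rewrite [delta_mx _ _ _ _]mxE (negbTE kj) /= mulr0.
have [a ai] := fset0Pn _ (A_neq0 i); pose a0 : A i := [` ai]%fset.
have all_a (b : A i) : b = a0 by apply: val_inj; rewrite (mom b) -(mom a0).
have := fz i; rewrite /dualapp (bigD1 a0)//= big1 => [|b]; last by rewrite (all_a b) eqxx.
rewrite addr0 ffunE => /eqP; rewrite !mulf_eq0 (negbTE (cexp_neq0 _)) orbF.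
have r0 : (rho a0)%:C != 0 by rewrite (inj_eq (@complexI R)) gt_eqF.
rewrite (negbTE r0) orbF => /eqP fa.
have /eqP := f0 i; apply; apply/ffunP => b; rewrite ffunE (all_a b).
exact: fa.
Qed.

End SpeedBounds.

(** * Length estimates along a regular path *)

Section RegularPath.
Variables (R : realType) (n : nat) (n_gt0 : (0 < n)%N).
Variable A : 'I_n -> {fset 'rV[R]_n}.
Hypothesis A_neq0 : forall i, A i != fset0.
Variable rho : forall i : 'I_n, A i -> R.
Hypothesis rho_gt0 : forall i a, 0 < @rho i a.
Variables (T : R) (f : R -> system A) (z : R -> 'cV[R[i]]_n).
Hypothesis fz_rect : rectifiable f z 0 T.
Hypothesis fz_regular : forall t, 0 <= t <= T -> regular_zero rho (f t) (z t).
Let lam := @lebesgue_measure R.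

Definition path_speed (t : R) : R := Num.sqrt (fsnorm (f t) (velocity_f f t) ^+ 2 +
  normx rho (z t) (velocity_z z t) ^+ 2).

Definition condition_speed (t : R) : \bar R :=
  (mu rho (f t) (z t) * nu rho (z t) * (path_speed t)%:E)%E.

Let fz_munu_ge1 t : 0 <= t <= T -> 1 <= munu rho (f t) (z t).
Proof. by move=> /fz_regular; exact: munu_ge1. Qed.

Lemma condition_speedE t : 0 <= t <= T ->
  condition_speed t = (munu rho (f t) (z t) * path_speed t)%:E.
Proof. by move=> /fz_regular h; rewrite /condition_speed (mu_nuE A_neq0 rho_gt0 h). Qed.

Lemma condition_speed_ge0 t : 0 <= t <= T -> (0 <= condition_speed t)%E.
Proof.
move=> tT; rewrite condition_speedE// lee_fin mulr_ge0 ?sqrtr_ge0//.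
exact: le_trans (fz_munu_ge1 tT).
Qed.

Let f_neq0 t : 0 <= t <= T -> forall i, f t i != 0.
Proof. by move=> /fz_regular[]. Qed.

Let acf i (e : A i) : cabs_cont 0 T (fun t => f t i e).
Proof. by apply: abs_continuous_cabs_cont; have [h _] := fz_rect; exact: h. Qed.

Let acz j : cabs_cont 0 T (fun t => z t j 0).
Proof. by apply: abs_continuous_cabs_cont; have [_ h] := fz_rect; exact: h. Qed.

Let Y s := path_sqdist rho f z (f s) (z s).

Let T_ge0 s : 0 <= s <= T -> 0 <= T.
Proof. by case/andP; exact: le_trans. Qed.

Let acY s : 0 <= s <= T -> abs_cont 0 T (Y s).
Proof.
by move=> sT; apply: abs_cont_path_sqdist => //; exact: (T_ge0 sT).
Qed.

Let Y_self s : 0 <= s <= T -> Y s s = 0.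
Proof.
move=> sT; rewrite /Y /path_sqdist /sin2_sum big1 => [|i _]; last first.
  by apply: sin2_self; rewrite hnorm_ffun_eq0; exact: f_neq0.
have -> : z s - z s = 0 by exact: subrr.
have -> : normx rho (z s) 0 = 0.
  rewrite /normx big1 ?sqrtr0// => i _; rewrite normi_sqr// big1// => a _.
  by rewrite /mform rowappr0 normc0 expr0n mulr0.
by rewrite expr0n add0r.
Qed.

Let path_distE s r : path_dist rho (f s) (f r) (z s) (z r - z s) =
  munu rho (f s) (z s) * Num.sqrt (Y s r).
Proof. by []. Qed.

(** Collecting all coordinates of the system and of the zero in one family [G] gives a single
    exceptional null set and a single majorant. *)
Lemma ae_velocity : 0 < T -> exists W k, [/\ abs_cont 0 T W, ac_density 0 T W k, forall t, 0 <= k t &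
  {ae lam, forall t, 0 < t < T ->
   [/\ forall i (e : A i), is_cderive t (fun s => f s i e) (velocity_f f t i e),
       forall j, is_cderive t (fun s => z s j 0) (velocity_z z t j 0),
       forall i (e : A i), normc (velocity_f f t i e) <= k t &
       forall j, normc (velocity_z z t j 0) <= k t]}].
Proof.
move=> T0; pose G (c : 'I_n + {i : 'I_n & A i}) (t : R) : R[i] :=
  match c with inl j => z t j 0 | inr p => f t (tag p) (tagged p) end.
have acG c : cabs_cont 0 T (G c).
  by case: c => [j|p]; [exact: acz|exact: acf].
have [W [k [acW dk k0 hk]]] := cabs_cont_family_dominated T0 acG.
exists W, k; split=> //.
apply: filterS hk; first exact: (ae_filter_ringOfSetsType lam).
move=> t ht tT; have [hd hs] := ht tT.
have le c : normc (cderive (G c) t) <= k t.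
  apply: le_trans hs; rewrite (bigD1 c)// lerDl.
  by apply: sumr_ge0 => c' _; exact: normc_ge0.
have vf i (e : A i) : velocity_f f t i e = cderive (G (inr (Tagged _ e))) t.
  by rewrite ffunE.
have vz j : velocity_z z t j 0 = cderive (G (inl j)) t by rewrite mxE.
split=> [i e|j|i e|j]; rewrite ?vf ?vz; try exact: le.
  exact: (hd (inr (Tagged (fun i => A i) e))).
exact: (hd (inl j)).
Qed.

(* The derivative of sqrt (path_sqdist + eps) is at most the speed measured at
   z s, which path_step_down compares with the speed measured at z r. *)
Lemma path_dist_le_length s t : 0 <= s -> s <= t -> t <= T ->
  (forall r, s <= r <= t -> path_dist rho (f s) (f r) (z s) (z r - z s) <= 1 / 20) ->
  ((path_dist rho (f s) (f t) (z s) (z t - z s))%:E <=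
   (8 / 5)%:E * \int[lam]_(r in `]s, t]) condition_speed r)%E.
Proof.
move=> s0 st tT hD; rewrite path_distE.
have sT : 0 <= s <= T by rewrite s0 (le_trans st).
have inT r : s <= r <= t -> 0 <= r <= T.
  by move=> /andP[h1 h2]; rewrite (le_trans s0)// (le_trans h2).
set c := munu _ _ _; have c0 : 0 < c := munu_gt0 n_gt0 A_neq0 rho_gt0 (fz_regular sT).
set J := (\int[_]_(r in _) _)%E.
have oc_in r : `]s, t]%classic r -> 0 <= r <= T.
  by rewrite /= in_itv /= => /andP[h1 h2]; apply: inT; rewrite (ltW h1).
have J0 : (0 <= J)%E by apply: integral_ge0 => r /oc_in; exact: condition_speed_ge0.
have [ts|s_neq_t] := eqVneq s t.
  by rewrite -ts Y_self// sqrtr0 mulr0 mule_ge0// lee_fin.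
have st' : s < t by rewrite lt_def eq_sym s_neq_t.
have T0 : 0 < T by apply: le_lt_trans s0 _; apply: lt_le_trans st' tT.
have Y0 r : 0 <= Y s r by exact: path_sqdist_ge0.
apply/lee_addgt0Pr => eta eta0.
(* Chosen so that the loss [c sqrt eps] is the prescribed [eta]. *)
pose eps := (eta / c) ^+ 2; have eps0 : 0 < eps by rewrite exprn_gt0// divr_gt0.
have seps : c * Num.sqrt eps = eta.
  by rewrite sqrtr_sqr gtr0_norm ?divr_gt0// mulrC divfK// gt_eqF.
pose g r := Num.sqrt (Y s r + eps).
have acg : abs_cont s t g.
  apply: (@abs_cont_subinterval _ 0 T s t) => //.
  by apply: abs_cont_sqrt => //; exact: acY.
have [h [_ [_ [[ih hE] _ _ _]]]] := abs_cont_density st' acg.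
have aeh := ae_is_derive_density ih hE.
have [W [k [_ _ _ aev]]] := ae_velocity T0.
(* The measurable minorant of [condition_speed]: [5/8] undoes the factor [8/5], and the positive
   part makes it nonnegative. *)
pose G r : R := 5 / 8 * (c * Num.max (h r) 0).
have mst : @measurable _ (measurableTypeR R) `]s, t] by exact: measurable_itv.
have mh : measurable_fun `]s, t] h.
  by have /measurable_int/measurable_EFinP := integrableS measurableT mst (@subsetT _ _) ih.
have mG : measurable_fun `]s, t] (EFin \o G).
  apply/measurable_EFinP; apply: measurable_funM; first exact: measurable_cst.
  apply: measurable_funM; first exact: measurable_cst.
  by apply: measurable_maxr => //; exact: measurable_cst.
have le_h r : s < r < t -> is_derive r (1 : R) g (h r) ->
    [/\ forall i (e : A i), is_cderive r (fun s => f s i e) (velocity_f f r i e) &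
       forall j, is_cderive r (fun s => z s j 0) (velocity_z z r j 0)] ->
    c * h r <= 8 / 5 * (munu rho (f r) (z r) * path_speed r).
  move=> /andP[sr rt] dg [df dz].
  have rst : s <= r <= t by rewrite !ltW.
  have rT := inT _ rst.
  have [D dD D_le] := @is_derive_path_sqdist R n A A_neq0 rho rho_gt0 f z (f s) (z s) r
    (velocity_f f r) (velocity_z z r) (f_neq0 rT) (f_neq0 sT) df dz.
  have Ye : 0 < Y s r + eps by rewrite ltr_wpDl.
  have dYe : is_derive r (1 : R) (fun x => Y s x + eps) D.
    have := is_deriveD dD (is_derive_cst eps r (1 : R)); by rewrite addr0.
  have dg' : is_derive r (1 : R) g ((2 * Num.sqrt (Y s r + eps))^-1 * D).
    have e := @is_derive1_comp R Num.sqrt (fun x => Y s x + eps) r _ _ (is_derive1_sqrt Ye) dYe.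
    exact: e.
  have hr : h r = (2 * Num.sqrt (Y s r + eps))^-1 * D.
    by rewrite -(@derive_val _ _ _ _ _ _ _ dg) -(@derive_val _ _ _ _ _ _ _ dg').
  set p := fsnorm (f r) (velocity_f f r) in D_le *.
  set q := normx rho (z s) (velocity_z z r) in D_le *.
  have p0 : 0 <= p by exact: sqrtr_ge0.
  have h_le : h r <= Num.sqrt (p ^+ 2 + q ^+ 2).
    rewrite hr ler_pdivrMl ?mulr_gt0 ?sqrtr_gt0//; apply: le_trans D_le _.
    rewrite -mulrA ler_pM2l// ler_wpM2r ?sqrtr_ge0//; apply: ler_wsqrtr.
    by rewrite lerDl ltW.
  apply: le_trans (ler_wpM2l (ltW c0) h_le) _.
  by apply: path_step_down_between => //; [exact: fz_regular|exact: fz_regular|exact: hD].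
have GI : (\int[lam]_(r in `]s, t]) (EFin \o G) r <= J)%E.
  apply: ae_ge0_le_integral_minorant => //.
  - move=> r _; rewrite /= lee_fin /G mulr_ge0//; apply: mulr_ge0; first exact: ltW.
    by rewrite le_max lexx orbT.
  - by move=> r /oc_in; exact: condition_speed_ge0.
  - have aet : {ae lam, forall r, r <> t}.
      exists [set t]; split; [exact: measurable_set1|exact: lebesgue_measure_set1|].
      by move=> r /= /contrapT.
    have FF := ae_filter_ringOfSetsType lam.
    apply: (@filterS3 _ _ FF _ _ _ _ _ aet aeh aev) => r rt dg hv rst.
    have rT := oc_in _ rst; move: rst; rewrite /= in_itv /= => /andP[sr rt'].
    (* The derivatives are known only in the open interval; the right end is a null set. *)
    have {rt'}rt : r < t by rewrite lt_def rt' andbT; apply/eqP => e; exact: rt.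
    rewrite condition_speedE// lee_fin /G.
    have r0T : 0 < r < T by rewrite (le_lt_trans s0)// (lt_le_trans rt).
    have srt : s < r < t by rewrite sr.
    have [df dz _ _] := hv r0T.
    have hc := le_h r srt (dg srt) (conj df dz).
    have := mulr_ge0 (le_trans ler01 (fz_munu_ge1 rT)) (sqrtr_ge0 (fsnorm (f r) (velocity_f f r) ^+ 2 +
      normx rho (z r) (velocity_z z r) ^+ 2)).
    rewrite -/(path_speed r); move: hc; move: (munu _ _ _ * _) => Q hc Q0.
    rewrite maxEle; case: ifP => _; last by lra.
    by rewrite !mulr0.
have ihs := integrableS measurableT mst (@subsetT _ _) ih.
pose hp := ((EFin \o h)^\+)%E.
have ihp : lam.-integrable `]s, t] hp by exact: integrable_funepos.
have gst : ((g t - g s)%:E <= \int[lam]_(r in `]s, t]) hp r)%E.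
  rewrite hE//; apply: le_integral => // r _.
  by rewrite /hp funeposE le_max lexx.
have GE : (\int[lam]_(r in `]s, t]) (EFin \o G) r =
    (5 / 8 * c)%:E * \int[lam]_(r in `]s, t]) hp r)%E.
  rewrite -integralZl//; apply: eq_integral => r _.
  by rewrite /hp funeposE /= /G mulrA EFinM EFin_max.
have k0 : (0 <= (5 / 8 * c)%:E)%E by rewrite lee_fin mulr_ge0// ltW.
have gJ : ((5 / 8 * c * (g t - g s))%:E <= J)%E.
  by apply: le_trans GI; rewrite GE EFinM; exact: lee_wpmul2l.
have gs : c * g s = eta by rewrite /g Y_self// add0r.
have gt : c * Num.sqrt (Y s t) <= c * g t.
  by rewrite ler_pM2l//; apply: ler_wsqrtr; rewrite lerDl ltW.
have {gt} h1 : c * Num.sqrt (Y s t) <= 8 / 5 * (5 / 8 * c * (g t - g s)) + eta.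
  apply: le_trans gt _; rewrite -gs; move: (g t) (g s) => x y.
  by rewrite le_eqVlt; apply/orP; left; apply/eqP; field.
have h2 : (((8 / 5) * (5 / 8 * c * (g t - g s)))%:E <= (8 / 5)%:E * J)%E.
  by rewrite EFinM; apply: lee_wpmul2l => //; rewrite lee_fin.
apply: le_trans (leeD h2 (lexx eta%:E)); rewrite -EFinD lee_fin; exact: h1.
Qed.

Let segment_integral_le s t r : s <= r -> r <= t -> 0 <= s -> t <= T ->
  (\int[lam]_(q in `]s, r]) condition_speed q <=
   \int[lam]_(q in `]s, t]) condition_speed q)%E.
Proof.
move=> sr rt s0 tT; apply: ge0_integral_subset => [q|q] /=; rewrite !in_itv /= => /andP[sq qr].
  by rewrite sq (le_trans qr).
by apply: condition_speed_ge0; rewrite (le_trans s0 (ltW sq)) (le_trans qr).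
Qed.

Lemma path_dist_small s t : 0 <= s -> s <= t -> t <= T ->
  (\int[lam]_(r in `]s, t]) condition_speed r <= (1 / 38)%:E)%E ->
  path_dist rho (f s) (f t) (z s) (z t - z s) <= 4 / 95.
Proof.
move=> s0 st tT hI; have sT : 0 <= s <= T by rewrite s0 (le_trans st).
have c0 : 0 < munu rho (f s) (z s) by exact: (munu_gt0 n_gt0 A_neq0 rho_gt0 (fz_regular sT)).
rewrite path_distE; apply: (@sqrt_continuation _ (Y s) _ (4 / 95) (1 / 20) s t) => //.
- by lra.
- exact: (abs_cont_subinterval s0 tT (acY sT)).
- by move=> r; exact: path_sqdist_ge0.
- exact: Y_self.
- move=> r /andP[sr rt] hD; rewrite -path_distE -lee_fin.
  apply: le_trans (path_dist_le_length s0 sr (le_trans rt tT) hD) _.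
  apply: le_trans (_ : ((8 / 5)%:E * (1 / 38)%:E <= _)%E).
    apply: lee_wpmul2l; first by rewrite lee_fin.
    exact: (le_trans (segment_integral_le sr rt s0 tT) hI).
  by rewrite -EFinM lee_fin; lra.
- by rewrite st lexx.
Qed.

(** Near each [s] the quantity [Y s] is small, so [munu_step_up_between] bounds nearby values by
    [3/2] of the one at [s]; compactness of [[0, T]] replaces any continuity of [mu nu]. *)
Lemma munu_bounded : exists M, forall t, 0 <= t <= T -> munu rho (f t) (z t) <= M.
Proof.
apply: locally_bounded_segment => s sT; set c := munu rho (f s) (z s).
have c0 : 0 < c := munu_gt0 n_gt0 A_neq0 rho_gt0 (fz_regular sT).
have eta0 : 0 < 4 / 95 / c by rewrite divr_gt0.
have [d d0 hd] := abs_cont_uniform (acY sT) (exprn_gt0 2 eta0).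
exists d => //; exists (3 / 2 * c) => r rT rs; apply: munu_step_up_between => //.
- exact: fz_regular.
- exact: fz_regular.
- rewrite path_distE -/c; have := hd s r sT rT rs; rewrite Y_self// subr0 => /ltW hY.
  have h : Num.sqrt (Y s r) <= 4 / 95 / c.
    rewrite -[leRHS](ger0_norm (ltW eta0)) -sqrtr_sqr ler_wsqrtr//.
    exact: (le_trans (ler_norm _) hY).
  by apply: le_trans (ler_wpM2l (ltW c0) h) _; rewrite mulrC divfK// gt_eqF.
Qed.

Let hnorm_bounded_below : 0 <= T ->
  exists2 m, 0 < m & forall t, 0 <= t <= T -> forall i, m <= hnorm (f t i).
Proof.
move=> T0; have hm i : exists2 m, 0 < m & forall t, 0 <= t <= T -> m <= hnorm (f t i) ^+ 2.
  apply: abs_cont_gt0_bounded => // [|t tT].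
    under eq_fun do rewrite hnorm_sqr.
    by apply: abs_cont_sum => e; apply: abs_cont_normc_sqr => //; exact: acf.
  rewrite exprn_gt0// lt_def hnorm_ge0 andbT hnorm_ffun_eq0; exact: f_neq0.
pose m i := Num.sqrt (s2val (cid2 (hm i))).
have m0 i : 0 < m i by rewrite sqrtr_gt0; exact: (s2valP (cid2 (hm i))).
exists (\big[Num.min/1]_i m i).
  by apply/bigmin_gtP; split=> // i _; exact: m0.
move=> t tT i; apply: le_trans (_ : m i <= _); first exact: bigmin_le_cond.
rewrite -[leRHS](ger0_norm (hnorm_ge0 _)) -sqrtr_sqr; apply: ler_wsqrtr.
exact: (s2valP' (cid2 (hm i))).
Qed.

(** With [mu nu] and the norms of the [f_i] under control, the speed is at most a constant times the
    coordinate velocities. This makes the lower integral finite and continuous in its upper end. *)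
Lemma condition_speed_dominated : 0 < T -> exists W k (C : R),
  [/\ 0 <= C, abs_cont 0 T W, ac_density 0 T W k, forall t, 0 <= k t &
   {ae lam, forall t, 0 < t < T -> (condition_speed t <= (C * k t)%:E)%E}].
Proof.
move=> T0; have [W [k [acW dk k0 hk]]] := ae_velocity T0.
have [M hM] := munu_bounded; have [m m0 hm] := hnorm_bounded_below (ltW T0).
have [Cz Cz0 hCz] := normx_le_coordinates A_neq0 rho_gt0.
pose Cf : R := \sum_i 2 * #|{: A i}|%:R / m.
have Cf0 : 0 <= Cf by apply: sumr_ge0 => i _; rewrite !mulr_ge0// invr_ge0 ltW.
have M0 : 0 <= M.
  have T00 : (0 : R) <= 0 <= T by apply/andP; split; [exact: lexx|exact: ltW].
  exact: (le_trans (le_trans ler01 (fz_munu_ge1 T00)) (hM _ T00)).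
exists W, k, (M * (Cf + Cz)); split=> //; first by rewrite mulr_ge0// addr_ge0.
apply: filterS hk; first exact: (ae_filter_ringOfSetsType lam).
move=> t ht tT'; have [_ _ hf hz] := ht tT'.
have tT : 0 <= t <= T by case/andP: tT' => t1 t2; rewrite !ltW.
rewrite condition_speedE// lee_fin -(mulrA M); apply: ler_pM.
- exact: (le_trans ler01 (fz_munu_ge1 tT)).
- exact: sqrtr_ge0.
- exact: hM.
pose p := fsnorm (f t) (velocity_f f t); pose q := normx rho (z t) (velocity_z z t).
have p0 : 0 <= p by exact: sqrtr_ge0.
have q0 : 0 <= q by exact: sqrtr_ge0.
apply: le_trans (_ : p + q <= _).
  rewrite /path_speed -/p -/q -ler_sqr ?nnegrE ?sqrtr_ge0 ?addr_ge0//.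
  rewrite (sqr_sqrtr (addr_ge0 (sqr_ge0 p) (sqr_ge0 q))) sqrrD.
  by rewrite lerD2r lerDl mulrn_wge0// mulr_ge0.
rewrite mulrDl; apply: lerD.
  exact: (fsnorm_le_coordinates m0 (hm t tT) hf).
exact: (hCz _ _ _ (k0 t) hz).
Qed.

Let ae_neq (c : R) : {ae lam, forall t, t <> c}.
Proof.
exists [set c]; split; [exact: measurable_set1|exact: lebesgue_measure_set1|].
by move=> r /= /contrapT.
Qed.

Lemma condition_mesh : 0 <= T -> exists (N : nat) (t : nat -> R),
  [/\ N%:Z <= Num.max 1 (Num.ceil (38 * fine (condition_length rho f z 0 T))),
      t 0%N = 0, t N = T, forall i, (i < N)%N -> t i < t i.+1 &
   (forall i, (i <= N)%N -> 0 <= t i <= T) /\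
   forall i, (i < N)%N ->
     path_dist rho (f (t i)) (f (t i.+1)) (z (t i)) (z (t i.+1) - z (t i)) <= 4 / 95].
Proof.
rewrite le_eqVlt => /orP[/eqP T00|T0].
  exists 0%N, (fun=> 0); split=> //; first by rewrite le_max.
  by split=> // i _; rewrite -T00 lexx.
have [W [k [C [C0 acW [ik kW] k0 hk]]]] := condition_speed_dominated T0.
pose Ck t := (C * k t)%:E.
have iCk (D : set (measurableTypeR R)) : measurable D -> lam.-integrable D Ck.
  move=> mD; have := integrableZl mD C (integrableS measurableT mD (@subsetT _ _) ik).
  by apply: eq_integrable => // x _; rewrite /Ck /= EFinM.
have Ck0 t : (0 <= Ck t)%E by rewrite lee_fin mulr_ge0.
have dom (D : set (measurableTypeR R)) : measurable D -> (forall t, D t -> 0 <= t <= T) ->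
    (\int[lam]_(t in D) condition_speed t <= \int[lam]_(t in D) Ck t)%E.
  move=> mD DT; apply: ae_ge0_integral_le_majorant => //.
  - by have /measurable_int := iCk D mD.
  - by move=> t /DT; exact: condition_speed_ge0.
  - have FF := ae_filter_ringOfSetsType lam.
    apply: (@filterS3 _ _ FF _ _ _ _ _ (ae_neq 0) (ae_neq T) hk) => t t0 tT ht Dt.
    have /andP[h1 h2] := DT t Dt; apply: ht.
    rewrite !lt_def h1 h2 !andbT; apply/andP; split; apply/eqP => e; first exact: t0.
    by apply: tT; exact: esym.
have moc (x y : R) : @measurable _ (measurableTypeR R) `]x, y] by exact: measurable_itv.
have oc_in x y : 0 <= x -> y <= T -> forall t, `]x, y]%classic t -> 0 <= t <= T.
  move=> x0 yT t; rewrite /= in_itv /= => /andP[h1 h2].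
  by rewrite (le_trans x0 (ltW h1)) (le_trans h2).
have fin (D : set (measurableTypeR R)) : measurable D -> (forall t, D t -> 0 <= t <= T) ->
    (\int[lam]_(t in D) condition_speed t)%E \is a fin_num.
  move=> mD DT; rewrite ge0_fin_numE.
    apply: le_lt_trans (dom D mD DT) _; rewrite -ge0_fin_numE ?integral_ge0//.
    by apply: integrable_fin_num => //; exact: iCk.
  by apply: integral_ge0 => t /DT; exact: condition_speed_ge0.
pose I x y := fine (\int[lam]_(t in `]x, y]) condition_speed t)%E.
have IE x y : 0 <= x -> y <= T -> (\int[lam]_(t in `]x, y]) condition_speed t)%E = (I x y)%:E.
  by move=> x0 yT; rewrite /I fineK//; apply: fin => //; exact: oc_in.
have I0 x y : 0 <= x -> y <= T -> 0 <= I x y.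
  move=> x0 yT; rewrite -lee_fin -IE//; apply: integral_ge0 => t /(oc_in _ _ x0 yT).
  exact: condition_speed_ge0.
have I_add x y : 0 <= x -> x <= y -> y <= T -> I 0 y = I 0 x + I x y.
  move=> x0 xy yT; have xT := le_trans xy yT.
  have UE : `]0, y]%classic = `]0, x]%classic `|` `]x, y]%classic :> set R.
    by rewrite -itv_bndbnd_setU// bnd_simp.
  have dU : [disjoint `]0, x]%classic & `]x, y]%classic].
    by apply/disj_setPS => t [] /=; rewrite !in_itv /= => /andP[_ h1] /andP[/lt_geF]; rewrite h1.
  have p0 t : (`]0, x]%classic `|` `]x, y]%classic) t -> (0 <= condition_speed t)%E.
    by rewrite -UE => /(oc_in _ _ (lexx 0) yT); exact: condition_speed_ge0.
  apply/eqP; rewrite eq_le -!lee_fin EFinD -!IE// UE; apply/andP; split.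
    exact: (ge0_integral_setU_le lam (moc 0 x) (moc x y) dU p0).
  apply: (ge0_integral_setU_ge (moc 0 x) (moc x y) dU p0).
  by rewrite -UE IE// ltry.
have I_le x y : 0 <= x -> x <= y -> y <= T -> I x y <= C * (W y - W x).
  move=> x0 xy yT; rewrite -lee_fin -IE//; apply: le_trans (dom _ (moc x y) (oc_in _ _ x0 yT)) _.
  have i1 := integrableS measurableT (moc x y) (@subsetT _ _) ik.
  rewrite EFinM kW//; have <- := integralZl (moc x y) i1 C.
  by have -> : Ck = (fun t => C%:E * (EFin \o k) t)%E by apply/funext => t; rewrite /Ck /= EFinM.
have [||N [t [hN t0 tN t_lt [tT hI]]]] := @equal_increment_mesh _ (I 0) T 38 (ltW T0) (ltr0n _ 38).
- apply: (@abs_cont_lipschitz1 _ _ _ _ W C) => // x y x0 xy yT.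
  have -> : I 0 y - I 0 x = I x y by rewrite (I_add x y)//; ring.
  rewrite ger0_norm ?I0//; apply: le_trans (I_le x y x0 xy yT) _.
  by rewrite ler_wpM2l// ler_norm.
- by move=> x y x0 xy yT; rewrite (I_add x y)// lerDl I0.
exists N, t; split=> //.
  (* The condition length is taken over [[0, T]], hence is at least the integral over []0, T]] used
     for the mesh. *)
  apply: le_trans hN _; rewrite ge_max !le_max lexx /=; apply/orP; right.
  apply: le_ceil; rewrite ler_pM2l//.
  have -> : I 0 0 = 0.
    by rewrite /I set_itv_ge ?integral_set0// bnd_simp ltxx.
  have m0T : @measurable _ (measurableTypeR R) `[0, T] by exact: measurable_itv.
  have cc_in r : `[0, T]%classic r -> 0 <= r <= T by rewrite /= in_itv.
  have fT := fin _ m0T cc_in.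
  rewrite subr0 /I; apply: fine_le.
  - by apply: fin => //; exact: oc_in.
  - exact: fT.
  - apply: ge0_integral_subset => [r|r /cc_in]; last exact: condition_speed_ge0.
    by rewrite /= !in_itv /= => /andP[/ltW-> ->].
split=> // i iN; have ti := tT i (ltnW iN); have ti1 := tT i.+1 iN.
have [ti0 _] := andP ti; have [_ ti1T] := andP ti1; have tlt := ltW (t_lt i iN).
apply: path_dist_small => //; rewrite IE// lee_fin ler_pdivlMr// mulrC.
have := hI i iN; rewrite (I_add (t i) (t i.+1))//.
by rewrite [X in 38 * X]addrAC subrr add0r.
Qed.

End RegularPath.

Lemma powR_half (R : realType) (k : nat) :
  (2 : R) `^ (- 2 ^+ k + 1) = (2^-1) ^+ (2 ^ k).-1.
Proof.
have -> : - 2 ^+ k + 1 = - ((2 ^ k).-1)%:R :> R.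
  by rewrite -subn1 natrB ?expn_gt0// natrX; ring.
by rewrite powRN powR_mulrn// exprVn.
Qed.

Theorem theoremA (R : realType) (n : nat) (hn : (0 < n)%N)
  (A : 'I_n -> {fset 'rV[R]_n}) (hA : forall i, A i != fset0)
  (rho : forall i : 'I_n, A i -> R) (hrho : forall i a, 0 < rho i a)
  (u0 : R) (hu0 : 0 < u0)
  (hu0_eq : u0 + 2 * u0 * (expR (4 * u0) - 1) *
              expR (expR (4 * u0) - 1 - 4 * u0) = (3 - Num.sqrt 7) / 2)
  (T : R) (hT : 0 <= T)
  (f : R -> system A) (z : R -> 'cV[R[i]]_n)
  (hrect : rectifiable f z 0 T)
  (hS0 : forall t : R, 0 <= t <= T -> solution_variety rho (f t) (z t))
  (hSigma : forall t : R, 0 <= t <= T -> ~ Sigma' rho (f t) (z t))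
  (x0 : 'cV[R[i]]_n) (hx0 : approx_cond rho u0 (f 0) (z 0) x0) :
  exists (N : nat) (t : nat -> R) (x : nat -> 'cV[R[i]]_n),
    (N%:Z <= Num.max 1 (Num.ceil (38 * fine (condition_length rho f z 0 T)))) /\
    t 0%N = 0 /\ t N = T /\ (forall i, (i < N)%N -> t i < t i.+1) /\
    x 0%N = x0 /\
    (forall i, (i < N)%N -> newton_defined rho (f (t i)) (x i) /\
                            x i.+1 = newton rho (f (t i)) (x i)) /\
    approx_cond rho u0 (f T) (z T) (x N) /\
    (forall y : nat -> 'cV[R[i]]_n,
       y 0%N = x N -> (forall i, y i.+1 = newton rho (f T) (y i)) ->
       forall i, newton_defined rho (f T) (y i) /\
         M_dist rho (z T) (y i) (z T) <=
           2 `^ (- 2 ^+ i + 1) * M_dist rho (z T) (y 0%N) (z T)).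
Proof.
have fz_regular t (tT : 0 <= t <= T) := regular_zeroP hn hA hrho (hS0 t tT) (hSigma t tT).
have u_ge := u0_ge hu0 hu0_eq; have u_lt := u0_lt hu0_eq.
have [N [t [hN t0 tN t_lt [tT hD]]]] := condition_mesh hn hA hrho hrect fz_regular hT.
pose x := nat_rect (fun=> 'cV[R[i]]_n) x0 (fun i y => newton rho (f (t i)) y).
have inT0 : 0 <= t 0%N <= T by exact: tT.
(* The invariant at the mesh points: Newton's step uses the system at [t i], and its result is
   measured at [t i.+1]. *)
have hx i : (i <= N)%N ->
    munu rho (f (t i)) (z (t i)) * M_dist rho (z (t i)) (z (t i)) (x i) <= 2 * u0.
  elim: i => [_|i IH iN].
    rewrite t0 in inT0 *; exact: (approx_condE hA hrho u0 x0 (fz_regular 0 inT0)).1.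
  exact: (homotopy_step hn hA hrho u_ge u_lt (fz_regular _ (tT i (ltnW iN)))
    (fz_regular _ (tT _ iN)) (hD i iN) (IH (ltnW iN))).2.
have TT : 0 <= T <= T by rewrite hT lexx.
have hxN : munu rho (f T) (z T) * M_dist rho (z T) (z T) (x N) <= 2 * u0.
  by have := hx N (leqnn N); rewrite tN.
exists N, t, x; split; first exact: hN.
split; first exact: t0.
split; first exact: tN.
split; first exact: t_lt.
split; first exact: erefl.
split.
  move=> i iN; split; last exact: erefl.
  exact: (homotopy_step hn hA hrho u_ge u_lt (fz_regular _ (tT i (ltnW iN)))
    (fz_regular _ (tT _ iN)) (hD i iN) (hx i (ltnW iN))).1.
split; first exact: (approx_condE hA hrho u0 (x N) (fz_regular T TT)).2.
move=> y y0 yS i; rewrite powR_half.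
have hy0 : munu rho (f T) (z T) * M_dist rho (z T) (z T) (y 0%N) <= 2 * u0 by rewrite y0.
exact: (newton_converges hn hA hrho u_lt (fz_regular T TT) hy0 yS i).
Qed.
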